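(* There exists a universal constant $C>0$ such that for every $\Lambda>0$ and every periodic function $u:[0,\Lambda]^2\to\mathbb{R}$ with $u\ge -1$ and $\int_{[0,\Lambda]^2}u\,dx=0$, $$\big\|u\,\ln^{\frac14}\max\{u,e\}\big\|_{\frac43}\;\le\; C\,\|\nabla u\|_1^{\frac12}\,\big\||\nabla|^{-1}u\big\|_2^{\frac12}.$$
   Context: Periodic means $\Lambda$-periodic in each coordinate, i.e. $u$ is a function on the torus $[0,\Lambda]^2$. $\ln^{\frac14}s$ means $(\ln s)^{1/4}$. $\|f\|_p=\left(\int_{[0,\Lambda]^2}|f|^p\,dx\right)^{1/p}$ (integral, not average). $\|\nabla u\|_1=\int_{[0,\Lambda]^2}|\nabla u|\,dx$, understood as the total variation of the distributional gradient on the torus when $u$ is merely of bounded variation. For periodic $u$ with vanishing average, $\||\nabla|^{-1}u\|_2$ is the homogeneous $\dot H^{-1}$-norm, given by $$\||\nabla|^{-1}u\|_2^2=\inf\left\{\int_{[0,\Lambda]^2}|j|^2\,dx\;:\; j \text{ periodic vector field},\ \nabla\cdot j=u\right\}=\int_{[0,\Lambda]^2}|\nabla\varphi|^2\,dx,$$ where $\varphi$ is the periodic solution of $-\Delta\varphi=u$. The inequality is understood for $u$ such that the right-hand side quantities are finite. *)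

(* Defs.v *)
From HB Require Import structures.
From mathcomp Require Import all_boot all_order all_algebra.
From mathcomp Require Import all_classical all_reals all_analysis.

Set Implicit Arguments.
Unset Strict Implicit.
Unset Printing Implicit Defensive.

Import Order.TTheory GRing.Theory Num.Theory.
Import numFieldNormedType.Exports.

Local Open Scope classical_set_scope.
Local Open Scope ring_scope.

Section torus.
Context {R : realType}.
Implicit Types (L : R) (f g u : R * R -> R).

Definition leb2 := (@lebesgue_measure R \x @lebesgue_measure R)%E.

Definition cell L : set (R * R) := `[0, L] `*` `[0, L].

Definition biperiodic L f : Prop :=
  forall x y, f (x + L, y) = f (x, y) /\ f (x, y + L) = f (x, y).

Definition pdx f : R * R -> R := fun z => 'D_((1, 0) : R * R) f z.
Definition pdy f : R * R -> R := fun z => 'D_((0, 1) : R * R) f z.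

Definition C1 f : Prop :=
  [/\ forall z, derivable f z ((1, 0) : R * R),
      forall z, derivable f z ((0, 1) : R * R),
      continuous (pdx f)
    & continuous (pdy f)].

Definition cell_integrable L f : Prop :=
  leb2.-integrable (cell L) (EFin \o f).

(* Total variation on the torus of the distributional gradient of [u], with
   respect to the Euclidean norm on the plane; [+oo] when [u] is not of bounded
   variation.  Meaningful when [u] is integrable on the cell. *)
Definition torus_variation L u : \bar R :=
  ereal_sup [set v | exists f g : R * R -> R,
    [/\ C1 f /\ biperiodic L f,
        C1 g /\ biperiodic L g,
        forall z, f z ^+ 2 + g z ^+ 2 <= 1
      & v = (\int[leb2]_(z in cell L) (u z * (pdx f z + pdy g z))%:E)%E]].

(* The divergence on the torus of the field [(j1, j2)] is [u], in the sense of
   distributions; the test functions are periodic, not compactly supported in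
   the cell. *)
Definition weak_div L (j1 j2 u : R * R -> R) : Prop :=
  forall f, C1 f -> biperiodic L f ->
    (\int[leb2]_(z in cell L) (j1 z * pdx f z + j2 z * pdy f z)%:E =
     - \int[leb2]_(z in cell L) (u z * f z)%:E)%E.

(* The homogeneous H^-1 norm on the torus; the infimum over the empty set is
   [+oo]. *)
Definition Hm1_norm L u : \bar R :=
  (ereal_inf [set v | exists j1 j2 : R * R -> R,
    [/\ cell_integrable L j1 /\ biperiodic L j1,
        cell_integrable L j2 /\ biperiodic L j2,
        weak_div L j1 j2 u
      & v = \int[leb2]_(z in cell L) (j1 z ^+ 2 + j2 z ^+ 2)%:E]] `^ 2^-1)%E.

Definition cell_Lnorm L (p : R) f : \bar R :=
  Lnorm leb2 p%:E (EFin \o (f \_ (cell L))).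

End torus.

(* Main.v *)
(* Cut [u] at the levels 8^k.  A high level is smoothed at the length
   1 / (2^k k^(1/3)); the total variation controls the smoothing error, while the
   smoothed levels are dominated by the maximum of multiples of logarithmic
   cutoffs, whose Dirichlet energies gain the factor 1/k of the planar capacity
   and add up to at most the weighted measure of the levels.  Pairing [u] with
   this maximum and using the H^-1 duality yields the k^(1/3), that is the
   logarithm to the power 1/3 inside the integral of |u|^(4/3).  At low levels no
   logarithm is needed: smoothed truncations are added up instead, and a
   geometric sum replaces the maximum.  The argument is carried out for means of
   [u] on a finite grid, where everything is a finite sum; the means are taken
   against a periodic C^1 partition of unity which is stable under difference
   quotients, so that both norms pass to the grid.  Lebesgue differentiation and
   Fatou's lemma bring the estimate back to [u], and a dilation by lambda is
   optimized at the end. *)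
Require Import Defs.
From HB Require Import structures.
From mathcomp Require Import all_boot all_order all_algebra.
From mathcomp Require Import all_classical all_reals all_analysis.
From mathcomp Require Import measurable_realfun.
From mathcomp Require Import ring lra zify.

Set Implicit Arguments.
Unset Strict Implicit.
Unset Printing Implicit Defensive.

Import Order.TTheory GRing.Theory Num.Theory.
Import numFieldNormedType.Exports.

Local Open Scope classical_set_scope.
Local Open Scope ring_scope.

(** * Moving averages on a finite torus *)

(** Both level estimates are self-referential: the weighted measure of the levels occurs on both
    sides and is absorbed, which is legitimate because on a grid it is a finite sum. Most numerical
    constants come from this absorption.

    The exponent 1/3 is a balance. Let level 8^k have inverse smoothing length 2^k l, hence weight
    16^k l. A cutoff built from M dyadic scales costs the energy 16^k l^4 / M per unit of measure,
    and equality with the weight means l^3 = M. The lower bound -1 limits M: the cutoff spreads over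
    a set larger by the factor 4^M, where the function may be as low as -1, and this loss must stay
    below the gain 8^k. M = k is admissible, and k is the logarithm of the height.

    The lower bound also confines the negative part to the low levels, which are therefore
    two-sided. They do not close alone: their smoothing error is paired with |u|, which may be
    large. The part of |u| on higher low levels is absorbed, the part beyond them is paid by the
    high levels, and what exceeds the top level vanishes in the limit by dominated convergence. *)

Section moving_average.
Context {R : realFieldType} {T : finZmodType}.
Implicit Types (e d : T) (n m : nat) (f g : T -> R).

(** The window is one-sided, from [z] on, which makes its increments telescope; where its position
    matters, an explicit shift is added. *)
Definition mavg e n f z : R := n%:R^-1 * \sum_(i < n) f (z + e *+ i).

Lemma sum_shift d f : \sum_z f (z + d) = \sum_z f z.
Proof. by rewrite [RHS](reindex_inj (addIr d)). Qed.

Lemma ler_mavg e n f g z : (forall w, f w <= g w) -> mavg e n f z <= mavg e n g z.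
Proof.
by move=> fg; rewrite ler_wpM2l ?invr_ge0 ?ler0n// ler_sum.
Qed.

Lemma mavgB e n f g z :
  mavg e n (fun w => f w - g w) z = mavg e n f z - mavg e n g z.
Proof. by rewrite /mavg sumrB mulrBr. Qed.

Lemma mavgZ e n c f z : mavg e n (fun w => c * f w) z = c * mavg e n f z.
Proof. by rewrite /mavg -mulr_sumr mulrCA. Qed.

Lemma mavg_cst e n c z : (0 < n)%N -> mavg e n (fun=> c) z = c.
Proof.
move=> n0; rewrite /mavg sumr_const card_ord -[c *+ n]mulr_natl mulKf//.
by rewrite pnatr_eq0 -lt0n.
Qed.

Lemma normr_mavg e n f z : `|mavg e n f z| <= mavg e n (fun w => `|f w|) z.
Proof.
rewrite /mavg normrM ger0_norm ?invr_ge0 ?ler0n//.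
by rewrite ler_wpM2l ?invr_ge0 ?ler0n// ler_norm_sum.
Qed.

Lemma mavg_shift e n d f z : mavg e n f (z + d) = mavg e n (fun w => f (w + d)) z.
Proof. by congr (_ * _); apply: eq_bigr => i _; rewrite addrAC. Qed.

Lemma mavgC e d n m f z :
  mavg e n (mavg d m f) z = mavg d m (mavg e n f) z.
Proof.
rewrite /mavg -!mulr_sumr mulrCA; congr (_ * (_ * _)).
rewrite exchange_big; apply: eq_bigr => i _; apply: eq_bigr => j _.
by rewrite addrAC.
Qed.

Lemma sum_mavg e n f : (0 < n)%N -> \sum_z mavg e n f z = \sum_z f z.
Proof.
move=> n0; rewrite -mulr_sumr exchange_big /=.
under eq_bigr do rewrite sum_shift.
rewrite sumr_const card_ord -[X in _ * X]mulr_natl mulKf//.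
by rewrite pnatr_eq0 -lt0n.
Qed.

Lemma mavg_bound e n f M z : (0 < n)%N ->
  (forall w, `|f w| <= M) -> `|mavg e n f z| <= M.
Proof.
move=> n0 fM; apply: le_trans (normr_mavg _ _ _ _) _.
by rewrite -[leRHS](mavg_cst e M z n0) ler_mavg.
Qed.

Lemma sum_normr_mavg e n f : (0 < n)%N ->
  \sum_z `|mavg e n f z| <= \sum_z `|f z|.
Proof.
move=> n0; rewrite -[leRHS](sum_mavg e _ n0); apply: ler_sum => z _.
exact: normr_mavg.
Qed.

(** Only the two ends of the window survive. Differentiating a mean over [n] steps thus costs a
    factor 1/n and leaves an increment of [f] itself, to be bounded by its oscillation or its
    mass. *)
Lemma mavg_diff e n f z : (0 < n)%N ->
  n%:R * (mavg e n f (z + e) - mavg e n f z) = f (z + e *+ n) - f z.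
Proof.
move=> n0; rewrite /mavg -mulrBr mulVKf ?pnatr_eq0 -?lt0n//.
rewrite -sumrB.
under eq_bigr do rewrite -addrA -mulrS.
rewrite -(big_mkord xpredT (fun i => f (z + e *+ i.+1) - f (z + e *+ i))).
by rewrite (telescope_sumr (fun i => f (z + e *+ i)))// mulr0n addr0.
Qed.

Lemma sum_normr_shift e n f :
  \sum_z `|f (z + e *+ n) - f z| <= n%:R * \sum_z `|f (z + e) - f z|.
Proof.
elim: n => [|n IH].
  by rewrite mul0r big1// => z _; rewrite mulr0n addr0 subrr normr0.
rewrite -[n.+1%:R]natr1 mulrDl mul1r; apply: le_trans (lerD IH (lexx _)).
rewrite -(sum_shift (e *+ n) (fun z => `|f (z + e) - f z|)) -big_split/=.
apply: ler_sum => z _; rewrite mulrSr addrA [leRHS]addrC.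
exact: ler_distD.
Qed.

(** A mean differs from the value by increments over fewer than [n] steps, and translation
    invariance of the sum reduces each of these to single steps. *)
Lemma sum_mavg_diff e n f : (0 < n)%N ->
  \sum_z `|mavg e n f z - f z| <= n%:R * \sum_z `|f (z + e) - f z|.
Proof.
move=> n0; set w := \sum_z `|f (z + e) - f z|.
have w0 : 0 <= w by exact: sumr_ge0.
apply: (@le_trans _ _ (n%:R^-1 * \sum_(i < n) \sum_z `|f (z + e *+ i) - f z|)).
  rewrite exchange_big/= mulr_sumr; apply: ler_sum => z _.
  rewrite -[X in _ - X](mavg_cst e (f z) z n0) -mavgB.
  exact: normr_mavg.
rewrite ler_pdivrMl ?ltr0n//.
apply: (@le_trans _ _ (\sum_(i < n) (n%:R * w))).
  apply: ler_sum => i _; apply: le_trans (sum_normr_shift _ _ _) _.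
  by rewrite ler_wpM2r// ler_nat ltnW.
by rewrite sumr_const card_ord -[leLHS]mulr_natl.
Qed.

Definition mavg2 e d n m f := mavg e n (mavg d m f).

Lemma mavg2C e d n m f z : mavg2 e d n m f z = mavg2 d e m n f z.
Proof. exact: mavgC. Qed.

Lemma sum_mavg2_diff e d n m f : (0 < n)%N -> (0 < m)%N ->
  \sum_z `|mavg2 e d n m f z - f z| <=
  n%:R * \sum_z `|f (z + e) - f z| + m%:R * \sum_z `|f (z + d) - f z|.
Proof.
move=> n0 m0; rewrite addrC.
apply: le_trans (lerD (sum_mavg_diff d f m0) (sum_mavg_diff e f n0)).
apply: le_trans (lerD (sum_normr_mavg e (fun z => mavg d m f z - f z) n0) (lexx _)).
rewrite -big_split/=; apply: ler_sum => z _.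
by rewrite mavgB ler_distD.
Qed.

(** Since [q] doubles, the partial sum before [n] is at most [M * q n]. The cross term in the square
    therefore costs 2M and the diagonal term M, and no factor [N] is lost as it would be with the
    Cauchy-Schwarz inequality. *)
Lemma geometric_square (N : nat) (q a : nat -> R) (M : R) :
    (forall i, 0 <= q i) -> (forall i, 2 * q i <= q i.+1) ->
    (forall i, 0 <= a i <= M) ->
  (\sum_(i < N) q i * a i) ^+ 2 <= 3 * M * \sum_(i < N) q i ^+ 2 * a i.
Proof.
move=> q0 q2 aM.
have M0 : 0 <= M by have /andP[/le_trans] := aM 0; apply.
have s0 n : 0 <= \sum_(i < n) q i * a i.
  by apply: sumr_ge0 => i _; rewrite mulr_ge0//; case/andP: (aM i).
have sM n : \sum_(i < n) q i * a i <= M * q n.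
  elim: n => [|n IH]; first by rewrite big_ord0 mulr_ge0.
  rewrite big_ord_recr/=; have := q2 n; have := q0 n.
  have /andP[a0 a1] := aM n => qn qn2.
  have : q n * a n <= q n * M by rewrite ler_wpM2l.
  have : M * (2 * q n) <= M * q n.+1 by rewrite ler_wpM2l.
  lra.
elim: N => [|n IH]; first by rewrite !big_ord0 expr0n mulr0.
rewrite !big_ord_recr/= sqrrD mulrDr.
have /andP[a0 a1] := aM n.
have qa : 0 <= q n * a n by rewrite mulr_ge0.
have : (\sum_(i < n) q i * a i) * (q n * a n) <= M * q n * (q n * a n).
  by rewrite ler_wpM2r.
have : (q n * a n) ^+ 2 <= M * (q n ^+ 2 * a n).
  rewrite -subr_ge0 (_ : _ - _ = q n ^+ 2 * (a n * (M - a n))); last by ring.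
  by rewrite mulr_ge0 ?sqr_ge0// mulr_ge0// subr_ge0.
move: IH; set s := \sum_(i < n) _; set t := \sum_(i < n) _; lra.
Qed.

End moving_average.

(** * Dirichlet energies of sums and maxima *)

Section energy.
Context {R : realFieldType} {T : finZmodType}.
Implicit Types (e d : T) (f g : T -> R).

Definition energy e (h : R) f := \sum_z ((f (z + e) - f z) / h) ^+ 2.

(** By [mavg_diff], the i-th difference quotient is at most [q i] times a mean of increments of
    [g i], bounded by the oscillation [M], and [geometric_square] applies at each point. The
    remaining factor 2 in 6 is the mass of an increment against that of [g i]. The low levels use it
    with varying [g i] and no shifts, the logarithmic cutoffs with equal coefficients. *)
Lemma energy_sum_mavg2 e d (N : nat) (h M : R) (c q : nat -> R)
    (n m : nat -> nat) (g : nat -> T -> R) (s : nat -> T) :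
    0 < h -> (forall i, (0 < n i)%N) -> (forall i, (0 < m i)%N) ->
    (forall i, 0 <= q i) -> (forall i, 2 * q i <= q i.+1) ->
    (forall i, 0 <= c i <= q i * (h * (n i)%:R)) ->
    (forall i z w, `|g i z - g i w| <= M) ->
  energy e h (fun z => \sum_(i < N) c i * mavg2 e d (n i) (m i) (g i) (z + s i))
  <= 6 * M * \sum_(i < N) q i ^+ 2 * \sum_z `|g i z|.
Proof.
move=> h0 n0 m0 q0 q2 cq gM.
pose a i z := `|mavg d (m i) (fun w => g i (w + e *+ n i) - g i w) (z + s i)|.
have M0 : 0 <= M by apply: le_trans (gM 0 0 0); rewrite normr_ge0.
have aM i z : 0 <= a i z <= M by rewrite normr_ge0 mavg_bound.
have step z : `|(\sum_(i < N) c i * mavg2 e d (n i) (m i) (g i) (z + e + s i)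
    - \sum_(i < N) c i * mavg2 e d (n i) (m i) (g i) (z + s i)) / h|
    <= \sum_(i < N) q i * a i z.
  rewrite -sumrB mulr_suml; apply: le_trans (ler_norm_sum _ _ _) _.
  apply: ler_sum => i _; rewrite -mulrBr addrAC.
  have := mavg_diff e (mavg d (m i) (g i)) (z + s i) (n0 i).
  rewrite (mavg_shift d _ (e *+ n i)) -mavgB => E.
  have ni0 : 0 < (n i)%:R :> R by rewrite ltr0n.
  set D := mavg2 _ _ _ _ _ _ - _.
  have {E} -> : a i z = (n i)%:R * `|D|.
    by rewrite /a -E normrM (ger0_norm (ltW ni0)).
  have /andP[ci0 ciq] := cq i.
  rewrite !normrM normfV (ger0_norm ci0) (gtr0_norm h0) ler_pdivrMr//.
  by rewrite -!mulrA mulrCA; apply: le_trans (ler_wpM2r (normr_ge0 D) ciq) _;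
     rewrite le_eqVlt; apply/orP; left; apply/eqP; ring.
apply: (@le_trans _ _ (\sum_z 3 * M * \sum_(i < N) q i ^+ 2 * a i z)).
  apply: ler_sum => z _.
  apply: le_trans (geometric_square N q0 q2 (aM ^~ z)).
  rewrite -[leLHS]real_normK ?num_real//.
  rewrite lerXn2r ?nnegrE ?normr_ge0 ?step//.
  by apply: sumr_ge0 => i _; rewrite mulr_ge0//; case/andP: (aM i z).
rewrite -mulr_sumr exchange_big/=.
rewrite (_ : 6 * M = 3 * M * 2); last by ring.
rewrite -[leRHS]mulrA ler_wpM2l ?mulr_ge0// mulr_sumr.
apply: ler_sum => i _; rewrite -mulr_sumr mulrCA ler_wpM2l ?sqr_ge0//.
rewrite (sum_shift (s i) (fun z => `|mavg d (m i)
  (fun w => g i (w + e *+ n i) - g i w) z|)).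
apply: le_trans (sum_normr_mavg _ _ (m0 i)) _.
rewrite mulr_natl mulr2n -[X in _ <= X + _](sum_shift (e *+ n i)) -big_split/=.
by apply: ler_sum => z _; exact: ler_normB.
Qed.

Lemma eq_energy e h f g : f =1 g -> energy e h f = energy e h g.
Proof. by move=> fg; apply: eq_bigr => z _; rewrite !fg. Qed.

Lemma energyC_sum_mavg2 e d (N : nat) (h M : R) (c q : nat -> R)
    (n m : nat -> nat) (g : nat -> T -> R) (s : nat -> T) :
    0 < h -> (forall i, (0 < n i)%N) -> (forall i, (0 < m i)%N) ->
    (forall i, 0 <= q i) -> (forall i, 2 * q i <= q i.+1) ->
    (forall i, 0 <= c i <= q i * (h * (m i)%:R)) ->
    (forall i z w, `|g i z - g i w| <= M) ->
  energy d h (fun z => \sum_(i < N) c i * mavg2 e d (n i) (m i) (g i) (z + s i))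
  <= 6 * M * \sum_(i < N) q i ^+ 2 * \sum_z `|g i z|.
Proof.
move=> h0 n0 m0 q0 q2 cq gM.
apply: le_trans (@energy_sum_mavg2 d e N h M c q m n g s _ _ _ _ _ _ _) => //.
rewrite le_eqVlt (eq_energy d h (g := fun z =>
  \sum_(i < N) c i * mavg2 d e (m i) (n i) (g i) (z + s i))) ?eqxx// => z.
by apply: eq_bigr => i _; rewrite mavg2C.
Qed.

(** If both maxima are attained in the same argument, one term suffices. If the maximum switches
    between neighbours, the difference of the maxima lies between the two differences. Hence the
    energy of a maximum is at most the sum of the energies. *)
Lemma sqr_max_le (x y x' y' : R) :
  (Num.max x y - Num.max x' y') ^+ 2 <= (x - x') ^+ 2 + (y - y') ^+ 2.
Proof.
have := sqr_ge0 (x - x'); have := sqr_ge0 (y - y').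
case: (leP x y) => xy; case: (leP x' y') => xy'; [lra| | |lra].
- by have [h|h] := leP x' y; nra.
- by have [h|h] := leP x y'; nra.
Qed.

Fixpoint maxf (N : nat) (x : nat -> R) : R :=
  if N is n.+1 then Num.max (maxf n x) (x n) else 0.

Lemma maxf_ge0 N x : 0 <= maxf N x.
Proof. by elim: N => //= N IH; rewrite le_max IH. Qed.

Lemma ler_maxf N x k : (k < N)%N -> x k <= maxf N x.
Proof.
elim: N => //= N IH; rewrite ltnS leq_eqVlt => /orP[/eqP ->|/IH kN].
  by rewrite le_max lexx orbT.
by rewrite le_max kN.
Qed.

Lemma maxf_le_sum N x : (forall k, 0 <= x k) -> maxf N x <= \sum_(k < N) x k.
Proof.
move=> x0; elim: N => [|N IH] /=; first by rewrite big_ord0.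
have : 0 <= \sum_(k < N) x k by apply: sumr_ge0.
have := x0 N.
by rewrite big_ord_recr/= ge_max; move: IH; set s := \sum_(_ < _) _; lra.
Qed.

Lemma energy_maxf e h N (f : nat -> T -> R) :
  energy e h (fun z => maxf N (f ^~ z)) <= \sum_(k < N) energy e h (f k).
Proof.
rewrite exchange_big/=; apply: ler_sum => z _.
have step x y : (maxf N x - maxf N y) ^+ 2 <= \sum_(k < N) (x k - y k) ^+ 2.
  elim: N => [|n IH] /=; first by rewrite big_ord0 subrr expr0n.
  by rewrite big_ord_recr/=; apply: le_trans (sqr_max_le _ _ _ _) _; rewrite lerD2r.
under [leRHS]eq_bigr do rewrite exprMn.
by rewrite exprMn -mulr_suml ler_wpM2r ?sqr_ge0.
Qed.

Lemma energyZ e h c f : energy e h (fun z => c * f z) = c ^+ 2 * energy e h f.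
Proof.
by rewrite mulr_sumr; apply: eq_bigr => z _; rewrite -mulrBr -mulrA exprMn.
Qed.

End energy.

Section window.
Context {R : realFieldType} {T : finZmodType}.
Implicit Types (e d : T) (f g : T -> R).

(** The shifted window is part of the [r] times longer one, so nonnegativity gives the bound, with
    the ratio of the lengths as the price. *)
Lemma mavg_window e n r k f w : (0 < n)%N -> (k + n <= r * n)%N ->
  (forall z, 0 <= f z) ->
  mavg e n f (w + e *+ k) <= r%:R * mavg e (r * n) f w.
Proof.
move=> n0 kn f0.
have r0 : (0 < r)%N by case: r kn => //; rewrite mul0n; lia.
rewrite /mavg natrM invfM mulrA mulVKf ?pnatr_eq0 -?lt0n//.
rewrite ler_wpM2l ?invr_ge0//.
rewrite -!(big_mkord xpredT (fun i => f (_ + e *+ i))).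
rewrite [leRHS](big_cat_nat (n := k))//=; [|lia].
rewrite [X in _ <= _ + X](big_cat_nat (n := (k + n)%N))//=; [|lia].
rewrite [leRHS]addrCA -[leLHS]addr0 lerD//; last by rewrite addr_ge0// sumr_ge0.
have := big_addn 0%N (k + n) k xpredT (fun i => f (w + e *+ i)).
rewrite add0n addKn => ->.
by apply: ler_sum => i _; rewrite -addrA -mulrnDr addnC.
Qed.

(* The large window contains the small one. *)
Lemma mavg2_window e d n m r a b f z : (0 < n)%N -> (0 < m)%N -> (0 < r)%N ->
  (a <= r * n)%N -> (b <= r * m)%N -> (forall w, 0 <= f w) ->
  mavg2 e d n m f z <= (r * 2)%:R ^+ 2 *
    mavg2 e d (r * 2 * n) (r * 2 * m) f
      (z - e *+ (r * n) - d *+ (r * m) + e *+ a + d *+ b).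
Proof.
move=> n0 m0 r0 an bm f0.
set w := z - _ - _ + _ + _.
have zE : z = w + d *+ (r * m - b) + e *+ (r * n - a).
  rewrite /w -addrA -[_ + d *+ b + _]addrA.
  rewrite (addrA (d *+ b)) -mulrnDr subnKC// (addrC (d *+ _)) addrA.
  rewrite -(addrA _ (e *+ a)) -mulrnDr subnKC//.
  by rewrite (addrAC _ (- _) (e *+ _)) subrK subrK.
have g0 u : 0 <= mavg d m f u.
  by rewrite mulr_ge0 ?invr_ge0// sumr_ge0.
rewrite {1}zE /mavg2 expr2 -mulrA.
apply: (le_trans (y := (r * 2)%:R * mavg e (r * 2 * n) (mavg d m f)
  (w + d *+ (r * m - b)))).
  by apply: mavg_window => //; nia.
rewrite ler_wpM2l// -mavgZ mavg_shift; apply: ler_mavg => u.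
by apply: mavg_window => //; nia.
Qed.

End window.

(** * Truncations and sums over levels *)

Section truncation.
Context {R : realFieldType}.
Implicit Types (a b c s t : R).

Definition clamp a b t := Num.min b (Num.max a t).

Lemma clampP a b t : a <= b ->
  [\/ t <= a /\ clamp a b t = a, (a <= t <= b) /\ clamp a b t = t
    | b <= t /\ clamp a b t = b].
Proof.
rewrite /clamp => ab; have [ta|ta] := leP t a.
  by constructor 1; rewrite (min_idPr ab).
by have [tb|tb] := leP b t; [constructor 3|constructor 2; rewrite (ltW ta) ltW].
Qed.

Lemma clamp_lip a b s t : a <= b -> s <= t ->
  0 <= clamp a b t - clamp a b s <= t - s.
Proof.
move=> ab st; have := clampP s ab; have := clampP t ab.
by move=> [] [] + -> [] [] + ->; lra.
Qed.

Lemma clamp_bound a b t : a <= b -> a <= clamp a b t <= b.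
Proof. by move=> ab; have := clampP t ab; move=> [] [] + ->; lra. Qed.

Lemma clampD a b c t : a <= b -> b <= c ->
  clamp a b t + clamp b c t = clamp a c t + b.
Proof.
move=> ab bc; have := clampP t ab; have := clampP t bc.
have := clampP t (le_trans ab bc).
by move=> [] [] + -> [] [] + -> [] [] + ->; lra.
Qed.

(** Monotonicity gives all the increments the same sign, so their absolute values add up to the
    increment of the sum. This replaces the coarea formula: the variations of all truncations
    together are paid by one total variation. *)
Lemma sum_normr_mono N (F : nat -> R -> R) s t :
    (forall k s t, s <= t -> F k s <= F k t) ->
    (forall s t, s <= t -> \sum_(k < N) F k t - \sum_(k < N) F k s <= t - s) ->
  \sum_(k < N) `|F k s - F k t| <= `|s - t|.
Proof.
move=> Fm FL; wlog st : s t / s <= t => [H|].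
  have [|/ltW] := leP s t; first exact: H.
  move=> /H; rewrite [leRHS]distrC; under eq_bigr do rewrite distrC.
  by [].
rewrite distrC (ger0_norm (x := t - s)) ?subr_ge0//.
apply: le_trans (FL _ _ st); rewrite -sumrB; apply: ler_sum => k _.
by rewrite distrC ger0_norm// subr_ge0 Fm.
Qed.

(** Below the highest level that is reached all levels are saturated, and their weights form a
    geometric sum of at most twice the last one. Together with the highest level itself this gives
    3. *)
Lemma sum_le_maxf N (W a : nat -> R) :
    (forall k, 0 <= W k) -> (forall k, 2 * W k <= W k.+1) ->
    (forall k, 0 <= a k <= 1) -> (forall k, 0 < a k.+1 -> a k = 1) ->
  \sum_(k < N) W k * a k <= 3 * maxf N (fun k => W k * a k).
Proof.
move=> W0 W2 a01 aS; elim: N => [|N IH] /=; first by rewrite big_ord0 mulr0.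
rewrite big_ord_recr/=; set mx := Num.max _ _.
have mx1 : maxf N (fun k => W k * a k) <= mx by rewrite le_max lexx.
have mx2 : W N * a N <= mx by rewrite le_max lexx orbT.
have /andP[] := a01 N; rewrite le_eqVlt => /orP[/eqP aN _|aN _].
  by rewrite -aN mulr0 addr0; apply: le_trans IH _; rewrite ler_wpM2l.
have a1 k : (k < N)%N -> a k = 1.
  move=> kN; rewrite -(subKn (ltnW kN)); have : (0 < N - k <= N)%N by lia.
  elim: (N - k)%N => // -[|i] IHi iN; first by apply: aS; rewrite subn1 prednK//; lia.
  apply: aS; rewrite (_ : (N - i.+2).+1 = N - i.+1)%N; last by lia.
  by rewrite IHi//; lia.
under eq_bigr => k _ do rewrite a1// mulr1.
have S n : \sum_(k < n.+1) W k <= 2 * W n.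
  elim: n => [|n IHn]; first by rewrite big_ord1; have := W0 0; lra.
  by rewrite big_ord_recr/=; have := W2 n; have := W0 n; lra.
case: N {IH} mx mx1 mx2 aN a1 => [|n] mx mx1 mx2 aN a1.
  by rewrite big_ord0; have := maxf_ge0 0 (fun k => W k * a k); lra.
have := ler_maxf (fun k => W k * a k) (ltnSn n); rewrite a1// mulr1.
by have := S n; lra.
Qed.

End truncation.

(** * The estimates available for a grid function *)

Section grid.
Context {R : realFieldType} {T : finZmodType}.

(* [gb_dual] is the duality between the H^-1 norm and the Dirichlet energy,
   linearized by Young's inequality. *)
Record grid_bounds (e1 e2 : T) (h1 h2 B H : R) (v : T -> R) : Prop := {
  gb_h1 : 0 < h1;
  gb_h2 : 0 < h2;
  gb_ge : forall z, -1 <= v z;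
  gb_bv1 : \sum_z `|v (z + e1) - v z| <= h1 * B;
  gb_bv2 : \sum_z `|v (z + e2) - v z| <= h2 * B;
  gb_dual : forall (f : T -> R) (t : R), 0 < t ->
    \sum_z v z * f z <= t * (energy e1 h1 f + energy e2 h2 f) + H / t }.

Context (e1 e2 : T) (h1 h2 B H : R) (v : T -> R).
Hypothesis vP : grid_bounds e1 e2 h1 h2 B H v.

Lemma gb_B0 : 0 <= B.
Proof.
rewrite -(pmulr_rge0 B (gb_h1 vP)); apply: le_trans (gb_bv1 vP).
by apply: sumr_ge0.
Qed.

Lemma gb_H0 : 0 <= H.
Proof.
have := gb_dual vP (fun=> 0) ltr01.
rewrite big1; last by move=> z _; rewrite mulr0.
rewrite /energy !big1; first by rewrite addr0 mulr0 add0r divr1.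
all: by move=> z _; rewrite subrr mul0r expr0n.
Qed.

(** The weight [c k] is at most twice the inverse smoothing length, so weight times length times
    variation is twice the variation of the k-th truncation. By [sum_normr_mono] these sum to
    [2 * B] in each direction. *)
Lemma sum_truncation_smoothing (N : nat) (F : nat -> R -> R) (c : nat -> R)
    (n m : nat -> nat) :
    (forall k s t, s <= t -> F k s <= F k t) ->
    (forall s t, s <= t -> \sum_(k < N) F k t - \sum_(k < N) F k s <= t - s) ->
    (forall k, (0 < n k)%N) -> (forall k, (0 < m k)%N) ->
    (forall k, (k < N)%N -> 0 <= c k) ->
    (forall k, (k < N)%N -> c k * (h1 * (n k)%:R) <= 2) ->
    (forall k, (k < N)%N -> c k * (h2 * (m k)%:R) <= 2) ->
  \sum_(k < N) c k * \sum_z `|mavg2 e1 e2 (n k) (m k) (F k \o v) z - F k (v z)|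
  <= 4 * B.
Proof.
move=> Fm FL n0 m0 c0 cn cm.
have key (e : T) (h : R) (r : nat -> nat) : 0 < h ->
    (forall k, (k < N)%N -> c k * (h * (r k)%:R) <= 2) ->
    \sum_z `|v (z + e) - v z| <= h * B ->
  \sum_(k < N) c k * ((r k)%:R * \sum_z `|F k (v (z + e)) - F k (v z)|) <= 2 * B.
  move=> h0 cr vB.
  apply: (@le_trans _ _ (\sum_(k < N) 2 / h *
      \sum_z `|F k (v (z + e)) - F k (v z)|)).
    apply: ler_sum => k _; rewrite mulrA ler_wpM2r ?sumr_ge0//.
    by rewrite ler_pdivlMr// -mulrA (mulrC _ h) cr.
  rewrite -mulr_sumr exchange_big/=.
  apply: (@le_trans _ _ (2 / h * (h * B))); last first.
    by rewrite mulrA divfK ?gt_eqF.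
  rewrite ler_wpM2l ?divr_ge0 ?(ltW h0)//.
  apply: le_trans vB; apply: ler_sum => z _; exact: sum_normr_mono.
rewrite (_ : 4 * B = 2 * B + 2 * B); last by ring.
apply: le_trans (lerD (key e1 h1 n (gb_h1 vP) cn (gb_bv1 vP))
                      (key e2 h2 m (gb_h2 vP) cm (gb_bv2 vP))).
rewrite -big_split/=; apply: ler_sum => k _.
by rewrite -mulrDr ler_wpM2l ?c0//; exact: sum_mavg2_diff.
Qed.

End grid.

Section high_levels.
Context {R : realFieldType} {T : finZmodType}.

(** The offset 5 keeps the high levels away from height 1: the factor 2^5 = 32 makes the mass of the
    cutoffs small enough to be absorbed. *)
Definition hi_trunc (k : nat) (t : R) :=
  clamp (8 ^+ (k + 5)) (8 ^+ (k + 6)) t - 8 ^+ (k + 5).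

Definition hi_frac k t := hi_trunc k t / (7 * 8 ^+ (k + 5)).

Lemma le_hi k : 8 ^+ (k + 5) <= 8 ^+ (k + 6) :> R.
Proof. by rewrite ler_weXn2l ?leq_add2l//; lra. Qed.

Lemma hi8_gt0 k : 0 < 8 ^+ k :> R. Proof. exact: exprn_gt0. Qed.

Lemma hi8S k : 8 ^+ (k + 6) = 8 * 8 ^+ (k + 5) :> R.
Proof. by rewrite -exprS addnS. Qed.

Lemma sum_hi_trunc N (t : R) :
  \sum_(k < N) hi_trunc k t = clamp (8 ^+ 5) (8 ^+ (N + 5)) t - 8 ^+ 5.
Proof.
elim: N => [|N IH].
  rewrite big_ord0 add0n; have := clampP t (lexx (8 ^+ 5)).
  by move=> [] [] + ->; lra.
rewrite big_ord_recr/= IH /hi_trunc.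
have h : 8 ^+ 5 <= 8 ^+ (N + 5) :> R by rewrite ler_weXn2l ?leq_addl//; lra.
by have := clampD t h (le_hi N); rewrite addSn -(addnS N); lra.
Qed.

Lemma hi_fracE k t : hi_trunc k t = 7 * 8 ^+ (k + 5) * hi_frac k t.
Proof. by rewrite mulrC divfK// mulf_neq0// gt_eqF ?hi8_gt0//; lra. Qed.

Lemma hi_frac01 k t : 0 <= hi_frac k t <= 1.
Proof.
have /andP[] := clamp_bound t (le_hi k); have := hi8_gt0 (k + 5).
rewrite /hi_frac /hi_trunc hi8S => p a b.
by rewrite divr_ge0 ?subr_ge0 ?mulr_ge0 ?(ltW p)//= ler_pdivrMr; lra.
Qed.

Lemma hi_frac_gt k t : 0 < hi_frac k t -> 8 ^+ (k + 5) < t.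
Proof.
rewrite /hi_frac /hi_trunc pmulr_lgt0; last first.
  by rewrite invr_gt0 mulr_gt0 ?hi8_gt0//; lra.
by have := clampP t (le_hi k) => -[] [] + ->; lra.
Qed.

Lemma hi_frac_eq1 k t : 8 ^+ (k + 6) <= t -> hi_frac k t = 1.
Proof.
move=> kt; rewrite /hi_frac /hi_trunc; have p := hi8_gt0 (k + 5).
rewrite (_ : clamp _ _ _ = 8 ^+ (k + 6)); last first.
  by have := clampP t (le_hi k) => -[] [] + ->; have := hi8S k; lra.
rewrite hi8S (_ : _ - _ = 7 * 8 ^+ (k + 5)); last by ring.
by rewrite divff// mulf_neq0 ?gt_eqF//; lra.
Qed.

End high_levels.

Lemma mavg_ge {R : realFieldType} {T : finZmodType} (e : T) n (f : T -> R) z c :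
  (0 < n)%N -> (forall i, (i < n)%N -> c <= f (z + e *+ i)) -> c <= mavg e n f z.
Proof.
move=> n0 cf; rewrite /mavg ler_pdivlMl ?ltr0n// mulr_natl.
rewrite -[n in _ *+ n]card_ord -sumr_const.
by apply: ler_sum => i _; exact: cf.
Qed.

(** * Logarithmic cutoffs and the high levels *)
Section logarithmic_cutoff.
Context {R : realFieldType} {T : finZmodType}.
Context (e1 e2 : T) (n m M : nat) (f : T -> R).
Hypotheses (n0 : (0 < n)%N) (m0 : (0 < m)%N) (M0 : (0 < M)%N).
Hypothesis f01 : forall z, 0 <= f z <= 1.

(** The scales decrease with [i], so that the inverse lengths double as [energy_sum_mavg2]
    requires. *)
Let sc i := (2 ^ (M.-1 - i))%N.

(** A soft indicator of the dilation of the set where [f] is large: up to truncation at 1, the mass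
    of [f] in a large window, measured in units of the small window [n] by [m]. *)
Definition dilate i w :=
  Num.min 1 ((sc i * 2)%:R ^+ 2 * mavg2 e1 e2 (sc i * 2 * n) (sc i * 2 * m) f w).

(** With this shift, the doubled window issued from any point of the averaging window contains the
    window [n] by [m] at [z]. *)
Let corner i := - (e1 *+ (sc i * n)) - e2 *+ (sc i * m).

(* Discrete counterpart of the logarithmic cutoff realizing the planar
   capacity. *)
Definition log_cutoff z := \sum_(i < M)
  M%:R^-1 * mavg2 e1 e2 (sc i * n) (sc i * m) (dilate i) (z + corner i).

Let sc0 i : (0 < sc i)%N. Proof. by rewrite expn_gt0. Qed.

Let f0 z : 0 <= f z. Proof. by case/andP: (f01 z). Qed.

Lemma mavg2_ge0 (e d : T) (a b : nat) (g : T -> R) z :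
  (forall w, 0 <= g w) -> 0 <= mavg2 e d a b g z.
Proof.
move=> g0; rewrite mulr_ge0 ?invr_ge0// sumr_ge0// => i _.
by rewrite mulr_ge0 ?invr_ge0// sumr_ge0.
Qed.

Lemma dilate01 i w : 0 <= dilate i w <= 1.
Proof.
by rewrite le_min ler01/= ge_min lexx/= mulr_ge0 ?sqr_ge0 ?mavg2_ge0.
Qed.

(** By [mavg2_window], every value of [dilate i] that is averaged dominates the mean of [f] at [z];
    averaging over positions and over the [M] scales keeps the bound. *)
Lemma log_cutoff_ge z : mavg2 e1 e2 n m f z <= log_cutoff z.
Proof.
have S1 : mavg2 e1 e2 n m f z <= 1.
  rewrite -(mavg_cst e1 1 z n0); apply: ler_mavg => w.
  by rewrite -(mavg_cst e2 1 w m0); apply: ler_mavg => u; case/andP: (f01 u).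
apply: (@le_trans _ _ (\sum_(i < M) M%:R^-1 * mavg2 e1 e2 n m f z)).
  by rewrite sumr_const card_ord -[leRHS]mulr_natl mulVKf ?pnatr_eq0 -?lt0n.
apply: ler_sum => i _; rewrite ler_wpM2l ?invr_ge0//.
have scn := sc0 i; apply: mavg_ge => [|a an]; first by rewrite muln_gt0 sc0.
apply: mavg_ge => [|b bm]; first by rewrite muln_gt0 sc0.
rewrite le_min S1/= /corner addrA.
by apply: mavg2_window => //; exact: ltnW.
Qed.

Lemma sum_dilate i : \sum_w dilate i w <= (sc i * 2)%:R ^+ 2 * \sum_w f w.
Proof.
rewrite -[X in _ <= _ * X](@sum_mavg _ _ e2 (sc i * 2 * m)) ?muln_gt0 ?sc0 ?m0//.
rewrite -[X in _ <= _ * X](@sum_mavg _ _ e1 (sc i * 2 * n)) ?muln_gt0 ?sc0 ?n0// mulr_sumr.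
by apply: ler_sum => w _; rewrite ge_min lexx orbT.
Qed.

Lemma log_cutoff_ge0 z : 0 <= log_cutoff z.
Proof.
apply: sumr_ge0 => i _; rewrite mulr_ge0 ?invr_ge0// mavg2_ge0// => w.
by case/andP: (dilate01 i w).
Qed.

(** The largest window has sides 2^M times those of the small one, hence the ratio of areas 4^M. *)
Lemma sum_log_cutoff : \sum_z log_cutoff z <= 4 ^+ M * \sum_z f z.
Proof.
rewrite exchange_big/=.
apply: (@le_trans _ _ (\sum_(i < M) M%:R^-1 * (4 ^+ M * \sum_z f z))); last first.
  by rewrite sumr_const card_ord -[leLHS]mulr_natl mulVKf ?pnatr_eq0 -?lt0n.
apply: ler_sum => i _; rewrite -mulr_sumr ler_wpM2l ?invr_ge0//.
rewrite (sum_shift _ (mavg2 e1 e2 (sc i * n) (sc i * m) (dilate i))).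
rewrite !sum_mavg ?muln_gt0 ?sc0//; apply: le_trans (sum_dilate i) _.
rewrite ler_wpM2r ?sumr_ge0// -natrX -[4]/(4%:R) -natrX ler_nat.
rewrite /sc -expnSr -expnM (_ : 4 = 2 ^ 2)%N// -expnM leq_exp2l//.
by have := ltn_ord i; lia.
Qed.

(** In the plane the energy is scale invariant: the squared inverse length of a scale cancels the
    area of its window, so each scale contributes 4 (c/M)^2 times the mass. There are [M] scales,
    and a single factor 1/M remains. *)
Lemma energy_log_cutoff (h c : R) : 0 < h -> 0 <= c -> 1 <= c * (h * n%:R) ->
  energy e1 h log_cutoff <= 24 * c ^+ 2 / M%:R * \sum_z f z.
Proof.
move=> h0 c0 cn.
have Mr : 0 < M%:R :> R by rewrite ltr0n.
have p2 k : 0 < 2 ^+ k :> R by rewrite exprn_gt0.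
(* [c] bounds the inverse of the length [h * n]; the length at scale [i] is 2^(M-1-i) times larger,
   and the coefficient of each scale is 1/M. *)
pose q i : R := 2 ^+ i * (c / (M%:R * 2 ^+ M.-1)).
have q0 i : 0 <= q i 
  by rewrite mulr_ge0 ?(ltW (p2 _))// divr_ge0// mulr_ge0 ?(ltW (p2 _)).
have qS i : 2 * q i <= q i.+1 by rewrite /q exprS mulrA.
apply: (le_trans (y := 6 * 1 * \sum_(i < M) q i ^+ 2 * \sum_z `|dilate i z|)).
  apply: (@energy_sum_mavg2 R T e1 e2 M h 1 (fun=> M%:R^-1) q
    (fun i => sc i * n)%N (fun i => sc i * m)%N dilate corner) => //.
  - by move=> i; rewrite muln_gt0 sc0.
  - by move=> i; rewrite muln_gt0 sc0.
  - move=> i; rewrite invr_ge0 ler0n/=.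
    rewrite (_ : q i * _ = M%:R^-1 * ((2 ^+ i * (sc i)%:R / 2 ^+ M.-1) *
      (c * (h * n%:R)))); last first.
      by rewrite /q natrM; field; rewrite !gt_eqF.
    rewrite -[leLHS]mulr1 ler_wpM2l ?invr_ge0// mulr_ege1// ler_pdivlMr// mul1r.
    by rewrite /sc natrX -exprD ler_weXn2l ?ler1n//; lia.
  - move=> i z w; have /andP[a b] := dilate01 i z; have /andP[a' b'] := dilate01 i w.
    by rewrite ler_norml; lra.
rewrite mulr1; apply: (@le_trans _ _ (6 * \sum_(i < M) 4 * (c / M%:R) ^+ 2 *
   \sum_z f z)); last first.
  rewrite sumr_const card_ord -[X in _ * X]mulr_natl le_eqVlt.
  by apply/orP; left; apply/eqP; field; rewrite gt_eqF.
rewrite ler_wpM2l//; apply: ler_sum => i _.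
under eq_bigr do rewrite ger0_norm ?(andP (dilate01 _ _)).1//.
apply: le_trans (ler_wpM2l (sqr_ge0 _) (sum_dilate i)) _.
rewrite mulrA ler_wpM2r ?sumr_ge0// -exprMn (_ : q i * _ = 2 * (c / M%:R)).
  by rewrite exprMn -[4]/(2 ^ 2)%:R natrX.
have E : 2 ^+ M.-1 = 2 ^+ i * 2 ^+ (M.-1 - i) :> R.
  by rewrite -exprD; congr (_ ^+ _); have := ltn_ord i; lia.
rewrite /q /sc natrM natrX E.
by field; rewrite !gt_eqF.
Qed.

End logarithmic_cutoff.

Lemma eq_mavg {R : realFieldType} {T : finZmodType} (e : T) n (f g : T -> R) :
  f =1 g -> mavg e n f =1 mavg e n g.
Proof. by move=> fg z; congr (_ * _); apply: eq_bigr => i _; rewrite fg. Qed.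

Lemma log_cutoffC {R : realFieldType} {T : finZmodType} (e1 e2 : T) n m M
    (f : T -> R) z :
  log_cutoff e1 e2 n m M f z = log_cutoff e2 e1 m n M f z.
Proof.
apply: eq_bigr => i _; rewrite mavg2C [in LHS](addrC (- (e1 *+ _))) /mavg2; congr (_ * _).
apply: eq_mavg => w; apply: eq_mavg => u.
by rewrite /dilate mavg2C.
Qed.

Lemma energyC_log_cutoff {R : realFieldType} {T : finZmodType} (e1 e2 : T)
    n m M (f : T -> R) (h c : R) :
    (0 < n)%N -> (0 < m)%N -> (0 < M)%N -> (forall z, 0 <= f z <= 1) ->
    0 < h -> 0 <= c -> 1 <= c * (h * m%:R) ->
  energy e2 h (log_cutoff e1 e2 n m M f) <= 24 * c ^+ 2 / M%:R * \sum_z f z.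
Proof.
move=> n0 m0 M0 f01 h0 c0 cm.
by rewrite (eq_energy _ _ (log_cutoffC e1 e2 n m M f)) energy_log_cutoff.
Qed.

Section high_levels_estimate.
Context {R : realFieldType} {T : finZmodType}.
Context (e1 e2 : T) (h1 h2 B H : R) (v : T -> R).
Hypothesis vP : grid_bounds e1 e2 h1 h2 B H v.
Context (N : nat) (l : nat -> R) (n m : nat -> nat).

Let w k : R := 2 ^+ (k + 5) * l k.

(* Height [8 ^+ k] of the level times the inverse [2 ^+ k * l k] of its
   smoothing length, with [k] shifted by 5. *)
Definition hi_weight (l : nat -> R) k : R := 16 ^+ (k + 5) * l k.

Hypothesis l1 : forall k, 1 <= l k.
Hypothesis lE : forall k, l k ^+ 3 = (k + 5)%:R.
Hypothesis lS : forall k, l k <= l k.+1.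
Hypotheses (n0 : forall k, (0 < n k)%N) (m0 : forall k, (0 < m k)%N).
Hypotheses (wn : forall k, 1 <= w k * (h1 * (n k)%:R))
           (wm : forall k, 1 <= w k * (h2 * (m k)%:R)).
Hypotheses (wn2 : forall k, (k < N)%N -> w k * (h1 * (n k)%:R) <= 2)
           (wm2 : forall k, (k < N)%N -> w k * (h2 * (m k)%:R) <= 2).

Let W := hi_weight l.
Let tau k z := hi_frac k (v z).
Let psi k := log_cutoff e1 e2 (n k) (m k) (k + 5) (tau k).
Let phi z := maxf N (fun k => w k * psi k z).
Let err k z : R := `|mavg2 e1 e2 (n k) (m k) (tau k) z - tau k z|.
Let Z := \sum_(k < N) W k * \sum_z tau k z.

Let l0 k : 0 < l k. Proof. exact: lt_le_trans ltr01 (l1 k). Qed.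
Let w0 k : 0 <= w k. Proof. by rewrite mulr_ge0 ?exprn_ge0// ltW. Qed.
Let W0 k : 0 <= W k. Proof. by rewrite mulr_ge0 ?exprn_ge0// ltW. Qed.

Let WE k : W k = 8 ^+ (k + 5) * w k.
Proof. by rewrite mulrA -exprMn -natrM. Qed.

Let tau01 k z : 0 <= tau k z <= 1. Proof. exact: hi_frac01. Qed.
Let tau0 k z : 0 <= tau k z. Proof. by case/andP: (tau01 k z). Qed.
Let err0 k z : 0 <= err k z. Proof. exact: normr_ge0. Qed.
Let M0 k : (0 < k + 5)%N. Proof. by rewrite addnS. Qed.

Let phi_ge0 z : 0 <= phi z. Proof. exact: maxf_ge0. Qed.

(** The cube condition on [l] enters here: [w k ^+ 2] times [w k ^+ 2 / (k + 5)] is 16^(k+5) l^4 /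
    l^3, which is exactly the weight [W k]. *)
Let phi_energy e h : 0 < h ->
  (forall k, energy e h (psi k) <= 24 * w k ^+ 2 / (k + 5)%:R * \sum_z tau k z) ->
  energy e h phi <= 24 * Z.
Proof.
move=> h0 eh; apply: le_trans (energy_maxf _ _ _ _) _.
rewrite mulr_sumr; apply: ler_sum => k _; rewrite energyZ.
apply: le_trans (ler_wpM2l (sqr_ge0 _) (eh k)) _.
rewrite !mulrA ler_wpM2r ?sumr_ge0//.
rewrite (_ : 16 ^+ _ = (2 ^+ (k + 5)) ^+ 4 :> R); last first.
  by rewrite -exprM mulnC exprM; congr (_ ^+ _); ring.
rewrite -lE /w le_eqVlt; apply/orP; left; apply/eqP; field.
by rewrite gt_eqF.
Qed.

(** With [k + 5] scales the support grows by 4^(k+5), while [W k] carries the height 8^(k+5); the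
    quotient 2^(k+5) is at least 32. *)
Let sum_phi : \sum_z phi z <= Z / 32.
Proof.
apply: (@le_trans _ _ (\sum_z \sum_(k < N) w k * psi k z)).
  apply: ler_sum => z _; apply: maxf_le_sum => k.
  by rewrite mulr_ge0 ?log_cutoff_ge0.
rewrite exchange_big/= mulr_suml; apply: ler_sum => k _.
rewrite -mulr_sumr.
apply: le_trans (ler_wpM2l (w0 k) (sum_log_cutoff _ _ _ _ _ _)) _ => //.
rewrite ler_pdivlMr// mulrA mulrAC ler_wpM2r ?sumr_ge0// WE.
rewrite -mulrA mulrC ler_wpM2r// (_ : 8 = 4 * 2 :> R); last by ring.
rewrite exprMn ler_wpM2l ?exprn_ge0// exprD -[leLHS]mul1r.
rewrite (_ : 2 ^+ 5 = 32 :> R); last by ring.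
by rewrite ler_wpM2r// exprn_ege1// ler1n.
Qed.

(** By saturation the sum is at most 3 times its largest term. Where [tau k] is nonzero, [v] exceeds
    8^(k+5), so [v * phi] dominates [W k * psi k], and [psi k] dominates the smoothed [tau k]. Where
    no level is active, the added [phi] compensates a negative [v], which is at least -1. *)
Let pointwise z : \sum_(k < N) W k * tau k z <=
  3 * (v z * phi z + phi z + \sum_(k < N) W k * err k z).
Proof.
have E0 : 0 <= \sum_(k < N) W k * err k z.
  by apply: sumr_ge0 => k _; rewrite mulr_ge0.
apply: le_trans (sum_le_maxf N W0 _ (tau01 ^~ z) _) _.
- move=> k; rewrite /W /hi_weight addSn exprS.
  have p0 : 0 <= 16 ^+ (k + 5) :> R by rewrite exprn_ge0.
  have := mulr_ge0 p0 (ltW (l0 k)).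
  by have := ler_wpM2l p0 (lS k); lra.
- move=> k /hi_frac_gt; rewrite addSn -addnS => /ltW; exact: hi_frac_eq1.
rewrite ler_wpM2l//.
have max_le (a : nat -> R) c : 0 <= c -> (forall k, (k < N)%N -> a k <= c) ->
    maxf N a <= c.
  move=> c0; elim: (N) => //= k IH ac; rewrite ge_max IH ?ac//.
  by move=> j jk; rewrite ac// ltnW.
have vphi : 0 <= v z * phi z + phi z.
  rewrite -[X in _ + X]mul1r -mulrDl mulr_ge0//.
  by have := gb_ge vP z; lra.
apply: max_le => [|k kN]; first by rewrite addr_ge0.
have e0 : W k * err k z <= \sum_(k < N) W k * err k z.
  rewrite (bigD1 (Ordinal kN))//= lerDl sumr_ge0// => j _.
  by rewrite mulr_ge0.
have := tau0 k z; rewrite le_eqVlt => /orP[/eqP<-|t0].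
  by rewrite mulr0 addr_ge0.
have vk := ltW (hi_frac_gt t0).
have v0 : 0 <= v z by apply: le_trans vk; rewrite exprn_ge0.
have pk : w k * psi k z <= phi z by exact: (ler_maxf (fun k => w k * psi k z)).
have Sk : tau k z - err k z <= psi k z.
  apply: le_trans (log_cutoff_ge _ _ _ _ (M0 k) (tau01 k) z) => //.
  rewrite /err; set x := mavg2 _ _ _ _ _ _.
  by rewrite lerBlDr -lerBlDl distrC ler_norm.
have : W k * (tau k z - err k z) <= v z * phi z.
  apply: (@le_trans _ _ (8 ^+ (k + 5) * (w k * psi k z))).
    by rewrite WE -mulrA !ler_wpM2l ?exprn_ge0.
  by apply: ler_pM; rewrite ?exprn_ge0// mulr_ge0// log_cutoff_ge0.
by move: e0 (phi_ge0 z); lra.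
Qed.

(** Since [hi_trunc] is 7 * 8^(k+5) times [hi_frac], the weight [W k] on fractions is one seventh of
    the weight [w k] on truncations, and 4/7 is below 1. *)
Let sum_err : \sum_(k < N) W k * \sum_z err k z <= B.
Proof.
have B0 := gb_B0 vP.
have := @sum_truncation_smoothing _ _ _ _ _ _ _ _ _ vP N hi_trunc w n m.
move=> /(_ _ _ n0 m0 _ wn2 wm2) => /(_ _ _ _).
have -> : \sum_(k < N) w k * \sum_z `|mavg2 e1 e2 (n k) (m k)
    (hi_trunc k \o v) z - hi_trunc k (v z)| = 7 * \sum_(k < N) W k * \sum_z err k z.
  rewrite mulr_sumr; apply: eq_bigr => k _; rewrite WE.
  have -> : \sum_z `|mavg2 e1 e2 (n k) (m k)
    (hi_trunc k \o v) z - hi_trunc k (v z)| = 7 * 8 ^+ (k + 5) * \sum_z err k z.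
    rewrite mulr_sumr; apply: eq_bigr => z _.
    rewrite /err -[X in X * _]ger0_norm ?mulr_ge0 ?exprn_ge0// -normrM mulrBr.
    rewrite -hi_fracE; congr (`|_ - _|).
    rewrite /mavg2 -mavgZ; apply: eq_mavg => y; rewrite -mavgZ.
    by apply: eq_mavg => x; rewrite /= hi_fracE.
  by ring.
move=> h; suff : 7 * \sum_(k < N) W k * \sum_z err k z <= 4 * B by lra.
apply: h => [k s t st|s t st|k _] //.
- by have /andP[] := clamp_lip (le_hi k) st; rewrite /hi_trunc; lra.
- rewrite !sum_hi_trunc.
  have h : 8 ^+ 5 <= 8 ^+ (N + 5) :> R by rewrite ler_weXn2l ?leq_addl//; lra.
  by have /andP[] := clamp_lip h st; lra.
Qed.

Lemma high_levels_estimate : Z <= 3000 * (B + H).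
Proof.
have B0 := gb_B0 vP; have H0 := gb_H0 vP.
have Z0 : 0 <= Z by apply: sumr_ge0 => k _; rewrite mulr_ge0 ?sumr_ge0.
have Zle : Z <= 3 * (\sum_z v z * phi z + \sum_z phi z +
    \sum_(k < N) W k * \sum_z err k z).
  rewrite /Z; under eq_bigr do rewrite mulr_sumr.
  under [X in _ <= _ * (_ + X)]eq_bigr do rewrite mulr_sumr.
  rewrite exchange_big/= [X in _ <= _ * (_ + X)]exchange_big/=.
  by rewrite -!big_split/= mulr_sumr; apply: ler_sum => z _; exact: pointwise.
(* The two energies add up to at most 48 Z, so this [t] leaves Z/6. With the factor 3 and the mass
   Z/32, the right side contains (1/2 + 3/32) Z, which is absorbed. *)
have D := gb_dual vP phi (t := 288^-1) _.
have En1 : energy e1 h1 phi <= 24 * Z.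
  by apply: phi_energy => [|k]; [exact: gb_h1 vP|
    apply: energy_log_cutoff => //; exact: gb_h1 vP].
have En2 : energy e2 h2 phi <= 24 * Z.
  by apply: phi_energy => [|k]; [exact: gb_h2 vP|
    apply: energyC_log_cutoff => //; exact: gb_h2 vP].
have {}D : \sum_z v z * phi z <= Z / 6 + 288 * H.
  apply: le_trans (D _) _; first by rewrite invr_gt0.
  by rewrite invrK; lra.
by move: sum_phi sum_err; lra.
Qed.

End high_levels_estimate.

(** * The low levels *)
Section low_truncation.
Context {R : realFieldType}.
Implicit Types (a t s : R).

(** Odd in [t] and zero on [-a, a], so that both signs are paired with [v] at once and each product
    is nonnegative. *)
Definition lo_trunc a t := clamp (- (8 * a)) (- a) t + clamp a (8 * a) t.

Definition lo_frac a t := lo_trunc a t / a.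

Lemma lo_truncE a t : 0 < a ->
  [\/ t <= - (8 * a) /\ lo_trunc a t = - (7 * a),
      - (8 * a) <= t <= - a /\ lo_trunc a t = t + a,
      - a <= t <= a /\ lo_trunc a t = 0
    | a <= t <= 8 * a /\ lo_trunc a t = t - a] \/
  (8 * a <= t /\ lo_trunc a t = 7 * a).
Proof.
move=> a0; have na : - (8 * a) <= - a by lra.
have pa : a <= 8 * a by lra.
rewrite /lo_trunc; have := clampP t na; have := clampP t pa.
move=> [] [] + -> [] [] + -> => h1 h2;
  first [lra|left; constructor 1; lra|left; constructor 2; lra
     |left; constructor 3; lra|left; constructor 4; lra|right; lra].
Qed.

Lemma lo_trunc_le a s t : 0 < a -> s <= t -> lo_trunc a s <= lo_trunc a t.
Proof.
move=> a0 st; rewrite lerD//.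
  by have /andP[] := @clamp_lip _ (- (8 * a)) (- a) s t ltac:(lra) st; lra.
by have /andP[] := @clamp_lip _ a (8 * a) s t ltac:(lra) st; lra.
Qed.

Lemma lo_fracE a t : 0 < a -> lo_trunc a t = a * lo_frac a t.
Proof. by move=> a0; rewrite mulrC divfK ?gt_eqF. Qed.

Lemma lo_frac_bound a t : 0 < a -> `|lo_frac a t| <= 7.
Proof.
move=> a0; rewrite normrM normfV (gtr0_norm a0) ler_pdivrMr// ler_norml.
by have [[]|] := lo_truncE t a0 => -[] + ->; lra.
Qed.

Lemma lo_frac_sign a t : 0 < a -> t * lo_frac a t = `|t| * `|lo_frac a t|.
Proof.
move=> a0; rewrite -normrM ger0_norm// mulrA divr_ge0 ?(ltW a0)//.
by have [[]|] := lo_truncE t a0 => -[] + ->; nra.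
Qed.

Lemma lo_frac_gt a t : 0 < a -> a * `|lo_frac a t| <= `|t| * `|lo_frac a t|.
Proof.
move=> a0; have [->|f0] := eqVneq (lo_frac a t) 0.
  by rewrite normr0 !mulr0.
rewrite ler_wpM2r//; have : lo_trunc a t != 0.
  by rewrite lo_fracE// mulf_neq0// gt_eqF.
rewrite ler_normr.
by have [[]|] := lo_truncE t a0 => -[] + -> => [? _|? _||? _|? _]; rewrite ?eqxx//; lra.
Qed.

(** Serves to charge the part of |t| above height [a] to the level [a]: on a < |t| < 8a the fraction
    times |t|/a is already at least |t| - a in units that do not depend on [a]. *)
Lemma lo_frac_ge a t : 0 < a -> Num.max 0 (`|t| - a) <= `|t| * `|lo_frac a t|.
Proof.
move=> a0; rewrite ge_max mulr_ge0//= -lo_frac_sign// mulrA ler_pdivlMr//.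
have a20 := mulr_ge0 (ltW a0) (ltW a0).
have := sqr_ge0 (`|t| - a); have [t0|t0] := leP 0 t.
  rewrite (ger0_norm t0) => sq.
  have : 0 <= t * a by rewrite mulr_ge0 ?(ltW a0).
  by have [[]|] := lo_truncE t a0 => -[] + -> => ?; first [lra|nra].
rewrite (ltr0_norm t0) => sq.
have : 0 <= - t * a by rewrite mulr_ge0 ?(ltW a0)// oppr_ge0 ltW.
by have [[]|] := lo_truncE t a0 => -[] + -> => ?; first [lra|nra].
Qed.

Lemma sum_lo_trunc N (a : R) t : 0 < a ->
  \sum_(i < N) lo_trunc (a * 8 ^+ i) t =
  clamp (- (a * 8 ^+ N)) (- a) t + clamp a (a * 8 ^+ N) t.
Proof.
move=> a0; elim: N => [|N IH].
  rewrite big_ord0 expr0 mulr1; have := clampP t (lexx a).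
  by have := clampP t (lexx (- a)) => -[] [] + -> [] [] + ->; lra.
rewrite big_ord_recr/= IH /lo_trunc exprS (mulrCA a 8).
have p1 : a <= a * 8 ^+ N by rewrite ler_peMr ?(ltW a0)// exprn_ege1//; lra.
have p2 : a * 8 ^+ N <= 8 * (a * 8 ^+ N) by lra.
have q1 : - (a * 8 ^+ N) <= - a by lra.
have q2 : - (8 * (a * 8 ^+ N)) <= - (a * 8 ^+ N) by lra.
by have := clampD t p1 p2; have := clampD t q2 q1; lra.
Qed.

End low_truncation.

Section low_levels_estimate.
Context {R : realFieldType} {T : finZmodType}.
Context (e1 e2 : T) (h1 h2 B H : R) (v : T -> R).
Hypothesis vP : grid_bounds e1 e2 h1 h2 B H v.
Context (N : nat) (beta : R) (n m : nat -> nat).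

(** [b i] is the inverse smoothing length and [a i] its cube, so [b i * a i] is the height to the
    power 4/3, the weight without a logarithm. *)
Let b i : R := beta * 2 ^+ i.
Let a i : R := beta ^+ 3 * 8 ^+ i.

Hypothesis beta0 : 0 < beta.
Hypothesis betaN : beta * 2 ^+ N = 64.
Hypotheses (n0 : forall k, (0 < n k)%N) (m0 : forall k, (0 < m k)%N).
Hypotheses (bn : forall k, 1 <= b k * (h1 * (n k)%:R))
           (bm : forall k, 1 <= b k * (h2 * (m k)%:R)).
Hypotheses (bn2 : forall k, (k < N)%N -> b k * (h1 * (n k)%:R) <= 2)
           (bm2 : forall k, (k < N)%N -> b k * (h2 * (m k)%:R) <= 2).

Let g i z := lo_frac (a i) (v z).
Let y i z := b i * (`|v z| * `|g i z|).
Let Y := \sum_(i < N) \sum_z y i z.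
Let excess z : R := Num.max 0 (v z - 8 ^+ 5).
Let phi z := \sum_(i < N) b i * mavg2 e1 e2 (n i) (m i) (g i) (z + 0).
Let err i z : R := `|mavg2 e1 e2 (n i) (m i) (g i) z - g i z|.

Let b0 i : 0 < b i. Proof. by rewrite mulr_gt0 ?exprn_gt0. Qed.
Let a0 i : 0 < a i. Proof. by rewrite mulr_gt0 ?exprn_gt0. Qed.
Let y0 i z : 0 <= y i z. Proof. by rewrite mulr_ge0 ?(ltW (b0 i))// mulr_ge0. Qed.
Let aE i : a i = b i ^+ 3.
Proof.
by rewrite exprMn -exprM mulnC exprM; congr (_ * _ ^+ _); ring.
Qed.

Let bS i : b i.+1 = 2 * b i. Proof. by rewrite /b [2 ^+ _]exprS mulrCA. Qed.

(** The fractions lie in [-7, 7], whence the oscillation 14. The rates are [b i ^+ 2], so the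
    estimate produces [b i ^+ 4], that is [b i * a i], and [a i] is at most |v| wherever [g i] is
    nonzero. *)
Let phi_energy1 : energy e1 h1 phi <= 84 * Y.
Proof.
have h10 := gb_h1 vP.
apply: (le_trans (y := 6 * 14 * \sum_(i < N) (b i ^+ 2) ^+ 2 * \sum_z `|g i z|)).
  apply: (@energy_sum_mavg2 R T e1 e2 N h1 14 b (fun i => b i ^+ 2) n m g
    (fun=> 0)) => //.
  - by move=> i; rewrite sqr_ge0.
  - by move=> i; rewrite bS [leRHS]exprMn; have := sqr_ge0 (b i); lra.
  - move=> i; rewrite ltW//= expr2 -mulrA -[leLHS]mulr1 ler_wpM2l//.
    exact: ltW.
  - move=> i z w; apply: le_trans (ler_normB _ _) _.
    by have := lo_frac_bound (v z) (a0 i); have := lo_frac_bound (v w) (a0 i); lra.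
rewrite (_ : 6 * 14 = 84); last by ring.
rewrite ler_wpM2l//; apply: ler_sum => i _; rewrite mulr_sumr.
apply: ler_sum => z _; rewrite -exprM exprS -aE -mulrA ler_wpM2l ?(ltW (b0 i))//.
exact: lo_frac_gt.
Qed.

Let phi_energy2 : energy e2 h2 phi <= 84 * Y.
Proof.
have h20 := gb_h2 vP.
apply: (le_trans (y := 6 * 14 * \sum_(i < N) (b i ^+ 2) ^+ 2 * \sum_z `|g i z|)).
  apply: (@energyC_sum_mavg2 R T e1 e2 N h2 14 b (fun i => b i ^+ 2) n m g
    (fun=> 0)) => //.
  - by move=> i; rewrite sqr_ge0.
  - by move=> i; rewrite bS [leRHS]exprMn; have := sqr_ge0 (b i); lra.
  - move=> i; rewrite ltW//= expr2 -mulrA -[leLHS]mulr1 ler_wpM2l//.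
    exact: ltW.
  - move=> i z w; apply: le_trans (ler_normB _ _) _.
    by have := lo_frac_bound (v z) (a0 i); have := lo_frac_bound (v w) (a0 i); lra.
rewrite (_ : 6 * 14 = 84); last by ring.
rewrite ler_wpM2l//; apply: ler_sum => i _; rewrite mulr_sumr.
apply: ler_sum => z _; rewrite -exprM exprS -aE -mulrA ler_wpM2l ?(ltW (b0 i))//.
exact: lo_frac_gt.
Qed.

Let sum_err : \sum_(i < N) b i * (a i * \sum_z err i z) <= 4 * B.
Proof.
have := @sum_truncation_smoothing _ _ _ _ _ _ _ _ _ vP N
  (fun i => lo_trunc (a i)) b n m.
move=> /(_ _ _ n0 m0 _ bn2 bm2) => /(_ _ _ _).
have -> : \sum_(k < N) b k * \sum_z `|mavg2 e1 e2 (n k) (m k)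
    (lo_trunc (a k) \o v) z - lo_trunc (a k) (v z)| =
    \sum_(k < N) b k * (a k * \sum_z err k z).
  apply: eq_bigr => k _; congr (_ * _); rewrite mulr_sumr; apply: eq_bigr => z _.
  rewrite /err -[X in X * _]ger0_norm ?(ltW (a0 k))// -normrM mulrBr.
  rewrite -lo_fracE//; congr (`|_ - _|).
  rewrite /mavg2 -mavgZ; apply: eq_mavg => u; rewrite -mavgZ.
  by apply: eq_mavg => x; rewrite /= lo_fracE.
apply => [k s t|s t st|k _]; [exact: lo_trunc_le| |exact: ltW].
rewrite !sum_lo_trunc ?exprn_gt0//; set c := beta ^+ 3.
have c0 : 0 < c by rewrite exprn_gt0.
have p1 : c <= c * 8 ^+ N by rewrite ler_peMr ?(ltW c0)// exprn_ege1//; lra.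
have p2 : c <= c * 8 ^+ N -> - (c * 8 ^+ N) <= - c by rewrite lerN2.
have := clamp_bound s p1; have := clamp_bound t p1.
have := clampP s p1; have := clampP t p1; have := clampP s (p2 p1).
have := clampP t (p2 p1).
by move=> [] [] + -> [] [] + -> [] [] + -> [] [] + ->; lra.
Qed.

(** The smoothing error is multiplied by |v|, which the total variation does not control. Up to the
    height of level [i + 6] the error of the truncation pays. The rest is charged to level [i + 6],
    whose weight is 64 times larger, so that the error bound 14 becomes the absorbable 14/64. If
    that level is missing, its height is at least 64^3 = 8^6 by [betaN], and [excess] pays; the
    negative values do not matter there, being at least -1. *)
Let pointwise i z : (i < N)%N ->
  b i * (`|v z| * err i z) <= 8 ^+ 6 * (b i * (a i * err i z)) +
    14 / 64 * (if (i + 6 < N)%N then y (i + 6) z else 0) + 14 * b i * excess z.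
Proof.
move=> iN.
have e0 : 0 <= err i z by exact: normr_ge0.
have e14 : err i z <= 14.
  apply: le_trans (ler_normB _ _) _.
  have := lo_frac_bound (v z) (a0 i).
  have : `|mavg2 e1 e2 (n i) (m i) (g i) z| <= 7.
    by do 2![apply: mavg_bound => // ?]; exact: lo_frac_bound.
  by rewrite -/(g i z); lra.
set p := Num.max 0 (`|v z| - a (i + 6)).
have p0 : 0 <= p by rewrite le_max lexx.
have vp : `|v z| <= 8 ^+ 6 * a i + p.
  have : `|v z| - a (i + 6) <= p by rewrite le_max lexx orbT.
  by rewrite /a exprD; lra.
have x0 : 0 <= excess z by rewrite le_max lexx.
have bi := ltW (b0 i).
have bp : b i * p <= 1 / 64 * (if (i + 6 < N)%N then y (i + 6) z else 0) +
    b i * excess z.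
  case: ltnP => [i6|i6].
    have bE : b (i + 6) = 64 * b i by rewrite /b exprD; ring.
    have := lo_frac_ge (v z) (a0 (i + 6)); rewrite -/p => /(ler_wpM2l bi).
    have : 0 <= b i * excess z by rewrite mulr_ge0.
    by rewrite /y bE /g; lra.
  rewrite mulr0 add0r ler_wpM2l// ge_max x0/=.
  have aN : 8 ^+ 6 <= a (i + 6).
    rewrite aE (_ : 8 ^+ 6 = 64 ^+ 3); last by ring.
    rewrite lerXn2r ?nnegrE ?(ltW (b0 _))// -betaN ler_wpM2l ?(ltW beta0)//.
    by rewrite ler_weXn2l ?ler1n.
  rewrite le_max; have := gb_ge vP z; have [v0|v0] := leP 0 (v z) => v1.
    by apply/orP; right; rewrite (ger0_norm v0); lra.
  by apply/orP; left; rewrite (ltr0_norm v0); lra.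
have := ler_wpM2r e0 (ler_wpM2l bi vp).
have : b i * p * err i z <= b i * p * 14 by rewrite ler_wpM2l// mulr_ge0.
lra.
Qed.

Lemma low_levels_estimate :
  \sum_(i < N) \sum_z b i * (`|v z| * `|lo_frac (a i) (v z)|) <=
  8 ^+ 8 * (B + H + \sum_z Num.max 0 (v z - 8 ^+ 5)).
Proof.
rewrite -/Y; set X := \sum_z _.
have X0 : 0 <= X by apply: sumr_ge0 => z _; rewrite le_max lexx.
have Y0 : 0 <= Y by apply: sumr_ge0 => i _; apply: sumr_ge0.
have B0 := gb_B0 vP; have H0 := gb_H0 vP.
have sb k : \sum_(i < k) b i <= beta * 2 ^+ k.
  elim: k => [|k IH]; first by rewrite big_ord0 mulr1 ltW.
  by rewrite big_ord_recr/= exprS /b; move: IH; lra.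
have err_le : \sum_(i < N) \sum_z b i * (`|v z| * err i z) <=
    8 ^+ 6 * (4 * B) + 14 / 64 * Y + 14 * 64 * X.
  apply: (@le_trans _ _ (\sum_(i < N) \sum_z (8 ^+ 6 * (b i * (a i * err i z)) +
    14 / 64 * (if (i + 6 < N)%N then y (i + 6) z else 0) + 14 * b i * excess z))).
    by apply: ler_sum => i _; apply: ler_sum => z _; exact: pointwise.
  under eq_bigr do rewrite !big_split/= -!mulr_sumr.
  rewrite !big_split/=; apply: lerD; first apply: lerD.
  - by rewrite -mulr_sumr ler_wpM2l ?exprn_ge0.
  - rewrite -mulr_sumr ler_wpM2l ?divr_ge0//.
    pose f j := if (j < N)%N then \sum_z y j z else 0.
    have f0 j : 0 <= f j by rewrite /f; case: ifP => // _; apply: sumr_ge0.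
    rewrite [leRHS](_ : _ = \sum_(0 <= j < N + 6) f j); last first.
      rewrite (big_cat_nat (n := N))//= ?leq_addr// [X in _ + X]big1_seq ?addr0.
        by rewrite big_mkord; apply: eq_bigr => i _; rewrite /f ltn_ord.
      by move=> j /andP[_]; rewrite mem_index_iota /f => /andP[Nj _]; rewrite ltnNge Nj.
    rewrite (big_cat_nat (n := 6))//= ?leq_addl//.
    rewrite -[leLHS]add0r lerD ?sumr_ge0//.
    rewrite (big_addn 0 (N + 6) 6) addnK big_mkord.
    by apply: ler_sum => i _; rewrite /f; case: ltnP => // _; rewrite big1.
  - rewrite -mulr_suml -mulr_sumr; apply: ler_wpM2r; first exact: X0.
    apply: ler_wpM2l; first by []. 
    by rewrite -betaN; exact: sb.
have low : Y <= \sum_z v z * phi z + \sum_(i < N) \sum_z b i * (`|v z| * err i z).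
  have -> : \sum_z v z * phi z =
      \sum_(i < N) \sum_z v z * (b i * mavg2 e1 e2 (n i) (m i) (g i) z).
    rewrite exchange_big/=; apply: eq_bigr => z _; rewrite mulr_sumr.
    by apply: eq_bigr => i _; rewrite addr0.
  rewrite -big_split/=; apply: ler_sum => i _; rewrite -big_split/=.
  apply: ler_sum => z _; rewrite mulrCA -mulrDr ler_wpM2l ?(ltW (b0 i))//.
  rewrite -lo_frac_sign// -/(g i z) /err -normrM -lerBlDl -mulrBr.
  by rewrite -[X in X <= _]opprK -mulrN opprB lerNl lerNnormlW.
(* The energies add up to at most 168 Y, so 1/672 leaves Y/4; together with 14/64 Y from the error
   this is less than Y. *)
have D : \sum_z v z * phi z <= 672^-1 * (energy e1 h1 phi + energy e2 h2 phi) +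
    H * 672.
  by rewrite -[X in H * X]invrK; apply: (gb_dual vP); rewrite invr_gt0 ltr0n.
move: err_le low phi_energy1 phi_energy2 D.
move: (energy e1 h1 phi) (energy e2 h2 phi) => E1 E2.
set S1 := \sum_z v z * phi z; set S2 := \sum_(i < N) _.
by move: (Y) (X) S1 S2 Y0 X0 B0 H0 => Y' X' S1 S2; lra.
Qed.

End low_levels_estimate.

(** * Low and high levels combined on the grid *)

Section profile.
Context {R : realType}.

Definition cubert k : R := (k + 5)%:R `^ (3^-1).

Lemma cubertE k : cubert k ^+ 3 = (k + 5)%:R.
Proof.
by rewrite -powR_mulrn ?powR_ge0// -powRrM mulVf// powRr1.
Qed.

Lemma cubert_ge1 k : 1 <= cubert k.
Proof.
rewrite [leLHS](_ : 1 = 1 `^ 3^-1); last by rewrite powR1.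
by rewrite ge0_ler_powR ?nnegrE ?invr_ge0// ler1n addnS.
Qed.

Lemma cubert_le k j : (k <= j)%N -> cubert k <= cubert j.
Proof.
by move=> kj; rewrite ge0_ler_powR ?nnegrE ?invr_ge0// ler_nat leq_add2r.
Qed.

Definition lo_profile (K : nat) (t : R) := \sum_(i < K + 6)
  (2 ^- K * 2 ^+ i) * (`|t| * `|lo_frac ((2 ^- K) ^+ 3 * 8 ^+ i) t|).

Definition hi_profile (N : nat) (t : R) :=
  \sum_(k < N) hi_weight cubert k * hi_frac k t.

(** Between 8^5 and the top height the excess is the sum of the slices, each 7 * 8^(k+5) times its
    fraction, and 8^(k+5) is below the weight. This pays the debt left by the low levels. *)
Lemma excess_le N (t : R) :
  Num.max 0 (t - 8 ^+ 5) <= 7 * hi_profile N t + Num.max 0 (t - 8 ^+ (N + 5)).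
Proof.
have le5 : 8 ^+ 5 <= 8 ^+ (N + 5) :> R by rewrite ler_weXn2l ?leq_addl//; lra.
have hi0 : \sum_(k < N) hi_trunc k t <= 7 * hi_profile N t.
  rewrite mulr_sumr; apply: ler_sum => k _; rewrite hi_fracE -mulrA ler_wpM2l//.
  have /andP[t0 _] := hi_frac01 k t; rewrite ler_wpM2r//.
  rewrite -[leLHS]mulr1 ler_pM ?exprn_ge0 ?cubert_ge1//.
  by rewrite lerXn2r ?nnegrE//; lra.
have max1 : t - 8 ^+ (N + 5) <= Num.max 0 (t - 8 ^+ (N + 5)).
  by rewrite le_max lexx orbT.
have max0 : 0 <= Num.max 0 (t - 8 ^+ (N + 5)) by rewrite le_max lexx.
move: hi0; rewrite sum_hi_trunc ge_max => hi0.
by have := clampP t le5 => -[] [] + hE; rewrite hE in hi0; lra.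
Qed.

(** A smoothing length 1/w is rounded up to a whole number of grid steps; once the step is shorter
    than the length, rounding costs at most a factor 2. *)
Lemma steps_exist (h : R) (w : nat -> R) : 0 < h -> (forall k, 0 < w k) ->
  exists n : nat -> nat, [/\ forall k, (0 < n k)%N,
    forall k, 1 <= w k * (h * (n k)%:R)
    & forall k, h * w k <= 1 -> w k * (h * (n k)%:R) <= 2].
Proof.
move=> h0 w0; exists (fun k => (Num.truncn (w k * h)^-1).+1).
have wh k : 0 < w k * h by rewrite mulr_gt0.
have P k : (Num.truncn (w k * h)^-1)%:R <= (w k * h)^-1
    < (Num.truncn (w k * h)^-1).+1%:R.
  by apply: truncn_itv; rewrite invr_ge0 ltW.
split=> // k => [|hw]; rewrite mulrA; have /andP[Pl Pr] := P k.
  by rewrite -ler_pdivrMl// mulr1 ltW.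
rewrite -natr1 mulrDr mulr1.
have := ler_wpM2l (ltW (wh k)) Pl; rewrite mulfV ?gt_eqF//.
by move: hw; rewrite (mulrC h); lra.
Qed.

(** The mesh conditions say that the length attached to index [N], shorter than all those in use,
    spans a grid step. The excess above 8^5 in the low estimate is replaced by 7 * 3000 (B + H) and
    the tail, which 8^5 absorbs; hence 8^13 = 8^8 * 8^5. *)
Lemma grid_estimate {T : finZmodType} (e1 e2 : T) (h1 h2 B H : R) (v : T -> R)
    (K N : nat) :
    grid_bounds e1 e2 h1 h2 B H v ->
    h1 * (2 ^+ (N + 5) * cubert N) <= 1 -> h2 * (2 ^+ (N + 5) * cubert N) <= 1 ->
  \sum_z (lo_profile K (v z) + hi_profile N (v z)) <=
  8 ^+ 13 * (B + H + \sum_z Num.max 0 (v z - 8 ^+ (N + 5))).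
Proof.
move=> vP hN1 hN2; have B0 := gb_B0 vP; have H0 := gb_H0 vP.
have c0 k : 0 < cubert k by rewrite (lt_le_trans ltr01)// cubert_ge1.
have p0 k : 0 < 2 ^+ k :> R by rewrite exprn_gt0.
pose w k : R := 2 ^+ (k + 5) * cubert k.
pose b i : R := 2 ^- K * 2 ^+ i.
have w0 k : 0 < w k by rewrite mulr_gt0.
have b0 i : 0 < b i by rewrite mulr_gt0 ?invr_gt0.
have wN k : (k < N)%N -> w k <= w N.
  move=> kN; rewrite ler_pM ?(ltW (p0 _)) ?(ltW (c0 _)) ?cubert_le 1?ltnW//.
  by rewrite ler_weXn2l ?ler1n// leq_add2r ltnW.
have bN i : (i < K + 6)%N -> b i <= w N.
  move=> iK; apply: (@le_trans _ _ (2 ^+ 5 * 1)).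
    rewrite mulr1 ler_pdivrMl// -exprD ler_weXn2l ?ler1n//; lia.
  apply: ler_pM; rewrite ?cubert_ge1 ?exprn_ge0//.
  by rewrite ler_weXn2l ?ler1n ?leq_addl.
have hw h x : 0 < h -> h * w N <= 1 -> x <= w N -> h * x <= 1.
  by move=> h0 hN xw; apply: le_trans hN; rewrite ler_wpM2l// ltW.
have [n1 [n10 n1l n1r]] := steps_exist (gb_h1 vP) w0.
have [n2 [n20 n2l n2r]] := steps_exist (gb_h2 vP) w0.
have [m1 [m10 m1l m1r]] := steps_exist (gb_h1 vP) b0.
have [m2 [m20 m2l m2r]] := steps_exist (gb_h2 vP) b0.
have Hi := high_levels_estimate vP cubert_ge1 cubertE
  (fun k => cubert_le (leqnSn k)) n10 n20 n1l n2l
  (fun k kN => n1r k (hw _ _ (gb_h1 vP) hN1 (wN k kN)))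
  (fun k kN => n2r k (hw _ _ (gb_h2 vP) hN2 (wN k kN))).
have beta1 : 2 ^- K * 2 ^+ (K + 6) = 64 :> R.
  by rewrite exprD mulKf ?gt_eqF//; ring.
have beta0 : 0 < 2 ^- K :> R by rewrite invr_gt0.
have Lo := @low_levels_estimate _ _ _ _ _ _ _ _ _ vP (K + 6) (2 ^- K) m1 m2
  beta0 beta1 m10 m20 m1l m2l
  (fun k kN => m1r k (hw _ _ (gb_h1 vP) hN1 (bN k kN)))
  (fun k kN => m2r k (hw _ _ (gb_h2 vP) hN2 (bN k kN))).
have {}Lo : \sum_z lo_profile K (v z) <=
    8 ^+ 8 * (B + H + \sum_z Num.max 0 (v z - 8 ^+ 5)).
  by rewrite exchange_big.
have {}Hi : \sum_z hi_profile N (v z) <= 3000 * (B + H).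
  rewrite exchange_big/=; apply: le_trans Hi.
  by apply: ler_sum => k _; rewrite mulr_sumr.
set X := \sum_z Num.max 0 (v z - 8 ^+ 5) in Lo.
set Y := \sum_z Num.max 0 (v z - 8 ^+ (N + 5)).
have XY : X <= 7 * \sum_z hi_profile N (v z) + Y.
  rewrite mulr_sumr -big_split/=; apply: ler_sum => z _; exact: excess_le.
have Y0 : 0 <= Y by apply: sumr_ge0 => z _; rewrite le_max lexx.
rewrite big_split/=; move: Hi Lo XY B0 H0 Y0.
move: (\sum_z lo_profile K (v z)) (\sum_z hi_profile N (v z)) X Y => a c X Y.
by rewrite (_ : 8 ^+ 13 = 8 ^+ 8 * 8 ^+ 5); [lra|rewrite -exprD].
Qed.

End profile.

(** * Periodic partitions of unity *)
Section primitive.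
Context {R : realType}.
Notation mu := (@lebesgue_measure R).
Implicit Types f F : R -> R.

Lemma continuous_integrable_itv f (a b : R) : continuous f ->
  mu.-integrable `[a, b] (EFin \o f).
Proof.
move=> cf; apply: continuous_compact_integrable; first exact: segment_compact.
exact: continuous_subspaceT.
Qed.

Lemma primitive_exists f : continuous f ->
  exists F : R -> R, forall x : R, is_derive x (1 : R) F (f x).
Proof.
move=> cf.
pose I a x := (\int[mu]_(t in `[a, x]) f t)%R.
pose F x := if 0 <= x then I 0 x else - I x 0.
exists F => x.
have IB a y x' : a <= y -> y <= x' -> I a x' - I a y = I y x'.
  move=> ay yx; rewrite /I Rintegral_itvB ?bnd_simp//.
    rewrite Rintegral_itv_obnd_cbnd//.
    apply: integrableS (continuous_integrable_itv y x' cf) => //.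
    exact: subset_itv_oc_cc.
  exact: continuous_integrable_itv.
(* Near [x], the function [F] differs by a constant from the integral started at [a]; as [a] lies to
   the left of both [x] and 0, the fundamental theorem applies at an interior point. *)
pose a := Num.min x 0 - 1.
have ax : a < x by rewrite ltrBlDr (le_lt_trans (y := x)) ?ge_min ?lexx ?ltrDl.
have a0 : a < 0 by rewrite ltrBlDr add0r (le_lt_trans (y := 0)) ?ge_min ?lexx ?orbT.
apply: (@near_eq_is_derive _ _ _ (I a \- cst (I a 0))).
  near=> y.
  have ay : a <= y by apply: ltW; near: y; exact: lt_nbhsr.
  rewrite /F /=; case: (leP 0 y) => y0; first by rewrite IB// ltW.
  by rewrite -(IB a y 0)// ?opprB// ltW.
have x1 : x < x + 1 by rewrite ltrDl.
have [dF dFE] := continuous_FTC1_closed x1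
  (continuous_integrable_itv a (x + 1) cf) ax (cf x).
rewrite -[f x]subr0; apply: is_deriveB.
by apply: DeriveDef; [exact: dF|rewrite -derive1E].
Unshelve. all: by end_near. Qed.

Lemma derive_mvt F (f : R -> R) (x h : R) : 0 < h ->
  (forall y : R, is_derive y (1 : R) F (f y)) ->
  exists2 c, x < c < x + h & (F (x + h) - F x) / h = f c.
Proof.
move=> h0 dF; have [//||c] := @MVT _ F f x (x + h).
- by rewrite ltrDl.
- apply: continuous_subspaceT => y; apply: differentiable_continuous.
  by apply/derivable1_diffP; exact: ex_derive.
rewrite in_itv/= => xc ->; exists c => //.
by rewrite addrAC subrr add0r mulfK// gt_eqF.
Qed.

Lemma is_derive_shifted F (df : R) (x k : R) :
  is_derive (x + k) (1 : R) F df -> is_derive x (1 : R) (fun y => F (y + k)) df.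
Proof.
move=> dF; have := @is_derive1_comp R F (shift k) x df 1 dF (is_derive_shift x 1 k).
by rewrite mulr1.
Qed.

End primitive.

Section kernels.
Context {R : realType} (p : nat).
Notation mu := (@lebesgue_measure R).
Local Notation I := 'I_p.+1.
Local Notation e := (Zp1 : I).

(** [kf_shift] is cyclic: a step of the index is a translation by [h]. Through it, difference
    quotients in [x] become difference quotients of grid coefficients. *)
Record kernel_family (L h : R) (f : I -> R -> R) : Prop := {
  kf_cont : forall i, continuous (f i);
  kf_per : forall i x, f i (x + L) = f i x;
  kf_shift : forall i x, f (i + e) (x + h) = f i x;
  kf_ge0 : forall i x, 0 <= f i x;
  kf_sum : forall x, \sum_i f i x = 1 }.

Lemma kf_le1 L h f i x : kernel_family L h f -> f i x <= 1.
Proof.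
move=> fP; rewrite -(kf_sum fP x) (bigD1 i)//= lerDl sumr_ge0// => j _.
exact: kf_ge0 fP _ _.
Qed.

Lemma primitive_diff_cst (F G f g : R -> R) (a x y : R) :
    (forall x : R, is_derive x (1 : R) F (f x)) ->
    (forall x : R, is_derive x (1 : R) G (g x)) ->
    (forall x, f (x + a) = g x) ->
  F (x + a) - G x = F (y + a) - G y.
Proof.
move=> dF dG fg; pose D := (fun x => F (x + a)) - G.
apply: (@is_derive_0_is_cst _ D) => z; rewrite -[0](subrr (f (z + a))) {2}fg.
by apply: is_deriveB; exact: is_derive_shifted.
Qed.

(** The mean of [f i] over [x, x + h] inherits all the properties and gains one derivative, which is
    a difference quotient of the old family. By the mean value theorem it is also a value of [f i],
    which bounds its support. *)
Lemma steklov_exists L h f : 0 < h -> kernel_family L h f ->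
  exists g, [/\ kernel_family L h g,
    forall i (x : R), is_derive x (1 : R) (g i) ((f i (x + h) - f i x) / h)
  & forall i x, exists2 c, x < c < x + h & g i x = f i c].
Proof.
move=> h0 fP; have [F dF] := choice (fun i => primitive_exists (@kf_cont _ _ _ fP i)).
pose g i x := (F i (x + h) - F i x) / h.
have dg i (x : R) : is_derive x (1 : R) (g i) ((f i (x + h) - f i x) / h).
  have -> : g i = h^-1 \*: ((fun x => F i (x + h)) - F i).
    by apply/funext => y; rewrite /g mulrC.
  rewrite (mulrC _ h^-1); apply: is_deriveZ; apply: is_deriveB.
  exact: is_derive_shifted.
have gc i x : exists2 c, x < c < x + h & g i x = f i c by exact: derive_mvt.
exists g; split=> //; split=> [i x|i x|i x|i x|x].
- by apply: differentiable_continuous; apply/derivable1_diffP; exact: ex_derive.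
- congr (_ / _); rewrite addrAC.
  by have := primitive_diff_cst (x + h) x (dF i) (dF i) (kf_per fP i); lra.
- congr (_ / _).
  by have := primitive_diff_cst (x + h) x (dF (i + e)) (dF i) (kf_shift fP i); lra.
- by have [c _ ->] := gc i x; exact: kf_ge0 fP _ _.
- rewrite -mulr_suml sumrB.
  have [|c _ ->] := @derive_mvt _ (fun x => \sum_i F i x) (fun x => \sum_i f i x) x h h0.
    by move=> y; rewrite -fct_sumE; exact: is_derive_sum.
  exact: kf_sum fP c.
Qed.

(** Translation and periodicity make all the integrals equal, and they add up to [L]. *)
Lemma kernel_integral L h f i : 0 < L -> L = h * p.+1%:R -> kernel_family L h f ->
  (\int[mu]_(x in `[0%R, L]) f i x)%R = h.
Proof.
move=> L0 LE fP; have [F dF] := choice (fun i => primitive_exists (@kf_cont _ _ _ fP i)).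
have IF j : (\int[mu]_(x in `[0%R, L]) f j x)%R = F j L - F j 0.
  rewrite /Rintegral (@continuous_FTC2 _ _ (F j) _ _ L0)//.
  - exact: continuous_subspaceT (@kf_cont _ _ _ fP j).
  - split.
    + by move=> x _; exact: ex_derive.
    + by apply: cvg_at_right_filter; apply: differentiable_continuous;
        apply/derivable1_diffP; exact: ex_derive.
    + by apply: cvg_at_left_filter; apply: differentiable_continuous;
        apply/derivable1_diffP; exact: ex_derive.
  - by move=> x _; rewrite derive1E; exact: derive_val.
have step j : F (j + e) L - F (j + e) 0 = F j L - F j 0.
  have := primitive_diff_cst 0 h (dF (j + e)) (dF (j + e)) (kf_per fP (j + e)).
  have := primitive_diff_cst L 0 (dF (j + e)) (dF j) (kf_shift fP j).
  by rewrite !add0r (addrC h L); lra.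
have const j : F j L - F j 0 = F 0 L - F 0 0.
  have -> : j = e *+ j.
    by apply: val_inj; rewrite Zp_mulrn /= modnMml mul1n modn_small.
  elim: (nat_of_ord j) => [|k IH]; first by rewrite mulr0n.
  by rewrite mulrSr step.
have : \sum_j (F j L - F j 0) = L.
  rewrite sumrB; have [|c _] := @derive_mvt _ (fun x => \sum_i F i x)
      (fun x => \sum_i f i x) 0 L L0.
    by move=> y; rewrite -fct_sumE; exact: is_derive_sum.
  rewrite (kf_sum fP c) add0r => /(congr1 ( *%R^~ L)).
  by rewrite divfK ?gt_eqF// mul1r.
under eq_bigr do rewrite const.
rewrite sumr_const card_ord IF const -mulr_natr => E.
have p0 : p.+1%:R != 0 :> R by rewrite pnatr_eq0.
by apply: (mulIf p0); rewrite E.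
Qed.

End kernels.

Section hat_kernel.
Context {R : realType} (p : nat).
Local Notation I := 'I_p.+1.
Local Notation e := (Zp1 : I).

Lemma lipschitz_continuous (f : R -> R) (k : R) : 0 < k ->
  (forall x y, x <= y -> `|f x - f y| <= k * (y - x)) -> continuous f.
Proof.
move=> k0 fk x; apply/cvgrPdist_le => eps eps0; near=> t.
have xt : `|x - t| <= eps / k.
  by near: t; apply: cvgr_dist_le; [exact: cvg_id|exact: divr_gt0].
have key : `|f x - f t| <= k * `|x - t|.
  have [xt'|tx] := leP x t.
    by apply: le_trans (fk _ _ xt') _; rewrite ler_wpM2l ?(ltW k0)// distrC ler_norm.
  rewrite distrC; apply: le_trans (fk _ _ (ltW tx)) _.
  by rewrite ler_wpM2l ?(ltW k0)// ler_norm.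
by apply: le_trans key _; rewrite mulrC -ler_pdivlMr.
Unshelve. all: by end_near. Qed.

(** Integer multiples of the generator [Zp1] reduce the floor modulo the number of nodes. *)
Definition cell_index (h x : R) : I := e *~ Num.floor (x / h).

Definition cell_frac (h x : R) : R := x / h - (Num.floor (x / h))%:~R.

(** The weights of linear interpolation between neighbouring nodes, that is the periodic tent
    functions. *)
Definition hat h (i : I) x : R :=
  (cell_index h x == i)%:R * (1 - cell_frac h x) +
  (cell_index h x + e == i)%:R * cell_frac h x.

Lemma cell_frac01 h x : 0 <= cell_frac h x < 1.
Proof.
rewrite /cell_frac; have /andP[] := floor_itv (x / h).
by rewrite intrD; lra.
Qed.

Lemma Zp1_mulrz_period : e *~ (p.+1%:Z) = 0.
Proof.
by apply: val_inj; rewrite /= -pmulrn Zp_mulrn /= modnMml mul1n modnn.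
Qed.

Lemma floorD1 (x : R) (k : int) : Num.floor (x + k%:~R) = Num.floor x + k.
Proof. by rewrite floorDrz ?intr_int// intrKfloor. Qed.

Lemma hat_lipschitz h i x y : 0 < h -> x <= y ->
  `|hat h i x - hat h i y| <= 3 / h * (y - x).
Proof.
move=> h0 xy; rewrite mulrAC -mulrA mulrBl.
have xy' : x / h <= y / h by rewrite ler_pM2r ?invr_gt0.
have : 0 <= y / h - x / h by rewrite subr_ge0.
have -> : y / h - x / h = (Num.floor (y / h) - Num.floor (x / h))%:~R +
    (cell_frac h y - cell_frac h x) by rewrite /cell_frac intrB; lra.
have := cell_frac01 h x; have := cell_frac01 h y.
have := le_floor xy'; rewrite /hat /cell_index.
move: (Num.floor (x / h)) (Num.floor (y / h)) => a b.
move: (cell_frac h x) (cell_frac h y) => s s'; rewrite -subr_ge0 => ab s01 s'01 D0.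
have -> : e *~ b = e *~ a + e *~ (b - a) by rewrite -mulrzDr addrC subrK.
have u01 (c d : bool) (t : R) : 0 <= t < 1 -> 0 <= c%:R * (1 - t) + d%:R * t <= 1.
  by case: c; case: d => /=; lra.
case: (b - a) ab D0 => // -[|[|k]] _; rewrite ?add0r => D0.
- rewrite mulr0z !addr0; move: (_ == i) (_ + e == i) => c0 c1.
  by rewrite ler_norml; move: s01 s'01; case: c0; case: c1 => /=; lra.
- rewrite mulr1z; move: (_ == i) (_ + e == i) (_ + e + e == i) => c0 c1 c2.
  by rewrite ler_norml; move: s01 s'01; case: c0; case: c1; case: c2 => /=; lra.
- have k2 : 2 <= (Posz k.+2)%:~R :> R by rewrite -pmulrn ler_nat.
  have /andP[] := u01 (e *~ a == i) (e *~ a + e == i) s s'01.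
  move: (e *~ a + e *~ _) => d; have /andP[] := u01 (d == i) (d + e == i) s' s01.
  by rewrite ler_norml; lra.
Qed.

Lemma hat_family h : 0 < h -> kernel_family (h * p.+1%:R) h (hat h).
Proof.
move=> h0; split=> [i|i x|i x|i x|x].
- apply: (@lipschitz_continuous _ (3 / h)); first exact: divr_gt0.
  by move=> x y; exact: hat_lipschitz.
- have E : (x + h * p.+1%:R) / h = x / h + (Posz p.+1)%:~R.
    by rewrite mulrDl mulrAC divff ?gt_eqF// mul1r.
  rewrite /hat /cell_index /cell_frac E floorD1 mulrzDr Zp1_mulrz_period addr0.
  by congr (_ * (1 - _) + _ * _); rewrite intrD; ring.
- have E : (x + h) / h = x / h + 1%:~R by rewrite mulrDl divff ?gt_eqF.
  rewrite /hat /cell_index /cell_frac E floorD1 mulrzDr mulr1z.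
  by rewrite !(inj_eq (addIr _)); congr (_ * (1 - _) + _ * _); rewrite intrD; ring.
- have := cell_frac01 h x; rewrite /hat.
  by case: (_ == i); case: (_ == i) => /=; lra.
- rewrite big_split/= -!mulr_suml.
  have S (j : I) : \sum_i (j == i)%:R = 1 :> R.
    rewrite (bigD1 j)//= eqxx big1 ?addr0// => i ij.
    by rewrite eq_sym (negbTE ij).
  by rewrite !S !mul1r subrK.
Qed.

Lemma hat_neq0 h i x : hat h i x != 0 -> i = cell_index h x \/ i = cell_index h x + e.
Proof.
rewrite /hat; have [->|_] := eqVneq (cell_index h x) i; first by left.
have [->|_] := eqVneq (cell_index h x + e) i; first by right.
by rewrite !mul0r addr0 eqxx.
Qed.

Lemma Zp1_mulrz_eq0 (k : int) : e *~ k = 0 -> (`|k| < p.+1)%N -> k = 0.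
Proof.
have nat_case (m : nat) : e *+ m = 0 -> (m < p.+1)%N -> m = 0%N.
  move=> /(congr1 val); rewrite Zp_mulrn /= modnMml mul1n => m0 mp.
  by rewrite modn_small in m0.
case: k => [m|m]; first by rewrite -pmulrn => /nat_case H /H ->.
by rewrite NegzE mulrNz -pmulrn => /eqP; rewrite oppr_eq0 => /eqP/nat_case H /H.
Qed.

(* The bounds on [y] exclude a wrap-around through the periodic boundary. *)
Lemma cell_index_close h (i : I) x y (c d : bool) : 0 < h ->
    i = cell_index h x + e *+ c -> i = cell_index h y + e *+ d ->
    0 <= x < h * p.+1%:R + h -> 3 * h <= y < h * p.+1%:R - 2 * h ->
  `|x - y| < 2 * h.
Proof.
move=> h0 -> E /andP[x0 xL] /andP[y0 yL].
have xlo : 0 <= x / h by rewrite divr_ge0// ltW.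
have xhi : x / h < p.+2%:R.
  by rewrite ltr_pdivrMr// -[p.+2%:R]natr1 mulrDl mul1r mulrC.
have ylo : 3 <= y / h by rewrite ler_pdivlMr.
have yhi : y / h < p.+1%:R - 2.
  by rewrite ltr_pdivrMr// mulrBl mulrC.
rewrite -(ltr_pM2r (x := h^-1)) ?invr_gt0//.
rewrite -[X in _ * X]gtr0_norm ?invr_gt0// -normrM mulrBl mulrK ?unitfE ?gt_eqF//.
have := floor_itv (x / h); have := floor_itv (y / h).
move: E; rewrite /cell_index.
move: (x / h) (y / h) xlo xhi ylo yhi => {x0 xL y0 yL}X Y xlo xhi ylo yhi.
move: (Num.floor X) (Num.floor Y) => a b E /andP[b1 b2] /andP[a1 a2].
rewrite intrD in a2 b2.
have a_lo : -1 < a by rewrite -(ltr_int R); lra.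
have a_hi : a < p.+2%:Z by rewrite -(ltr_int R) -pmulrn; lra.
have b_lo : 2 < b by rewrite -(ltr_int R); lra.
have b_hi : b < p%:Z - 1.
  by rewrite -(ltr_int R) intrB -pmulrn; move: yhi; rewrite -natr1; lra.
have : e *~ (a + (c : nat)%:Z - (b + (d : nat)%:Z)) = 0.
  by rewrite mulrzBr !mulrzDr -!pmulrn E subrr.
move=> /Zp1_mulrz_eq0 ab.
have {}ab : a = b + (d : nat)%:Z - (c : nat)%:Z.
  suff : a + (c : nat)%:Z - (b + (d : nat)%:Z) = 0 by lia.
  by apply: ab; case: (c); case: (d); lia.
move: a1 a2; rewrite ab intrB intrD ltr_norml.
by case: (c); case: (d) => /=; rewrite -!pmulrn ?mulr1n ?mulr0n; lra.
Qed.

End hat_kernel.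

Section integrable_times_continuous.
Context {R : realType}.
Notation mu := (@lebesgue_measure R).

Lemma integrable_continuousM (a b : R) (f k : R -> R) (M : R) :
    mu.-integrable `[a, b] (EFin \o f) -> continuous k ->
    (forall x, `|k x| <= M) ->
  mu.-integrable `[a, b] (EFin \o (fun x => f x * k x)).
Proof.
move=> fi ck kM.
apply: (@integrableMl _ _ _ mu `[a, b] _ (EFin \o f) k) => //.
  by apply: measurable_funTS; apply: continuous_measurable_fun.
exists M; split; first exact: num_real.
by move=> x Mx y _; exact: le_trans (kM y) (ltW Mx).
Qed.

End integrable_times_continuous.

Lemma measurable_fun_limn_einf d (T : measurableType d) (R : realType) (D : set T)
    (f : (T -> \bar R)^nat) :
  (forall n, measurable_fun D (f n)) -> measurable_fun D (fun x => limn_einf (f ^~ x)).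
Proof.
move=> mf; rewrite /limn_einf; apply: measurableT_comp => //.
by apply: (measurable_fun_limn_esup (f := fun n x => - f n x)%E) => n; exact: measurableT_comp.
Qed.

(** Asks for domination by the lower limit rather than convergence, since the profiles are only
    known to dominate the limit function up to a constant from some index on. *)
Lemma fatou_ae d (T : measurableType d) (R : realType)
    (mu : {measure set T -> \bar R}) (D : set T) (f : (T -> \bar R)^nat)
    (g : T -> \bar R) :
    measurable D -> (forall n, measurable_fun D (f n)) ->
    (forall n x, D x -> 0 <= f n x)%E ->
    measurable_fun D g -> (forall x, D x -> 0 <= g x)%E ->
    {ae mu, forall x, D x -> (g x <= limn_einf (f ^~ x))%E} ->
  (\int[mu]_(x in D) g x <= limn_einf (fun n => \int[mu]_(x in D) f n x))%E.
Proof.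
move=> mD mf f0 mg g0 gf; apply: le_trans (fatou mu mD mf f0).
apply: ae_ge0_le_integral => //; last exact: measurable_fun_limn_einf.
move=> x Dx; rewrite limn_einf_lim; apply: lime_ge; first exact: is_cvg_einfs.
apply: nearW => n; apply: le_ereal_inf_tmp => _ [m _ <-]; exact: f0.
Qed.

Lemma limn_einf_le (R : realType) (u : (\bar R)^nat) (c : \bar R) (N : nat) :
  (forall n, (N <= n)%N -> u n <= c)%E -> (limn_einf u <= c)%E.
Proof.
move=> uc; rewrite limn_einf_lim; apply: lime_le; first exact: is_cvg_einfs.
exists N => // n /= Nn; apply: (@le_trans _ _ (u n)); last exact: uc.
by apply: ereal_inf_lbound; exists n => /=.
Qed.

Lemma continuous_sumr (R : realType) (V : topologicalType) (I : finType)
    (f : I -> V -> R) :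
  (forall i, continuous (f i)) -> continuous (fun x => \sum_i f i x).
Proof.
by move=> cf x; apply: (cvg_big (op := +%R)) => [|i _]; [exact: add_continuous|exact: cf].
Qed.

(** * One-dimensional means and Lebesgue differentiation *)

Section kernel_means.
Context {R : realType} (L : R) (kap : forall p, 'I_p.+1 -> R -> R).
Notation mu := (@lebesgue_measure R).
Hypothesis L0 : 0 < L.

Definition mesh p : R := L / p.+1%:R.

Hypothesis kP : forall p, kernel_family L (mesh p) (@kap p).
Hypothesis kloc : forall p i x y, 0 <= x <= L ->
  4 * mesh p <= y <= L - 3 * mesh p ->
  @kap p i x != 0 -> @kap p i y != 0 -> `|x - y| < 3 * mesh p.

Lemma mesh_gt0 p : 0 < mesh p. Proof. exact: divr_gt0. Qed.

Lemma meshE p : L = mesh p * p.+1%:R.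
Proof. by rewrite divfK// pnatr_eq0. Qed.

Definition kmean p (i : 'I_p.+1) (f : R -> R) : R :=
  (mesh p)^-1 * (\int[mu]_(x in `[0%R, L]) (f x * @kap p i x))%R.

Let normk p i x : `|@kap p i x| <= 1.
Proof. by rewrite ger0_norm ?(kf_ge0 (kP p))// (kf_le1 _ _ (kP p)). Qed.

Let integrable_kM p i (f : R -> R) : mu.-integrable `[0%R, L] (EFin \o f) ->
  mu.-integrable `[0%R, L] (EFin \o (fun x => f x * @kap p i x)).
Proof.
move=> fi; apply: (integrable_continuousM fi _ (normk i)).
exact: (@kf_cont _ _ _ _ _ (kP p)).
Qed.

(** The kernel has integral [mesh p], so the difference is a mean of [f x - f y]. The kernel is at
    most 1 and lives in the ball of radius 3h about [y], whose length 6h gives the factor 6. *)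
Lemma kmean_dist p (i : 'I_p.+1) (f : R -> R) y : mu.-integrable `[0%R, L] (EFin \o f) ->
    4 * mesh p <= y <= L - 3 * mesh p -> kap i y != 0 ->
  ((`|kmean i f - f y|)%:E <= 6%:E * davg (f \_ `[0%R, L]) y (3 * mesh p))%E.
Proof.
move=> fi yL ky; set ft := f \_ _; set h := mesh p.
have h0 : 0 < h by exact: mesh_gt0.
have yin : y \in `[0%R, L] by rewrite in_itv/=; move: yL; rewrite -/h; lra.
have ftE x : x \in `[0%R, L] -> ft x = f x by move=> xL; rewrite /ft patchE mem_setE xL.
have ci : mu.-integrable `[0%R, L] (EFin \o cst (f y)).
  exact/continuous_integrable_itv/cst_continuous.
have fyi : mu.-integrable `[0%R, L] (EFin \o (fun x => f x - f y)).
  exact: (integrableB _ fi ci).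
have -> : kmean i f - f y =
    h^-1 * (\int[mu]_(x in `[0%R, L]) ((f x - f y) * kap i x))%R.
  have -> : (fun x => (f x - f y) * kap i x) =
      (fun x => f x * kap i x - f y * kap i x).
    by apply/funext => x; rewrite mulrBl.
  rewrite RintegralB//; [|exact: integrable_kM|exact: (integrable_kM _ ci)].
  rewrite RintegralZl//; last first.
    exact/continuous_integrable_itv/(@kf_cont _ _ _ _ _ (kP p)).
  rewrite (kernel_integral _ L0 (meshE p) (kP p)) mulrBr -/h; congr (_ - _).
  by rewrite mulrC mulfK// gt_eqF.
rewrite normrM gtr0_norm ?invr_gt0// EFinM EFin_normr_Rintegral//; last first.
  exact: integrable_kM.
have dE : (davg ft y (3 * h) = ((6 * h)^-1)%:E *
    \int[mu]_(x in ball y (3 * h)%R) (`|ft x - ft y|)%:E)%E.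
  rewrite /davg /iavg lebesgue_measure_ball; last by rewrite mulr_ge0// ltW.
  rewrite (_ : (3 * h) *+ 2 = 6 * h); last by rewrite mulr2n; lra.
  by rewrite inver mulf_eq0 (gt_eqF h0) orbF pnatr_eq0/=.
rewrite dE muleA -EFinM (_ : 6 * (6 * h)^-1 = h^-1); last first.
  by rewrite invfM mulrA divff ?mul1r.
rewrite lee_pmul2l ?lte_fin ?invr_gt0//.
have mfk : measurable_fun `[0%R, L] (EFin \o (fun x => (f x - f y) * kap i x)).
  exact: (measurable_int mu (integrable_kM i fyi)).
apply: le_trans (le_abse_integral mu _ mfk) _ => //.
have mft : measurable_fun setT (fun x => (`|ft x - ft y|)%:E).
  apply/measurable_EFinP; apply: measurableT_comp => //; apply: measurable_funB => //.
  apply/(measurable_restrictT f) => //.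
  by apply/measurable_EFinP; exact: measurable_int fi.
have mball : measurable (ball y (3 * h)) by exact: measurable_ball.
apply: (@le_trans _ _ (\int[mu]_(x in `[0%R, L])
    ((fun x => (`|ft x - ft y|)%:E) \_ (ball y (3 * h)%R)) x)%E).
  apply: ge0_le_integral => //.
  - exact: measurableT_comp.
  - apply: measurable_funTS; exact/(measurable_restrictT _ mball)/measurable_funTS.
  - move=> x /= xL; rewrite patchE; case: ifPn => [_|].
      rewrite /= lee_fin normrM !ftE// -[leRHS]mulr1.
      by rewrite ler_wpM2l// normk.
    rewrite notin_setE => nb; suff -> : kap i x = 0 by rewrite mulr0 /= normr0.
    apply/eqP; apply: contrapT => /negP kx; apply: nb.
    rewrite /ball/= distrC; exact: (@kloc p i).
rewrite -integral_mkcondr; apply: ge0_subset_integral => //.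
- exact: measurableI.
- exact: measurable_funTS.
Qed.

Lemma mesh_cvg0 : mesh @ \oo --> 0.
Proof.
rewrite -(mulr0 L); apply: cvgM; first exact: cvg_cst.
exact: cvg_harmonic.
Qed.

(** The kernels at [y] are convex weights, and only indices with [kap i y] nonzero count; at a
    Lebesgue point all of their means are close to [f y]. *)
Lemma kmean_cvg (f Psi : R -> R) y : mu.-integrable `[0%R, L] (EFin \o f) ->
    0 < y < L -> lebesgue_pt (f \_ `[0%R, L]) y -> continuous Psi ->
  (fun p => \sum_(i < p.+1) Psi (kmean i f) * kap i y) @ \oo --> Psi (f y).
Proof.
move=> fi /andP[y0 yL] fy cPsi; apply/cvgrPdist_le => eps eps0.
have /cvgrPdist_le /(_ _ eps0) := cPsi (f y).
move=> /nbhs_ballP[delta /= delta0 Pdelta].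
have delta6 : 0 < delta / 7 by exact: divr_gt0.
have /fine_cvgP[davg_fin /cvgrPdist_lt/(_ _ delta6) davg0] := fy.
have : \forall r \near (0 : R)^'+,
    (6%:E * davg (f \_ `[0%R, L]) y r < delta%:E)%E.
  near=> r.
  have rfin : davg (f \_ `[0%R, L]) y r \is a fin_num by near: r; exact: davg_fin.
  have : `|0 - fine (davg (f \_ `[0%R, L]) y r)| < delta / 7 by near: r.
  rewrite sub0r normrN -(fineK rfin) -EFinM lte_fin => /ltr_normlW.
  by rewrite /= ltr_pdivlMr//; move: (fine _) => t; lra.
move=> /nbhs_ballP[rho /= rho0 Prho]; near=> p.
have hp : mesh p < Num.min (rho / 3) (Num.min (y / 4) ((L - y) / 3)).
  have := mesh_gt0 p; near: p.
  have : 0 < Num.min (rho / 3) (Num.min (y / 4) ((L - y) / 3)).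
    by rewrite !lt_min !divr_gt0// subr_gt0.
  move=> m0; have /cvgrPdist_lt/(_ _ m0) := mesh_cvg0.
  by apply: filterS => p; rewrite sub0r normrN => /ltr_normlW.
move: hp; rewrite !lt_min => /and3P[hrho hy hL].
have yL' : 4 * mesh p <= y <= L - 3 * mesh p by lra.
have close i : kap i y != 0 -> `|Psi (f y) - Psi (@kmean p i f)| <= eps.
  move=> ky; apply: Pdelta; rewrite /ball/= distrC -lte_fin.
  apply: le_lt_trans (kmean_dist fi yL' ky) _; apply: Prho => /=.
    by rewrite /ball/= sub0r normrN gtr0_norm ?mulr_gt0 ?mesh_gt0//; lra.
  by rewrite mulr_gt0// mesh_gt0.
rewrite -[Psi (f y)]mulr1 -(kf_sum (kP p) y) mulr_sumr -sumrB.
apply: le_trans (ler_norm_sum _ _ _) _.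
apply: (@le_trans _ _ (\sum_(i < p.+1) eps * kap i y)); last first.
  by rewrite -mulr_sumr (kf_sum (kP p)) mulr1.
apply: ler_sum => i _; rewrite -mulrBl normrM (ger0_norm (kf_ge0 (kP p) i y)).
have [->|ky] := eqVneq (kap i y) 0; first by rewrite !mulr0.
by rewrite ler_wpM2r ?close// (kf_ge0 (kP p)).
Unshelve. all: by end_near. Qed.

(** The integral of the interpolated values is exactly the sum over the grid. A finite family of
    functions is allowed, so that all the rows of a grid can be treated together. *)
Lemma kernel_fatou (I : finType) (f : I -> R -> R) (Psi : R -> R) :
    (forall a, mu.-integrable `[0%R, L] (EFin \o f a)) ->
    continuous Psi -> (forall t, 0 <= Psi t) ->
  (\int[mu]_(y in `[0%R, L]) (\sum_a Psi (f a y))%:E <=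
   limn_einf (fun p => (\sum_a \sum_(i < p.+1) mesh p * Psi (kmean i (f a)))%:E))%E.
Proof.
move=> fi cPsi Psi0.
pose g p y := \sum_a \sum_(i < p.+1) Psi (kmean i (f a)) * kap i y.
have cg p : continuous (g p).
  apply: continuous_sumr => a; apply: continuous_sumr => i y.
  by apply: cvgM; [exact: cvg_cst|exact: (@kf_cont _ _ _ _ _ (kP p))].
have g0 p y : 0 <= g p y.
  by apply: sumr_ge0 => a _; apply: sumr_ge0 => i _;
     rewrite mulr_ge0// (kf_ge0 (kP p)).
have mg D p : measurable_fun D (EFin \o g p).
  by apply/measurable_EFinP; apply: measurable_funTS; apply: continuous_measurable_fun.
have mf : measurable_fun `[0%R, L] (fun y => (\sum_a Psi (f a y))%:E).
  apply/measurable_EFinP; apply: measurable_sum => a.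
  apply: measurableT_comp; first exact: continuous_measurable_fun.
  by apply/measurable_EFinP; exact: (measurable_int mu (fi a)).
have -> : (fun p => (\sum_a \sum_(i < p.+1) mesh p * Psi (kmean i (f a)))%:E) =
    (fun p => (\int[mu]_(y in `[0%R, L]) (g p y)%:E)%E).
  apply/funext => p.
  have ki i : mu.-integrable `[0%R, L] (EFin \o @kap p i).
    exact/continuous_integrable_itv/(@kf_cont _ _ _ _ _ (kP p)).
  have kiE i : (\int[mu]_(y in `[0%R, L]) (@kap p i y)%:E = (mesh p)%:E)%E.
    rewrite -(kernel_integral i L0 (meshE p) (kP p)) /Rintegral fineK//.
    by apply: integrable_fin_num => //; exact: ki.
  under eq_integral do rewrite -sumEFin.
  rewrite ge0_integral_sum//; last 2 first.
  - move=> a; apply/measurable_EFinP; apply: measurable_sum => i.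
    apply: measurable_funM => //.
    by apply/measurable_EFinP; exact: (measurable_int mu (ki i)).
  - move=> a y _; rewrite lee_fin sumr_ge0// => i _.
    by rewrite mulr_ge0// (kf_ge0 (kP p)).
  rewrite -sumEFin; apply: eq_bigr => a _.
  under eq_integral do rewrite -sumEFin.
  rewrite ge0_integral_sum//; last 2 first.
  - move=> i; apply/measurable_EFinP; apply: measurable_funM => //.
    by apply/measurable_EFinP; exact: (measurable_int mu (ki i)).
  - by move=> i y _; rewrite lee_fin mulr_ge0// (kf_ge0 (kP p)).
  rewrite -sumEFin; apply: eq_bigr => i _.
  under eq_integral do rewrite EFinM.
  rewrite integralZl//; last exact: (ki i).
  by rewrite [X in (_ * X)%E](kiE i) -EFinM mulrC.
apply: fatou_ae => //.
- by move=> n; exact: mg.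
- by move=> n y _; rewrite lee_fin.
- by move=> y _; rewrite lee_fin sumr_ge0.
have lp : {ae mu, forall y, forall a, lebesgue_pt (f a \_ `[0%R, L]) y}.
  apply: filter_forall => a; apply: lebesgue_differentiation.
  exact: integrable_locally.
have n0 (c : R) : {ae mu, forall y, y != c}.
  exists [set c]; split=> //; first exact: lebesgue_measure_set1.
  by move=> y /= /negP; rewrite negbK => /eqP.
near=> y => yL.
have y0L : 0 < y < L.
  have : y != 0 by near: y; exact: n0.
  have : y != L by near: y; exact: n0.
  move: yL; rewrite /= in_itv/= => /andP[y0 yL].
  by rewrite !lt_neqAle y0 yL => -> yn; rewrite eq_sym yn.
have cv : (fun p => (g p y)%:E) @ \oo --> (\sum_a Psi (f a y))%:E.
  apply: cvg_EFin; first exact: nearW.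
  apply: (cvg_big (op := +%R)) => [|a _]; first exact: add_continuous.
  apply: kmean_cvg => //; move: a; near: y; exact: lp.
by rewrite (cvg_limn_einf_sup cv).1.
Unshelve. all: by end_near. Qed.

End kernel_means.

Section bump_kernels.
Context {R : realType}.

(** Hats, then two Steklov means. The means of the function use [kap]; derivatives of [kap] fall on
    [bet], while [gam] gives test fields whose derivatives fall on [kap]. The support of [kap] is
    one step longer than that of a hat, hence 3 instead of 2. *)
Lemma bump_kernels_exist (L : R) p : 0 < L ->
  exists bet kap gam : 'I_p.+1 -> R -> R,
  [/\ [/\ kernel_family L (mesh L p) bet, kernel_family L (mesh L p) kap
        & kernel_family L (mesh L p) gam],
      forall i (x : R), is_derive x (1 : R) (kap i)
        ((bet i (x + mesh L p) - bet i x) / mesh L p),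
      forall i (x : R), is_derive x (1 : R) (gam i)
        ((kap i (x + mesh L p) - kap i x) / mesh L p)
    & forall i x y, 0 <= x <= L -> 4 * mesh L p <= y <= L - 3 * mesh L p ->
        kap i x != 0 -> kap i y != 0 -> `|x - y| < 3 * mesh L p].
Proof.
move=> L0; set h := mesh L p; have h0 : 0 < h by exact: mesh_gt0.
have LE : L = h * p.+1%:R by exact: meshE.
have bP := hat_family p h0; rewrite -LE in bP.
have [kap [kP dk kb]] := steklov_exists h0 bP.
have [gam [gP dg _]] := steklov_exists h0 kP.
exists (hat h), kap, gam; split => // i x y /andP[x0 xL] /andP[y0 yL].
have [c /andP[xc cx] ->] := kb i x; have [d /andP[yd dy] ->] := kb i y.
have idx u : hat h i u != 0 -> exists b : bool, i = cell_index p h u + Zp1 *+ b.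
  by move=> /hat_neq0[->|->]; [exists false; rewrite addr0|exists true].
move=> /idx[b ic] /idx[b' id'].
suff : `|c - d| < 2 * h by rewrite !ltr_norml; lra.
by apply: (cell_index_close h0 ic id'); rewrite -LE; lra.
Qed.

End bump_kernels.

(** * Interpolation of grid functions by products of kernels *)

Section interpolation.
Context {R : realType} (p q : nat).
Local Notation T := ('I_p.+1 * 'I_q.+1)%type.
Implicit Types (a b : 'I_p.+1 -> R -> R) (c d : 'I_q.+1 -> R -> R) (f : T -> R).

Definition interp a c f (z : R * R) : R :=
  \sum_i \sum_j f (i, j) * (a i z.1 * c j z.2).

Lemma is_derive_fst (A : R -> R) (z : R * R) (d v : R) :
  is_derive z.1 v A d -> is_derive z ((v, 0) : R * R) (A \o fst) d.
Proof.
move=> [dA <-]; split; first exact: dA.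
by [].
Qed.

Lemma is_derive_fst0 (A : R -> R) (z : R * R) (v : R) :
  is_derive z ((0, v) : R * R) (A \o fst) 0.
Proof.
have E : (fun h : R => h^-1 *: ((A \o fst) (h *: ((0, v) : R * R) + z) -
    (A \o fst) z)) = cst 0.
  by apply/funext => h /=; rewrite scaler0 add0r subrr scaler0.
split.
  by rewrite /derivable E; exact: is_cvg_cst.
by rewrite /derive E; exact: lim_cst.
Qed.

Lemma is_derive_snd (A : R -> R) (z : R * R) (d v : R) :
  is_derive z.2 v A d -> is_derive z ((0, v) : R * R) (A \o snd) d.
Proof. by move=> [dA <-]; split; [exact: dA|]. Qed.

Lemma is_derive_snd0 (A : R -> R) (z : R * R) (v : R) :
  is_derive z ((v, 0) : R * R) (A \o snd) 0.
Proof.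
have E : (fun h : R => h^-1 *: ((A \o snd) (h *: ((v, 0) : R * R) + z) -
    (A \o snd) z)) = cst 0.
  by apply/funext => h /=; rewrite scaler0 add0r subrr scaler0.
split.
  by rewrite /derivable E; exact: is_cvg_cst.
by rewrite /derive E; exact: lim_cst.
Qed.

Lemma interp_sumE a c f : interp a c f =
  \sum_(i < p.+1) \sum_(j < q.+1) (f (i, j) \*: ((a i \o fst) * (c j \o snd))).
Proof.
apply/funext => z; rewrite fct_sumE; apply: eq_bigr => i _.
by rewrite fct_sumE.
Qed.

Lemma is_derive_interp1 a a' c f z :
    (forall i (x : R), is_derive x (1 : R) (a i) (a' i x)) ->
  is_derive z ((1, 0) : R * R) (interp a c f) (interp a' c f z).
Proof.
move=> da; rewrite interp_sumE; apply: is_derive_sum => i; apply: is_derive_sum => j.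
apply: is_deriveZ.
rewrite (_ : _ * _ = (a i \o fst) z *: (0 : R) + (c j \o snd) z *: a' i z.1).
  by apply: is_deriveM; [exact: is_derive_fst|exact: is_derive_snd0].
by rewrite scaler0 add0r mulrC.
Qed.

Lemma is_derive_interp2 a c c' f z :
    (forall j (x : R), is_derive x (1 : R) (c j) (c' j x)) ->
  is_derive z ((0, 1) : R * R) (interp a c f) (interp a c' f z).
Proof.
move=> dc; rewrite interp_sumE; apply: is_derive_sum => i; apply: is_derive_sum => j.
apply: is_deriveZ.
rewrite (_ : _ * _ = (a i \o fst) z *: c' j z.2 + (c j \o snd) z *: (0 : R)).
  by apply: is_deriveM; [exact: is_derive_fst0|exact: is_derive_snd].
by rewrite scaler0 addr0.
Qed.

Lemma continuous_interp a c f : (forall i, continuous (a i)) ->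
  (forall j, continuous (c j)) -> continuous (interp a c f).
Proof.
move=> ca cc; apply: continuous_sumr => i; apply: continuous_sumr => j z.
apply: cvgM; first exact: cvg_cst.
by apply: cvgM; apply: continuous_comp;
  [exact: cvg_fst|exact: ca|exact: cvg_snd|exact: cc].
Qed.

Lemma C1_interp a a' c c' f :
    (forall i (x : R), is_derive x (1 : R) (a i) (a' i x)) ->
    (forall j (x : R), is_derive x (1 : R) (c j) (c' j x)) ->
    (forall i, continuous (a i)) -> (forall j, continuous (c j)) ->
    (forall i, continuous (a' i)) -> (forall j, continuous (c' j)) ->
  [/\ C1 (interp a c f), pdx (interp a c f) = interp a' c f
    & pdy (interp a c f) = interp a c' f].
Proof.
move=> da dc ca cc ca' cc'.
have Ex : pdx (interp a c f) = interp a' c f.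
  apply/funext => z; have := is_derive_interp1 c f z da.
  exact: @derive_val.
have Ey : pdy (interp a c f) = interp a c' f.
  apply/funext => z; have := is_derive_interp2 a f z dc.
  exact: @derive_val.
split=> //; split; rewrite ?Ex ?Ey; [..|exact: continuous_interp|exact: continuous_interp].
  by move=> z; have := is_derive_interp1 c f z da => -[].
by move=> z; have := is_derive_interp2 a f z dc => -[].
Qed.

Lemma biperiodic_interp L h k a c f : kernel_family L h a -> kernel_family L k c ->
  biperiodic L (interp a c f).
Proof.
move=> aP cP x y; split; apply: eq_bigr => i _; apply: eq_bigr => j _ /=.
  by rewrite (kf_per aP).
by rewrite (kf_per cP).
Qed.

(** Summation by parts: [kf_shift] moves the translation from the kernel to the index. *)
Lemma interp_diff1 L h b c f z : kernel_family L h b ->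
  interp (fun i x => (b i (x + h) - b i x) / h) c f z =
  interp b c (fun t => (f (t + (Zp1, 0)) - f t) / h) z.
Proof.
move=> bP; rewrite /interp [LHS]exchange_big [RHS]exchange_big/=.
apply: eq_bigr => j _.
have E : \sum_i f (i, j) * (b i (z.1 + h) / h * c j z.2) =
    \sum_i f (i + Zp1, j) * (b i z.1 / h * c j z.2).
  rewrite (reindex_inj (addIr Zp1)); apply: eq_bigr => i _.
  by rewrite (kf_shift bP).
transitivity (\sum_i (f (i, j) * (b i (z.1 + h) / h * c j z.2) -
    f (i, j) * (b i z.1 / h * c j z.2))).
  by apply: eq_bigr => i _; ring.
rewrite sumrB E -sumrB; apply: eq_bigr => i _.
have -> : (i, j) + (Zp1, 0) = (i + Zp1, j) :> T by congr pair; rewrite addr0.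
by ring.
Qed.

Lemma interp_diff2 L h b c f z : kernel_family L h c ->
  interp b (fun j x => (c j (x + h) - c j x) / h) f z =
  interp b c (fun t => (f (t + (0, Zp1)) - f t) / h) z.
Proof.
move=> cP; apply: eq_bigr => i _.
have E : \sum_j f (i, j) * (b i z.1 * (c j (z.2 + h) / h)) =
    \sum_j f (i, j + Zp1) * (b i z.1 * (c j z.2 / h)).
  rewrite (reindex_inj (addIr Zp1)); apply: eq_bigr => j _.
  by rewrite (kf_shift cP).
transitivity (\sum_j (f (i, j) * (b i z.1 * (c j (z.2 + h) / h)) -
    f (i, j) * (b i z.1 * (c j z.2 / h)))).
  by apply: eq_bigr => j _; ring.
rewrite sumrB E -sumrB; apply: eq_bigr => j _.
have -> : (i, j) + (0, Zp1) = (i, j + Zp1) :> T by congr pair; rewrite addr0.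
by ring.
Qed.

Lemma sum_kernels L L' h k a c z : kernel_family L h a -> kernel_family L' k c ->
  \sum_i \sum_j a i z.1 * c j z.2 = 1.
Proof.
move=> aP cP; under eq_bigr do rewrite -mulr_sumr (kf_sum cP) mulr1.
exact: kf_sum aP _.
Qed.

Lemma normr_interp_le1 L L' h k a c f z : kernel_family L h a -> kernel_family L' k c ->
  (forall t, `|f t| <= 1) -> `|interp a c f z| <= 1.
Proof.
move=> aP cP f1; rewrite -(sum_kernels z aP cP).
apply: le_trans (ler_norm_sum _ _ _) _; apply: ler_sum => i _.
apply: le_trans (ler_norm_sum _ _ _) _; apply: ler_sum => j _.
have ac0 : 0 <= a i z.1 * c j z.2 by rewrite mulr_ge0 ?(kf_ge0 aP) ?(kf_ge0 cP).
by rewrite normrM (ger0_norm ac0) ler_piMl.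
Qed.

(** Jensen's inequality for the convex weights, from the nonnegativity of the variance. *)
Lemma sqr_interp_le L L' h k a c f z : kernel_family L h a -> kernel_family L' k c ->
  interp a c f z ^+ 2 <= interp a c (fun t => f t ^+ 2) z.
Proof.
move=> aP cP; set m := interp a c f z.
have : 0 <= interp a c (fun t => (f t - m) ^+ 2) z.
  apply: sumr_ge0 => i _; apply: sumr_ge0 => j _.
  by rewrite mulr_ge0 ?sqr_ge0// mulr_ge0 ?(kf_ge0 aP) ?(kf_ge0 cP).
suff -> : interp a c (fun t => (f t - m) ^+ 2) z =
    interp a c (fun t => f t ^+ 2) z - 2 * m * interp a c f z +
    m ^+ 2 * (\sum_i \sum_j a i z.1 * c j z.2).
  by rewrite (sum_kernels z aP cP) -/m expr2; lra.
move: (m) => x; rewrite /interp !mulr_sumr -sumrB -big_split/=.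
apply: eq_bigr => i _; rewrite !mulr_sumr -sumrB -big_split/=.
by apply: eq_bigr => j _; ring.
Qed.

End interpolation.

(** * Local means of a function on the torus *)
Section cell_integrals.
Context {R : realType} (L : R).
Hypothesis L0 : 0 < L.
Notation mu := (@lebesgue_measure R).
Notation D := (cell L).

Lemma measurable_cell : measurable D.
Proof. exact: measurableX. Qed.

Lemma leb2_cell : (leb2 D = (L * L)%:E)%E.
Proof.
rewrite /leb2 /cell product_measure1E//= lebesgue_measure_itv/= lte_fin L0.
by rewrite sube0 -EFinM.
Qed.

Lemma leb2_cell_lty : (leb2 D < +oo)%E.
Proof. by rewrite leb2_cell ltry. Qed.

Lemma integrable_cellM (u g : R * R -> R) (M : R) : cell_integrable L u ->
    measurable_fun setT g -> (forall z, `|g z| <= M) ->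
  cell_integrable L (fun z => u z * g z).
Proof.
move=> ui mg gM; apply: (@integrableMl _ _ _ leb2 D _ (EFin \o u) g) => //.
- exact: measurable_cell.
- exact: measurable_funTS.
- exists M; split; first exact: num_real.
  by move=> x Mx y _; exact: le_trans (gM y) (ltW Mx).
Qed.

Lemma integrable_cell_bounded (g : R * R -> R) (M : R) :
    measurable_fun setT g -> (forall z, `|g z| <= M) -> cell_integrable L g.
Proof.
move=> mg gM; apply: measurable_bounded_integrable => //.
- exact: measurable_cell.
- exact: leb2_cell_lty.
- exact: measurable_funTS.
- exists M; split; first exact: num_real.
  by move=> x Mx y _; exact: le_trans (gM y) (ltW Mx).
Qed.

Lemma cell_tonelli (g : R * R -> \bar R) : measurable_fun D g ->
    (forall z, D z -> 0 <= g z)%E ->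
  (\int[leb2]_(z in D) g z = \int[mu]_(y in `[0%R, L]) \int[mu]_(x in `[0%R, L]) g (x, y))%E.
Proof.
move=> mg g0; rewrite integral_mkcond.
have gDm : measurable_fun setT (g \_ D).
  exact/(measurable_restrictT _ measurable_cell).
rewrite (@fubini_tonelli2 _ _ _ _ _ mu mu)//; last first.
  by move=> z; rewrite patchE; case: ifPn => //; rewrite inE => /g0.
rewrite [RHS]integral_mkcond.
apply: eq_integral => y _; rewrite /fubini_G patchE.
case: ifPn => [yL|yL].
  rewrite [RHS]integral_mkcond; apply: eq_integral => x _.
  rewrite !patchE /cell; congr (if _ then _ else _).
  by apply/idP/idP; rewrite !inE/=; [case|move=> xL; split=> //; rewrite inE in yL].
apply: integral0_eq => x _; rewrite patchE ifF//.
by apply: contraNF yL; rewrite !inE => -[].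
Qed.

End cell_integrals.

Section moments.
Context {R : realType} (L : R) (p q : nat).
Hypothesis L0 : 0 < L.
Notation mu := (@lebesgue_measure R).
Notation D := (cell L).
Context (kx : 'I_p.+1 -> R -> R) (ky : 'I_q.+1 -> R -> R).
Hypotheses (kxP : kernel_family L (mesh L p) kx) (kyP : kernel_family L (mesh L q) ky).

Definition moment (u : R * R -> R) i j : R :=
  Rintegral leb2 D (fun z => u z * (kx i z.1 * ky j z.2)).

Lemma measurable_kxy i j :
  measurable_fun setT (fun z : R * R => kx i z.1 * ky j z.2).
Proof.
apply: measurable_funM.
  apply: measurableT_comp => //; apply: continuous_measurable_fun.
  exact: (@kf_cont _ _ _ _ _ kxP).
apply: measurableT_comp => //; apply: continuous_measurable_fun.
exact: (@kf_cont _ _ _ _ _ kyP).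
Qed.

Lemma kxy01 i j (z : R * R) : 0 <= kx i z.1 * ky j z.2 <= 1.
Proof.
rewrite mulr_ge0 ?(kf_ge0 kxP) ?(kf_ge0 kyP)//=.
by rewrite mulr_ile1 ?(kf_ge0 kxP) ?(kf_ge0 kyP) ?(kf_le1 _ _ kxP) ?(kf_le1 _ _ kyP).
Qed.

Lemma normr_kxy i j (z : R * R) : `|kx i z.1 * ky j z.2| <= 1.
Proof. by have /andP[k0 k1] := kxy01 i j z; rewrite ger0_norm. Qed.

Lemma integrable_kxy u i j : cell_integrable L u ->
  cell_integrable L (fun z => u z * (kx i z.1 * ky j z.2)).
Proof.
by move=> ui; apply: integrable_cellM (measurable_kxy i j) (normr_kxy i j).
Qed.

Lemma moment_EFin u i j : cell_integrable L u ->
  (\int[leb2]_(z in D) (u z * (kx i z.1 * ky j z.2))%:E = (moment u i j)%:E)%E.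
Proof.
move=> ui; rewrite /moment /Rintegral fineK//.
apply: integrable_fin_num; [exact: measurable_cell|exact: integrable_kxy].
Qed.

Lemma integral_interp u f : cell_integrable L u ->
  (\int[leb2]_(z in D) (u z * interp kx ky f z)%:E =
   (\sum_i \sum_j f (i, j) * moment u i j)%:E)%E.
Proof.
move=> ui.
have E z : (u z * interp kx ky f z)%:E = (\sum_i \sum_j
    (f (i, j))%:E * (u z * (kx i z.1 * ky j z.2))%:E)%E.
  rewrite mulr_sumr -sumEFin; apply: eq_bigr => i _.
  rewrite mulr_sumr -sumEFin; apply: eq_bigr => j _.
  by rewrite -EFinM mulrCA.
under eq_integral do rewrite E.
have mD := measurable_cell L.
have int1 i j : leb2.-integrable D
    (fun z => ((f (i, j))%:E * (u z * (kx i z.1 * ky j z.2))%:E)%E).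
  by apply: integrableZl => //; exact: integrable_kxy.
rewrite integral_sum//; last by move=> i; exact: integrable_sum.
rewrite -sumEFin; apply: eq_bigr => i _.
rewrite integral_sum// -sumEFin; apply: eq_bigr => j _.
rewrite integralZl//; last exact: integrable_kxy.
by rewrite moment_EFin.
Qed.

Lemma measurable_interp f : measurable_fun setT (interp kx ky f).
Proof.
apply: measurable_sum => i; apply: measurable_sum => j.
by apply: measurable_funM => //; exact: measurable_kxy.
Qed.

Lemma moment1 i j : moment (cst 1) i j = mesh L p * mesh L q.
Proof.
apply: EFin_inj; rewrite -moment_EFin; last first.
  apply: (@integrable_cell_bounded _ _ L0 _ 1) => //.
  by move=> z; rewrite normr1.
have ki n (k : 'I_n.+1 -> R -> R) (kP : kernel_family L (mesh L n) k) a :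
    (\int[mu]_(x in `[0%R, L]) (k a x)%:E = (mesh L n)%:E)%E.
  rewrite -(kernel_integral a L0 (meshE L n) kP) /Rintegral fineK//.
  apply: integrable_fin_num => //; apply: continuous_integrable_itv.
  exact: (@kf_cont _ _ _ _ _ kP).
have km n (k : 'I_n.+1 -> R -> R) (kP : kernel_family L (mesh L n) k) a :
    measurable_fun `[0%R, L] (EFin \o k a).
  apply/measurable_EFinP; apply: measurable_funTS; apply: continuous_measurable_fun.
  exact: (@kf_cont _ _ _ _ _ kP).
rewrite cell_tonelli//.
- under eq_integral => y _.
    under eq_integral do rewrite /= mul1r mulrC EFinM.
    rewrite ge0_integralZl_EFin//; last 3 first.
    + by move=> x _; rewrite lee_fin (kf_ge0 kxP).
    + exact: km.
    + exact: (kf_ge0 kyP).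
    rewrite [X in (_ * X)%E](ki _ _ kxP) muleC.
    over.
  rewrite ge0_integralZl_EFin//.
  + by rewrite [X in (_ * X)%E](ki _ _ kyP).
  + by move=> x _; rewrite lee_fin (kf_ge0 kyP).
  + exact: km.
  + exact/ltW/mesh_gt0.
- apply/measurable_EFinP; apply: measurable_funTS; apply: measurable_funM => //.
  exact: measurable_kxy.
- by move=> z _; rewrite lee_fin mul1r; have /andP[] := kxy01 i j z.
Qed.

End moments.

HB.instance Definition _ (U V : finZmodType) := GRing.Zmodule.on (U * V)%type.

Lemma ae_leb2_filter (R : realType) : Filter (almost_everywhere (@leb2 R)).
Proof.
exact: (ae_filter_ringOfSetsType ((@lebesgue_measure R) \x (@lebesgue_measure R))%E).
Qed.

Lemma cell_integrableZ (R : realType) (L c : R) (f : R * R -> R) :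
  cell_integrable L f -> cell_integrable L (fun z => c * f z).
Proof.
move=> fi.
suff : leb2.-integrable (cell L) (fun z => c%:E * (f z)%:E)%E by [].
by apply: integrableZl => //; exact: measurable_cell.
Qed.

Lemma cell_integrableD (R : realType) (L : R) (f g : R * R -> R) :
  cell_integrable L f -> cell_integrable L g ->
  cell_integrable L (fun z => f z + g z).
Proof.
move=> fi gi.
suff : leb2.-integrable (cell L) (fun z => (f z)%:E + (g z)%:E)%E by [].
by apply: integrableD => //; exact: measurable_cell.
Qed.

Lemma cell_integralD (R : realType) (L : R) (f g : R * R -> R) :
  cell_integrable L f -> cell_integrable L g ->
  (\int[leb2]_(z in cell L) (f z + g z)%:E =
  \int[leb2]_(z in cell L) (f z)%:E + \int[leb2]_(z in cell L) (g z)%:E)%E.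
Proof.
move=> fi gi; under eq_integral do rewrite EFinD.
by rewrite integralD//; exact: measurable_cell.
Qed.

Lemma cell_integralZl (R : realType) (L c : R) (f : R * R -> R) :
  cell_integrable L f -> (\int[leb2]_(z in cell L) (c * f z)%:E =
  c%:E * \int[leb2]_(z in cell L) (f z)%:E)%E.
Proof.
move=> fi; under eq_integral do rewrite EFinM.
by rewrite integralZl//; exact: measurable_cell.
Qed.

(** * Transfer of both norms to the grid *)

Section grid_of_torus.
Context {R : realType} (L : R) (p q : nat).
Hypothesis L0 : 0 < L.
Notation mu := (@lebesgue_measure R).
Notation D := (cell L).
Local Notation hx := (mesh L p).
Local Notation hy := (mesh L q).
Local Notation T := ('I_p.+1 * 'I_q.+1)%type.
Local Notation e1 := ((Zp1, 0) : T).
Local Notation e2 := ((0, Zp1) : T).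
Context (bx kx gx : 'I_p.+1 -> R -> R) (by_ ky gy : 'I_q.+1 -> R -> R).
Hypotheses (bxP : kernel_family L hx bx) (kxP : kernel_family L hx kx)
  (gxP : kernel_family L hx gx).
Hypotheses (byP : kernel_family L hy by_) (kyP : kernel_family L hy ky)
  (gyP : kernel_family L hy gy).
Hypotheses
  (dkx : forall i (x : R), is_derive x (1 : R) (kx i) ((bx i (x + hx) - bx i x) / hx))
  (dgx : forall i (x : R), is_derive x (1 : R) (gx i) ((kx i (x + hx) - kx i x) / hx))
  (dky : forall i (x : R), is_derive x (1 : R) (ky i) ((by_ i (x + hy) - by_ i x) / hy))
  (dgy : forall i (x : R), is_derive x (1 : R) (gy i) ((ky i (x + hy) - ky i x) / hy)).
Context (u : R * R -> R) (V J lam : R).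
Hypothesis ui : cell_integrable L u.
Hypothesis uge : {ae leb2, forall z, cell L z -> -1 <= u z}.
Hypothesis uV : (torus_variation L u <= V%:E)%E.
Hypothesis lam0 : 0 < lam.

Let hx0 : 0 < hx. Proof. exact: mesh_gt0. Qed.
Let hy0 : 0 < hy. Proof. exact: mesh_gt0. Qed.
Let w := hx * hy.
Let w0 : 0 < w. Proof. exact: mulr_gt0. Qed.

Definition cell_mean (u : R * R -> R) (t : T) : R := w^-1 * moment L kx ky u t.1 t.2.

Lemma integral_interp_mean f :
  (\int[leb2]_(z in D) (u z * interp kx ky f z)%:E =
   (w * \sum_t cell_mean u t * f t)%:E)%E.
Proof.
rewrite integral_interp//; congr EFin.
rewrite pair_big/= mulr_sumr; apply: eq_bigr => -[i j] _ /=.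
rewrite /cell_mean/= mulrA (mulrA w) divff ?gt_eqF// mul1r.
by rewrite mulrC.
Qed.

Lemma cell_mean_ge t : -1 <= cell_mean u t.
Proof.
rewrite ler_pdivlMl// mulrN1 /w -(moment1 L0 kxP kyP t.1 t.2).
have i1 : cell_integrable L (cst (1 : R)).
  by apply: (@integrable_cell_bounded _ _ L0 _ 1) => // z; rewrite normr1.
rewrite -lee_fin EFinN -!moment_EFin//.
set k := fun z : R * R => kx t.1 z.1 * ky t.2 z.2.
have mk : measurable_fun setT k by exact: (measurable_kxy kxP kyP).
have k01 z : 0 <= k z <= 1 by exact: (kxy01 kxP kyP).
have mD := measurable_cell L.
have ki : cell_integrable L (fun z => cst 1 z * k z) by exact: (integrable_kxy kxP kyP _ _ i1).
have mu_ : measurable_fun D u by apply/measurable_EFinP; exact: (measurable_int leb2 ui).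
(* Equals [u] almost everywhere on the cell and satisfies the lower bound everywhere, so that
   integrals can be compared pointwise. *)
pose u' z := Num.max (u z) (-1).
have mu' : measurable_fun D u' by exact: measurable_maxr.
have u'u : ae_eq leb2 D (fun z => (u z * k z)%:E) (fun z => (u' z * k z)%:E).
  apply: (@filterS _ _ (ae_leb2_filter R)) uge => z uz Dz.
  by rewrite /u' (max_idPl (uz Dz)).
have mku (f : R * R -> R) : measurable_fun D f ->
    measurable_fun D (fun z => (f z * k z)%:E).
  by move=> mf; apply/measurable_EFinP; apply: measurable_funM => //; exact: measurable_funTS.
have -> : (\int[leb2]_(z in D) (u z * k z)%:E = \int[leb2]_(z in D) (u' z * k z)%:E)%E.
  by apply: ae_eq_integral => //; exact: mku.
have absi : leb2.-integrable D (fun z => (`|u z|%:E + 1%:E)%E).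
  by apply: integrableD => //; exact: (integrable_norm ui).
have u'i : cell_integrable L u'.
  apply: le_integrable absi => //; first exact/measurable_EFinP.
  move=> z _ /=; rewrite lee_fin [leRHS]ger0_norm ?addr_ge0// ler_norml /u'.
  rewrite le_max ge_max; have := ler_norm (u z); have := normr_ge0 (u z).
  by have := ler_norm (- u z); rewrite normrN => *; apply/andP; split;
    [apply/orP; right|apply/andP; split]; lra.
have u'ki : leb2.-integrable D (fun z => (u' z * k z)%:E).
  by apply: integrable_cellM mk _ => // z; exact: (normr_kxy kxP kyP).
rewrite -mulN1e -EFinN -cell_integralZl//.
apply: le_integral => //.
  exact: cell_integrableZ.
move=> z _; rewrite lee_fin mulrA ler_wpM2r//; first by case/andP: (k01 z).
by rewrite /= mulr1 /u' le_max lexx orbT.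
Qed.

Let v := cell_mean u.

Let C1_0 : C1 (cst 0 : R * R -> R) /\ biperiodic L (cst 0).
Proof.
split; last by [].
have d0 (x : R * R) : pdx (cst 0 : R * R -> R) x = 0 by rewrite /pdx derive_cst.
have d0' (x : R * R) : pdy (cst 0 : R * R -> R) x = 0 by rewrite /pdy derive_cst.
split.
- by move=> z; exact: derivable_cst.
- by move=> z; exact: derivable_cst.
- by rewrite (_ : pdx _ = cst 0); [exact: cst_continuous|apply/funext].
- by rewrite (_ : pdy _ = cst 0); [exact: cst_continuous|apply/funext].
Qed.

Let steklov_cont n (h : R) (k : 'I_n.+1 -> R -> R) : kernel_family L h k ->
  forall i, continuous (fun x => (k i (x + h) - k i x) / h).
Proof.
move=> kP i x; apply: cvgM; last exact: cvg_cst.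
apply: cvgB; last exact: (@kf_cont _ _ _ _ _ kP).
apply: continuous_comp; last exact: (@kf_cont _ _ _ _ _ kP).
by apply: cvgD; [exact: cvg_id|exact: cvg_cst].
Qed.

(** The field with first component [interp gx ky s] and second component 0 is admissible, and its
    divergence interpolates the difference quotient of [s] with the very kernels that define the
    means. *)
Let variation_test (s : T -> R) : (forall t, `|s t| <= 1) ->
  w * \sum_t v t * ((s (t + e1) - s t) / hx) <= V.
Proof.
move=> s1; rewrite -lee_fin -integral_interp_mean; apply: le_trans uV.
have [FC1 FE _] := C1_interp (c := ky) s dgx dky (@kf_cont _ _ _ _ _ gxP)
  (@kf_cont _ _ _ _ _ kyP) (steklov_cont kxP) (steklov_cont byP).
apply: ereal_sup_ubound; exists (interp gx ky s), (cst 0); split.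
- by split=> //; exact: biperiodic_interp gxP kyP.
- exact: C1_0.
- move=> z; rewrite expr0n addr0 -[leLHS]real_normK ?num_real// expr_le1//.
  exact: normr_interp_le1 gxP kyP s1.
- apply: eq_integral => z _; congr EFin; congr (_ * _).
  by rewrite FE (interp_diff1 _ _ _ kxP) /pdy derive_cst addr0.
Qed.

Let variation_test2 (s : T -> R) : (forall t, `|s t| <= 1) ->
  w * \sum_t v t * ((s (t + e2) - s t) / hy) <= V.
Proof.
move=> s1; rewrite -lee_fin -integral_interp_mean; apply: le_trans uV.
have [FC1 _ FE] := C1_interp (a := kx) s dkx dgy (@kf_cont _ _ _ _ _ kxP)
  (@kf_cont _ _ _ _ _ gyP) (steklov_cont bxP) (steklov_cont kyP).
apply: ereal_sup_ubound; exists (cst 0), (interp kx gy s); split.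
- exact: C1_0.
- by split=> //; exact: biperiodic_interp kxP gyP.
- move=> z; rewrite expr0n add0r -[leLHS]real_normK ?num_real// expr_le1//.
  exact: normr_interp_le1 kxP gyP s1.
- apply: eq_integral => z _; congr EFin; congr (_ * _).
  by rewrite FE (interp_diff2 _ _ _ kyP) /pdx derive_cst add0r.
Qed.

(** After summation by parts, the sign of the backward difference of [v] is the optimal test
    function. *)
Let sum_diff_le (e : T) (h : R) : 0 < h ->
    (forall s : T -> R, (forall t, `|s t| <= 1) ->
      w * \sum_t v t * ((s (t + e) - s t) / h) <= V) ->
  \sum_t `|v (t + e) - v t| <= h * (V / w).
Proof.
move=> h0 test; pose s t := Num.sg (v (t - e) - v t).
have s1 t : `|s t| <= 1 by rewrite normr_sg; case: (_ != 0).
have := test s s1.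
have -> : \sum_t v t * ((s (t + e) - s t) / h) = h^-1 * \sum_t `|v (t + e) - v t|.
  transitivity (h^-1 * (\sum_t v t * s (t + e) - \sum_t v t * s t)).
    by rewrite -sumrB mulr_sumr; apply: eq_bigr => t _; ring.
  rewrite -(sum_shift e (fun t => v t * s t)) -sumrB; congr (_ * _).
  apply: eq_bigr => t _; rewrite -mulrBl /s addrK mulrC -normrEsg.
  exact: distrC.
move: (\sum_t _) => S.
rewrite (_ : h * (V / w) = h / w * V); last by ring.
rewrite {2}(_ : S = h / w * (w * (h^-1 * S))); last by field; rewrite !gt_eqF.
by move=> H; rewrite ler_wpM2l// divr_ge0// ltW.
Qed.

Let normr_interp (a : 'I_p.+1 -> R -> R) (c : 'I_q.+1 -> R -> R) (f : T -> R) z : kernel_family L hx a -> kernel_family L hy c ->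
  `|interp a c f z| <= \sum_i \sum_j `|f (i, j)|.
Proof.
move=> aP cP; apply: le_trans (ler_norm_sum _ _ _) _; apply: ler_sum => i _.
apply: le_trans (ler_norm_sum _ _ _) _; apply: ler_sum => j _.
by rewrite normrM ler_piMr// (normr_kxy aP cP).
Qed.

Let integral_sqr_interp (a : 'I_p.+1 -> R -> R) (c : 'I_q.+1 -> R -> R) (f : T -> R) : kernel_family L hx a -> kernel_family L hy c ->
  (\int[leb2]_(z in D) (interp a c f z ^+ 2)%:E <= (w * \sum_t f t ^+ 2)%:E)%E.
Proof.
move=> aP cP; have mD := measurable_cell L.
have i1 : cell_integrable L (cst (1 : R)).
  by apply: (@integrable_cell_bounded _ _ L0 _ 1) => // z; rewrite normr1.
have -> : w * \sum_t f t ^+ 2 = \sum_i \sum_j f (i, j) ^+ 2 * moment L a c (cst 1) i j.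
  rewrite pair_big/= mulr_sumr; apply: eq_bigr => -[i j] _ /=.
  by rewrite moment1// mulrC.
rewrite -(integral_interp aP cP (fun t => f t ^+ 2) i1).
apply: ge0_le_integral => //.
- by move=> z _; rewrite lee_fin sqr_ge0.
- apply/measurable_EFinP; apply: measurable_funTS; apply: measurable_funX.
  exact: measurable_interp aP cP _.
- apply/measurable_EFinP; apply: measurable_funTS; apply: measurable_funM => //.
  exact: measurable_interp aP cP _.
- by move=> z _; rewrite lee_fin mul1r (sqr_interp_le f z aP cP).
Qed.

(** The dilation by [lam] is mere bookkeeping: the grid values stay, the steps are declared to be
    [lam] times shorter, and the two bounds scale accordingly. For the duality, [interp kx ky f] is
    tested in the weak divergence, Young's inequality splits off the field, and [sqr_interp_le]
    returns to the discrete energies. *)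
Lemma torus_grid_bounds j1 j2 : cell_integrable L j1 -> cell_integrable L j2 ->
    weak_div L j1 j2 u ->
    (\int[leb2]_(z in D) (j1 z ^+ 2 + j2 z ^+ 2)%:E <= J%:E)%E ->
  grid_bounds e1 e2 (hx / lam) (hy / lam) (lam * V / w) (J / (lam ^+ 2 * w)) v.
Proof.
move=> j1i j2i ju jJ; have mD := measurable_cell L.
have bv e (h : R) S : S <= h * (V / w) -> S <= h / lam * (lam * V / w).
  suff -> : h / lam * (lam * V / w) = h * (V / w) by [].
  by field; rewrite !gt_eqF.
split.
- exact: divr_gt0.
- exact: divr_gt0.
- exact: cell_mean_ge.
- by apply: bv => //; exact: sum_diff_le variation_test.
- by apply: bv => //; exact: sum_diff_le variation_test2.
move=> f t t0.
have [FC1 Fx Fy] := C1_interp f dkx dky (@kf_cont _ _ _ _ _ kxP)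
  (@kf_cont _ _ _ _ _ kyP) (steklov_cont bxP) (steklov_cont byP).
set F := interp kx ky f in FC1 Fx Fy.
pose d1 := fun t => (f (t + e1) - f t) / hx.
pose d2 := fun t => (f (t + e2) - f t) / hy.
have {}Fx : pdx F = interp bx ky d1.
  by rewrite Fx; apply/funext => z; exact: interp_diff1 bxP.
have {}Fy : pdy F = interp kx by_ d2.
  by rewrite Fy; apply/funext => z; exact: interp_diff2 byP.
have := ju F FC1 (biperiodic_interp f kxP kyP).
rewrite integral_interp_mean => juF.
pose s := t * lam ^+ 2.
have s0 : 0 < s by rewrite mulr_gt0// exprn_gt0.
have mx : measurable_fun setT (pdx F) by rewrite Fx; exact: measurable_interp bxP kyP _.
have my : measurable_fun setT (pdy F) by rewrite Fy; exact: measurable_interp kxP byP _.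
have bx_ z : `|pdx F z| <= \sum_i \sum_j `|d1 (i, j)|.
  by rewrite Fx; exact: normr_interp.
have by__ z : `|pdy F z| <= \sum_i \sum_j `|d2 (i, j)|.
  by rewrite Fy; exact: normr_interp.
have mj1 : measurable_fun D j1 by apply/measurable_EFinP; exact: measurable_int j1i.
have mj2 : measurable_fun D j2 by apply/measurable_EFinP; exact: measurable_int j2i.
have ix : cell_integrable L (fun z => j1 z * pdx F z) by exact: integrable_cellM mx bx_.
have iy : cell_integrable L (fun z => j2 z * pdy F z) by exact: integrable_cellM my by__.
have ixy : cell_integrable L (fun z => j1 z * pdx F z + j2 z * pdy F z).
  exact: cell_integrableD.
have ixx : cell_integrable L (fun z => pdx F z ^+ 2).
  apply: (@integrable_cell_bounded _ _ L0 _ ((\sum_i \sum_j `|d1 (i, j)|) ^+ 2)).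
    exact: measurable_funX.
  move=> z; rewrite normrX lerXn2r ?nnegrE//.
  by apply: sumr_ge0 => i _; exact: sumr_ge0.
have iyy : cell_integrable L (fun z => pdy F z ^+ 2).
  apply: (@integrable_cell_bounded _ _ L0 _ ((\sum_i \sum_j `|d2 (i, j)|) ^+ 2)).
    exact: measurable_funX.
  move=> z; rewrite normrX lerXn2r ?nnegrE//.
  by apply: sumr_ge0 => i _; exact: sumr_ge0.
have ijj : cell_integrable L (fun z => j1 z ^+ 2 + j2 z ^+ 2).
  apply/integrableP; split.
    by apply/measurable_EFinP; apply: measurable_funD; exact: measurable_funX.
  apply: le_lt_trans (ltry J); apply: le_trans jJ; rewrite le_eqVlt; apply/orP; left.
  apply/eqP; apply: eq_integral => z _ /=.
  by rewrite ger0_norm// addr_ge0 ?sqr_ge0.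
have young (x y : R) : -1 * (x * y) <= s * y ^+ 2 + s^-1 * x ^+ 2.
  rewrite -(ler_pM2l s0) mulrDr (mulrA s s^-1) divff ?gt_eqF// mul1r.
  have := sqr_ge0 (x + s * y); have := sqr_ge0 (s * y); have := sqr_ge0 x.
  by nra.
have main : w * \sum_t v t * f t <=
    s * (w * \sum_t d1 t ^+ 2) + s * (w * \sum_t d2 t ^+ 2) + s^-1 * J.
  rewrite -lee_fin -[leLHS]oppeK -juF -mulN1e -cell_integralZl//.
  apply: (@le_trans _ _ (\int[leb2]_(z in D) (s * pdx F z ^+ 2 + s * pdy F z ^+ 2 +
      s^-1 * (j1 z ^+ 2 + j2 z ^+ 2))%:E)%E).
    apply: le_integral => //.
    - exact: cell_integrableZ.
    - by apply: cell_integrableD; [apply: cell_integrableD|];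
        exact: cell_integrableZ.
    - move=> z _; rewrite lee_fin.
      by have := young (j1 z) (pdx F z); have := young (j2 z) (pdy F z); lra.
  rewrite cell_integralD; [|apply: cell_integrableD; exact: cell_integrableZ|
    exact: cell_integrableZ].
  rewrite cell_integralD; [|exact: cell_integrableZ..].
  rewrite !cell_integralZl// !EFinD !EFinM; apply: leeD; first apply: leeD.
  - rewrite lee_pmul2l// -EFinM Fx; exact: integral_sqr_interp.
  - rewrite lee_pmul2l// -EFinM Fy; exact: integral_sqr_interp.
  - by rewrite lee_pmul2l ?lte_fin ?invr_gt0.
have en (e : T) (h : R) : energy e (h / lam) f = lam ^+ 2 *
    \sum_t ((f (t + e) - f t) / h) ^+ 2.
  rewrite mulr_sumr; apply: eq_bigr => z _.
  by rewrite -exprMn invf_div; congr (_ ^+ _); ring.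
rewrite !en -(ler_pM2l w0); apply: le_trans main _.
rewrite le_eqVlt; apply/orP; left; apply/eqP; rewrite /s; field.
by rewrite !gt_eqF.
Qed.

End grid_of_torus.

(** * Passage to the limit *)
Section slices.
Context {R : realType} (L : R).
Hypothesis L0 : 0 < L.
Notation mu := (@lebesgue_measure R).
Notation D := (cell L).
Implicit Types g : R * R -> \bar R.

Let restr_int g : leb2.-integrable D g -> leb2.-integrable setT (g \_ D).
Proof.
by have := integrable_restrict leb2 (measurable_cell L) measurableT g;
  rewrite setTI => ->.
Qed.

Let fubini_F_restr g x : fubini_F mu (g \_ D) x =
  ((fun x => \int[mu]_(y in `[0%R, L]) g (x, y))%E \_ `[0%R, L]) x.
Proof.
rewrite /fubini_F patchE; case: ifPn => [xL|xL].
  rewrite [RHS]integral_mkcond; apply: eq_integral => y _.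
  rewrite !patchE /cell; congr (if _ then _ else _).
  by apply/idP/idP; rewrite !inE/=; [case|move=> yL; split=> //; rewrite inE in xL].
apply: integral0_eq => y _; rewrite patchE ifF//.
by apply: contraNF xL; rewrite !inE => -[].
Qed.

Lemma cell_fubiniF g : leb2.-integrable D g ->
  (\int[leb2]_(z in D) g z = \int[mu]_(x in `[0%R, L]) \int[mu]_(y in `[0%R, L]) g (x, y))%E.
Proof.
move=> gi; rewrite integral_mkcond -integral12_prod_meas1//; last exact: restr_int.
by rewrite [RHS]integral_mkcond; apply: eq_integral => x _; exact: fubini_F_restr.
Qed.

Lemma integrable_slice_integral g : leb2.-integrable D g ->
  mu.-integrable `[0%R, L] (fun x => \int[mu]_(y in `[0%R, L]) g (x, y))%E.
Proof.
move=> gi; pose h x := (\int[mu]_(y in `[0%R, L]) g (x, y))%E.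
have := integrable_restrict mu (measurable_itv `[0%R, L]) measurableT h.
rewrite setTI => hE; apply/hE; have -> : h \_ `[0%R, L] = fubini_F mu (g \_ D).
  by apply/funext => x; rewrite fubini_F_restr.
exact: integrable_fubini_F (restr_int gi).
Qed.

Lemma ae_integrable_slice g : leb2.-integrable D g ->
  {ae mu, forall x, `[0%R, L]%classic x ->
    mu.-integrable `[0%R, L] (fun y => g (x, y))}.
Proof.
move=> gi; have := ae_integrable1 (restr_int gi).
apply: filterS => x xi xL.
have := integrable_restrict mu (measurable_itv `[0%R, L]) measurableT
  (fun y => g (x, y)).
rewrite setTI => hE; apply/hE; suff -> : (fun y => g (x, y)) \_ `[0%R, L] = (fun y => (g \_ D) (x, y)) by [].
apply/funext => y; rewrite !patchE /cell; congr (if _ then _ else _).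
by apply/idP/idP; rewrite !inE/=; [move=> yL; split|case].
Qed.

Lemma cell_tonelliF g : measurable_fun D g -> (forall z, D z -> 0 <= g z)%E ->
  (\int[leb2]_(z in D) g z = \int[mu]_(x in `[0%R, L]) \int[mu]_(y in `[0%R, L]) g (x, y))%E.
Proof.
move=> mg g0; rewrite integral_mkcond.
have gDm : measurable_fun setT (g \_ D).
  exact/(measurable_restrictT _ (measurable_cell L)).
rewrite (@fubini_tonelli1 _ _ _ _ _ mu mu)//; last first.
  by move=> z; rewrite patchE; case: ifPn => //; rewrite inE => /g0.
by rewrite [RHS]integral_mkcond; apply: eq_integral => x _; exact: fubini_F_restr.
Qed.

Lemma measurable_slice_integral g : measurable_fun D g ->
    (forall z, D z -> 0 <= g z)%E ->
  measurable_fun `[0%R, L] (fun x => \int[mu]_(y in `[0%R, L]) g (x, y))%E.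
Proof.
move=> mg g0.
have gDm : measurable_fun setT (g \_ D).
  exact/(measurable_restrictT _ (measurable_cell L)).
have gD0 z : (0 <= (g \_ D) z)%E.
  by rewrite patchE; case: ifPn => //; rewrite inE => /g0.
pose h x := (\int[mu]_(y in `[0%R, L]) g (x, y))%E; apply/(measurable_restrictT h (measurable_itv `[0%R, L])).
have -> : h \_ `[0%R, L] = fubini_F mu (g \_ D).
  by apply/funext => x; rewrite fubini_F_restr.
exact: measurable_fun_fubini_tonelli_F.
Qed.

End slices.

Section cell_means_limit.
Context {R : realType} (L : R) (kap : forall p, 'I_p.+1 -> R -> R).
Notation mu := (@lebesgue_measure R).
Notation D := (cell L).
Hypothesis L0 : 0 < L.
Hypothesis kP : forall p, kernel_family L (mesh L p) (@kap p).
Hypothesis kloc : forall p (i : 'I_p.+1) x y, 0 <= x <= L ->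
  4 * mesh L p <= y <= L - 3 * mesh L p ->
  kap i x != 0 -> kap i y != 0 -> `|x - y| < 3 * mesh L p.
Context (u : R * R -> R).
Hypothesis ui : cell_integrable L u.

Definition row_mean m (j : 'I_m.+1) (x : R) : R := kmean L kap j (fun y => u (x, y)).

Let uk_int m (j : 'I_m.+1) : leb2.-integrable D (fun z => (u z * kap j z.2)%:E).
Proof.
apply: (@integrable_cellM _ L u (fun z => kap j z.2) 1) => //.
  apply: measurableT_comp => //; apply: continuous_measurable_fun.
  exact: (@kf_cont _ _ _ _ _ (kP m)).
by move=> z; rewrite ger0_norm ?(kf_ge0 (kP m))// (kf_le1 _ _ (kP m)).
Qed.

Let G m (j : 'I_m.+1) x := (\int[mu]_(y in `[0%R, L]) (u (x, y) * kap j y)%:E)%E.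

Let G_int m (j : 'I_m.+1) : mu.-integrable `[0%R, L] (G j).
Proof. exact: (integrable_slice_integral (uk_int j)). Qed.

Lemma integrable_row_mean m (j : 'I_m.+1) :
  mu.-integrable `[0%R, L] (EFin \o row_mean j).
Proof.
suff : mu.-integrable `[0%R, L]
    (fun x => ((mesh L m)^-1)%:E * (fine (G j x))%:E)%E by [].
apply: integrableZl => //.
have mG := measurable_int mu (G_int j).
apply: (le_integrable _ _ _ (G_int j)) => //.
  apply/measurable_EFinP; exact: measurableT_comp.
move=> x _ /=; case: (G j x) => [r| |] //=; rewrite ?normr0 ?leey//.
Qed.

(** Fubini: a mean in [y] followed by one in [x] is the mean over the product. Slices need only be
    integrable for almost every [x]; elsewhere [fine] may give a meaningless value, on a null
    set. *)
Lemma kmean_row_mean n m (i : 'I_n.+1) (j : 'I_m.+1) :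
  kmean L kap i (row_mean j) = cell_mean L (@kap n) (@kap m) u (i, j).
Proof.
rewrite /kmean /cell_mean (invfM (mesh L n) (mesh L m)) -mulrA; congr (_ * _).
have mD := measurable_cell L.
set hm := (mesh L m)^-1.
have Gfin : {ae mu, forall x, `[0%R, L]%classic x -> G j x \is a fin_num}.
  exact: integrable_ae (G_int j).
have mki : measurable_fun `[0%R, L] (@kap n i).
  apply: measurable_funTS; apply: continuous_measurable_fun.
  exact: (@kf_cont _ _ _ _ _ (kP n)).
have mG := measurable_int mu (G_int j).
have mfG : measurable_fun `[0%R, L] (fine \o G j) by exact: measurableT_comp.
have rint : mu.-integrable `[0%R, L] (fun x => (fine (G j x) * kap i x)%:E).
  apply: (@integrable_continuousM _ 0 L (fine \o G j) (kap i) 1).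
  - apply: (le_integrable _ _ _ (G_int j)) => //.
      exact/measurable_EFinP.
    by move=> x _ /=; case: (G j x) => [r| |] //=; rewrite ?normr0 ?leey.
  - exact: (@kf_cont _ _ _ _ _ (kP n)).
  - by move=> x; rewrite ger0_norm ?(kf_ge0 (kP n))// (kf_le1 _ _ (kP n)).
transitivity (hm * (\int[mu]_(x in `[0%R, L]) (fine (G j x) * kap i x))%R).
  rewrite -RintegralZl//; congr fine; apply: eq_integral => x _.
  by rewrite mulrA.
congr (_ * _); rewrite /moment /Rintegral; congr fine.
have uki : leb2.-integrable D (fun z => (u z * (kap i z.1 * kap j z.2))%:E).
  exact: integrable_kxy (kP n) (kP m) _ _ _ ui.
rewrite cell_fubiniF//; apply: ae_eq_integral => //.
- exact: (measurable_int mu rint).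
- exact: (measurable_int mu (integrable_slice_integral uki)).
have slice := ae_integrable_slice (uk_int j).
near=> x => xL /=.
have Gx : G j x \is a fin_num by move: xL; near: x; exact: Gfin.
have sx : mu.-integrable `[0%R, L] (fun y => (u (x, y) * kap j y)%:E).
  by move: xL; near: x; exact: slice.
under eq_integral => y _ do rewrite mulrCA EFinM.
by rewrite integralZl// -[X in (_ * X)%E](fineK Gx) -EFinM mulrC.
Unshelve. all: by end_near. Qed.

(* The limits in the two mesh sizes are taken one after the other, so that only
   the one-dimensional Lebesgue differentiation theorem is used. *)
Lemma cell_fatou (Psi : R -> R) (C : R) (N : nat) :
    continuous Psi -> (forall t, 0 <= Psi t) ->
    (forall n m, (N <= n)%N -> (N <= m)%N ->
      mesh L n * mesh L m * \sum_t Psi (cell_mean L (@kap n) (@kap m) u t) <= C) ->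
  (\int[leb2]_(z in D) (Psi (u z))%:E <= C%:E)%E.
Proof.
move=> cPsi Psi0 bound.
have mPsi : measurable_fun setT Psi by exact: continuous_measurable_fun.
have mu_ : measurable_fun D u by apply/measurable_EFinP; exact: (measurable_int leb2 ui).
have mg : measurable_fun D (fun z => (Psi (u z))%:E).
  by apply/measurable_EFinP; exact: measurableT_comp.
have g0 z : D z -> (0 <= (Psi (u z))%:E)%E by rewrite lee_fin.
rewrite cell_tonelliF//.
apply: (le_trans (@fatou_ae _ _ _ mu `[0%R, L] (fun m x =>
  (\sum_(j < m.+1) mesh L m * Psi (row_mean j x))%:E)
  (fun x => \int[mu]_(y in `[0%R, L]) (Psi (u (x, y)))%:E)%E _ _ _ _ _ _)) => //.
- move=> m; apply/measurable_EFinP; apply: measurable_sum => j.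
  apply: measurable_funM => //; apply: measurableT_comp => //.
  by apply/measurable_EFinP; exact: (measurable_int mu (integrable_row_mean j)).
- move=> m x _; rewrite lee_fin sumr_ge0// => j _.
  by rewrite mulr_ge0// ltW// mesh_gt0.
- exact: (measurable_slice_integral mg g0).
- by move=> x _; apply: integral_ge0 => y _; rewrite lee_fin.
- have := ae_integrable_slice ui; apply: (@filterS _ _ (ae_filter_ringOfSetsType mu)) => x xi xL.
  have {}xi := xi xL.
  have := @kernel_fatou _ L kap L0 kP kloc unit (fun _ y => u (x, y)) Psi
    (fun _ => xi) cPsi Psi0.
  rewrite (_ : (fun p => _) = (fun m =>
      (\sum_(j < m.+1) mesh L m * Psi (row_mean j x))%:E)); last first.
    by apply/funext => m; rewrite big_const card_unit /= addr0.
  apply: le_trans; rewrite le_eqVlt; apply/orP; left; apply/eqP.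
  apply: eq_integral => y _; congr EFin.
  by rewrite big_const card_unit /= addr0.
apply: (@limn_einf_le _ _ _ N) => m Nm.
have cPsi' : continuous (fun t => mesh L m * Psi t).
  by move=> t; apply: cvgM; [exact: cvg_cst|exact: cPsi].
have Psi0' t : 0 <= mesh L m * Psi t by rewrite mulr_ge0// ltW// mesh_gt0.
have kf := @kernel_fatou _ L kap L0 kP kloc _ (fun j : 'I_m.+1 => row_mean j)
  (fun t => mesh L m * Psi t) (@integrable_row_mean m) cPsi' Psi0'.
apply: (le_trans kf).
apply: (@limn_einf_le _ _ _ N) => n Nn; rewrite lee_fin.
apply: le_trans (bound n m Nn Nm); rewrite le_eqVlt; apply/orP; left; apply/eqP.
rewrite exchange_big pair_big/= mulr_sumr; apply: eq_bigr => -[i j] _ /=.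
by rewrite kmean_row_mean mulrA.
Qed.

End cell_means_limit.

Section profile_regularity.
Context {R : realType}.

Lemma continuous_clamp (a b : R) : a <= b -> continuous (clamp a b).
Proof.
move=> ab; apply: (@lipschitz_continuous _ _ 1) => // x y xy.
by rewrite mul1r distrC ger0_norm; have /andP[] := clamp_lip ab xy.
Qed.

Lemma continuous_lo_frac (a : R) : 0 < a -> continuous (lo_frac a).
Proof.
move=> a0 x; apply: cvgM; last exact: cvg_cst.
by apply: cvgD; apply: continuous_clamp; lra.
Qed.

Lemma continuous_hi_frac k : continuous (@hi_frac R k).
Proof.
move=> x; apply: cvgM; last exact: cvg_cst.
apply: cvgB; last exact: cvg_cst.
by apply: continuous_clamp; rewrite ler_weXn2l ?ler1n// leq_add2l.
Qed.

Definition profile K (t : R) := lo_profile K t + hi_profile K t.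

Lemma continuous_profile K : continuous (profile K).
Proof.
move=> x; apply: cvgD; apply: continuous_sumr => i t.
- apply: cvgM; first exact: cvg_cst.
  apply: cvgM; first exact: norm_continuous.
  apply: cvg_norm; apply: continuous_lo_frac.
  by rewrite mulr_gt0 ?exprn_gt0 ?invr_gt0 ?exprn_gt0.
- by apply: cvgM; [exact: cvg_cst|exact: continuous_hi_frac].
Qed.

Lemma lo_term_ge0 K i (t : R) :
  0 <= (2 ^- K * 2 ^+ i) * (`|t| * `|lo_frac ((2 ^- K) ^+ 3 * 8 ^+ i) t|).
Proof. by rewrite mulr_ge0// mulr_ge0// ?invr_ge0 exprn_ge0. Qed.

Lemma hi_term_ge0 k (t : R) : 0 <= hi_weight cubert k * hi_frac k t.
Proof.
have /andP[t0 _] := hi_frac01 k t; apply: mulr_ge0 => //.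
by rewrite mulr_ge0 ?exprn_ge0// powR_ge0.
Qed.

Lemma profile_ge0 K t : 0 <= profile K t.
Proof.
by apply: addr_ge0; apply: sumr_ge0 => i _; [exact: lo_term_ge0|exact: hi_term_ge0].
Qed.

End profile_regularity.

Lemma cell_integrable_excess (R : realType) (L : R) (u : R * R -> R) (c : R) : cell_integrable L u -> 0 <= c ->
  cell_integrable L (fun z => Num.max 0 (u z - c)).
Proof.
move=> ui c0; have mD := measurable_cell L.
have mu_ : measurable_fun (cell L) u by apply/measurable_EFinP; exact: (measurable_int leb2 ui).
apply: le_integrable ui => //.
  apply/measurable_EFinP; apply: measurable_maxr => //.
  exact: measurable_funB.
move=> z _ /=; rewrite lee_fin ger0_norm ?le_max ?lexx// ge_max normr_ge0/=.
by have := ler_norm (u z); lra.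
Qed.

Section mean_excess.
Context {R : realType} (L : R) (p q : nat).
Hypothesis L0 : 0 < L.
Context (kx : 'I_p.+1 -> R -> R) (ky : 'I_q.+1 -> R -> R).
Hypotheses (kxP : kernel_family L (mesh L p) kx) (kyP : kernel_family L (mesh L q) ky).

(** Jensen by duality: with [f] the indicator of the nodes whose mean exceeds [c], the sum equals
    the integral of [u - c] against the interpolation of [f], which takes values in [0, 1]. *)
Lemma mean_excess (u : R * R -> R) (c : R) : cell_integrable L u -> 0 <= c ->
  ((mesh L p * mesh L q * \sum_t Num.max 0 (cell_mean L kx ky u t - c))%:E <=
   \int[leb2]_(z in cell L) (Num.max 0 (u z - c))%:E)%E.
Proof.
move=> ui c0; pose f (t : 'I_p.+1 * 'I_q.+1) : R := (c < cell_mean L kx ky u t)%R%:R.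
have mD := measurable_cell L.
have i1 : cell_integrable L (cst (1 : R)).
  by apply: (@integrable_cell_bounded _ _ L0 _ 1) => // z; rewrite normr1.
have f01 t : 0 <= f t <= 1 by rewrite /f; case: (_ < _); rewrite /= ?lexx ler01.
have I1 z : `|interp kx ky f z| <= 1.
  apply: (normr_interp_le1 _ kxP kyP) => t.
  by have /andP[f0 f1] := f01 t; rewrite ger0_norm.
have I0 z : 0 <= interp kx ky f z.
  apply: sumr_ge0 => i _; apply: sumr_ge0 => j _.
  have /andP[f0 _] := f01 (i, j).
  by rewrite mulr_ge0// mulr_ge0 ?(kf_ge0 kxP) ?(kf_ge0 kyP).
have mI := measurable_interp kxP kyP f.
have uI : cell_integrable L (fun z => u z * interp kx ky f z) by exact: integrable_cellM mI I1.
have cI : cell_integrable L (fun z => cst 1 z * interp kx ky f z) by exact: integrable_cellM mI I1.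
have Ui := cell_integrable_excess ui c0.
have Eu := integral_interp_mean L0 kxP kyP ui f.
have E1 := integral_interp_mean L0 kxP kyP i1 f.
have cc t : cell_mean L kx ky (cst 1) t = 1.
  by rewrite /cell_mean (moment1 L0 kxP kyP) mulVf// gt_eqF// mulr_gt0// mesh_gt0.
rewrite (_ : \sum_t _ = \sum_t cell_mean L kx ky u t * f t - c * \sum_t f t); last first.
  rewrite mulr_sumr -sumrB; apply: eq_bigr => t _; rewrite /f -mulrBl.
  case: ltP => h; rewrite /= ?mulr1 ?mulr0.
    by apply/max_idPr; lra.
  by apply/max_idPl; lra.
rewrite mulrBr EFinB leeBlDr// -Eu.
have -> : (mesh L p * mesh L q * (c * \sum_t f t))%:E =
    (\int[leb2]_(z in cell L) (c * (cst 1 z * interp kx ky f z))%:E)%E.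
  rewrite cell_integralZl// E1 -EFinM mulrCA; congr (_ * (_ * _))%:E.
  by apply: eq_bigr => t _; rewrite cc mul1r.
rewrite -cell_integralD//; last exact: cell_integrableZ.
apply: le_integral => //.
  by apply: cell_integrableD => //; exact: cell_integrableZ.
move=> z _; rewrite lee_fin /= mul1r.
have h : u z - c <= Num.max 0 (u z - c) by rewrite le_max lexx orbT.
have h0 : 0 <= Num.max 0 (u z - c) by rewrite le_max lexx.
by move: h h0 (I0 z) (ler_norm (interp kx ky f z)) (I1 z);
  move: (Num.max _ _) (interp _ _ _ _) => a b; nra.
Qed.

End mean_excess.

Lemma profile_integral_bound (R : realType) (L : R) (u j1 j2 : R * R -> R) (V J lam : R) K :
    0 < L -> cell_integrable L u -> {ae leb2, forall z, cell L z -> -1 <= u z} ->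
    (torus_variation L u <= V%:E)%E -> 0 < lam ->
    cell_integrable L j1 -> cell_integrable L j2 -> weak_div L j1 j2 u ->
    (\int[leb2]_(z in cell L) (j1 z ^+ 2 + j2 z ^+ 2)%:E <= J%:E)%E ->
  (\int[leb2]_(z in cell L) (profile K (u z))%:E <=
   (8 ^+ 13)%:E * ((lam * V + J / lam ^+ 2)%:E +
     \int[leb2]_(z in cell L) (Num.max 0 (u z - 8 ^+ (K + 5)))%:E))%E.
Proof.
move=> L0 ui uge uV lam0 i1 i2 jdiv jJ.
have ex p : exists F : ('I_p.+1 -> R -> R) * ('I_p.+1 -> R -> R) * ('I_p.+1 -> R -> R),
  [/\ [/\ kernel_family L (mesh L p) F.1.1, kernel_family L (mesh L p) F.1.2
        & kernel_family L (mesh L p) F.2],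
      forall i (x : R), is_derive x (1 : R) (F.1.2 i)
        ((F.1.1 i (x + mesh L p) - F.1.1 i x) / mesh L p),
      forall i (x : R), is_derive x (1 : R) (F.2 i)
        ((F.1.2 i (x + mesh L p) - F.1.2 i x) / mesh L p)
    & forall i x y, 0 <= x <= L -> 4 * mesh L p <= y <= L - 3 * mesh L p ->
        F.1.2 i x != 0 -> F.1.2 i y != 0 -> `|x - y| < 3 * mesh L p].
  by have [b [k [g P]]] := bump_kernels_exist p L0; exists (b, k, g).
pose F p := projT1 (cid (ex p)).
have FP p := projT2 (cid (ex p)); rewrite -/(F _) in FP.
have kP p : kernel_family L (mesh L p) (F p).1.2 by case: (FP p) => [[]].
have Ei := cell_integrable_excess ui (exprn_ge0 (K + 5) (ler0n R 8)).
have Efin : (\int[leb2]_(z in cell L) (Num.max 0 (u z - 8 ^+ (K + 5)))%:E)%E \is a fin_num.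
  by apply: integrable_fin_num; [exact: measurable_cell|exact: Ei].
rewrite -(fineK Efin) -EFinD -EFinM.
set E := fine _.
have m0 : 0 < 2 ^+ (K + 5) * cubert K :> R.
  by rewrite mulr_gt0 ?exprn_gt0// (lt_le_trans ltr01)// cubert_ge1.
(* With [K] and [lam] fixed, the mesh conditions of [grid_estimate] hold for all fine grids. *)
have [N _ NP] : \forall n \near \oo, mesh L n <= lam / (2 ^+ (K + 5) * cubert K).
  have /cvgrPdist_le /(_ (lam / (2 ^+ (K + 5) * cubert K))) := mesh_cvg0 L.
  move=> /(_ (divr_gt0 lam0 m0)); apply: filterS => n.
  by rewrite sub0r normrN gtr0_norm// mesh_gt0.
have fine_mesh n : (N <= n)%N -> mesh L n / lam * (2 ^+ (K + 5) * cubert K) <= 1.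
  move=> Nn; have := NP n Nn; rewrite ler_pdivlMr// => h.
  by rewrite mulrAC ler_pdivrMr// mul1r.
apply: (@cell_fatou _ L (fun p => (F p).1.2) L0 kP _ u ui _ _ N).
- by move=> p; case: (FP p).
- exact: continuous_profile.
- exact: profile_ge0.
move=> n m Nn Nm.
have [[bn kn gn] dkn dgn _] := FP n; have [[bm km gm] dkm dgm _] := FP m.
have gb := torus_grid_bounds L0 bn kn gn bm km gm dkn dgn dkm dgm ui uge uV lam0 i1 i2 jdiv jJ.
have := grid_estimate K gb (fine_mesh n Nn) (fine_mesh m Nm).
have := mean_excess L0 kn km ui (exprn_ge0 (K + 5) (ler0n R 8)).
rewrite -(fineK Efin) lee_fin -/E.
set w := mesh L n * mesh L m => Ex Est.
have w0 : 0 < w by rewrite mulr_gt0// mesh_gt0.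
apply: le_trans (ler_wpM2l (ltW w0) Est) _.
rewrite mulrCA ler_pM2l ?exprn_gt0// !mulrDr.
apply: lerD => //; rewrite le_eqVlt; apply/orP; left; apply/eqP.
by field; rewrite !gt_eqF.
Qed.

(** * Comparison with the profile and optimization of the scale *)
Section pointwise.
Context {R : realType}.

Lemma lt_exp8 (s : R) : exists n, s < 8 ^+ n.
Proof.
exists (Num.truncn s).+1; apply: lt_le_trans (truncnS_gt s) _.
by rewrite -natrX ler_nat ltnW// ltn_expl.
Qed.

Lemma exp8_itv (s : R) : 1 <= s -> exists n, 8 ^+ n <= s < 8 ^+ n.+1.
Proof.
move=> s1; have [m sm mmin] := ex_minnP (lt_exp8 s).
case: m => [|m] in sm mmin *; first by move: sm; rewrite expr0; lra.
exists m; rewrite sm andbT leNgt; apply/negP => /mmin; lia.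
Qed.

Definition power_log (t : R) : R := `|t * ln (Num.max t (expR 1)) `^ (1 / 4)| `^ (4 / 3).

Lemma cube_root (x : R) : 0 <= x -> (x `^ 3^-1) ^+ 3 = x.
Proof. by move=> x0; rewrite -powR_mulrn ?powR_ge0// -powRrM mulVf// powRr1. Qed.

Lemma ler_cube (x y : R) : 0 <= x -> 0 <= y -> x ^+ 3 <= y ^+ 3 -> x <= y.
Proof. by move=> x0 y0; rewrite ler_pXn2r. Qed.

Lemma ln_max_ge1 (t : R) : 1 <= ln (Num.max t (expR 1)).
Proof.
have e0 : 0 < expR 1 :> R by exact: expR_gt0.
rewrite -[leLHS](expRK 1) ler_ln ?posrE ?lt_max ?e0 ?orbT//.
by rewrite le_max lexx orbT.
Qed.

Lemma power_logE (t : R) :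
  power_log t = (`|t| `^ 3^-1) ^+ 4 * ln (Num.max t (expR 1)) `^ 3^-1.
Proof.
have l0 : 0 <= ln (Num.max t (expR 1)) by have := ln_max_ge1 t; lra.
rewrite /power_log normrM (ger0_norm (powR_ge0 _ _)) powRM ?powR_ge0//.
rewrite -powRrM (_ : 1 / 4 * (4 / 3) = 3^-1 :> R); last by field.
by rewrite -powR_mulrn ?powR_ge0// -powRrM mulrC (_ : 3^-1 * 4 = 4 / 3)// mulrC.
Qed.

Lemma power_log_ge0 t : 0 <= power_log t. Proof. exact: powR_ge0. Qed.

Lemma measurable_power_log : measurable_fun setT power_log.
Proof.
apply: (measurableT_comp (measurable_powR _)); apply: measurableT_comp => //.
apply: measurable_funM => //; apply: (measurableT_comp (measurable_powR _)).
by apply: (measurableT_comp (@measurable_ln R)); exact: measurable_maxr.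
Qed.

Lemma power_log_bound (c l t : R) : 0 <= c -> 0 <= l -> `|t| <= c ^+ 3 ->
  ln (Num.max t (expR 1)) <= l ^+ 3 -> power_log t <= c ^+ 4 * l.
Proof.
move=> c0 l0 tc tl; rewrite power_logE; apply: ler_pM.
- by rewrite exprn_ge0// powR_ge0.
- exact: powR_ge0.
- rewrite lerXn2r ?nnegrE ?powR_ge0//.
  by apply: ler_cube => //; rewrite ?powR_ge0// cube_root.
- apply: ler_cube => //; rewrite ?powR_ge0// cube_root//.
  by have := ln_max_ge1 t; lra.
Qed.

Lemma expR1_le8 : expR 1 <= 8 :> R.
Proof.
have h : expR (- 2^-1) >= 1 + - 2^-1 :> R by exact: expR_ge1Dx.
have p0 : 0 < expR (2^-1) :> R by exact: expR_gt0.
have xV : expR (2^-1) * (expR (2^-1))^-1 = 1 :> R by rewrite divff// gt_eqF.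
have -> : 1 = 2^-1 + 2^-1 :> R by field.
rewrite expRN in h; rewrite expRD; move: p0 h xV; move: (expR _) => x; move: (x^-1) => y *.
have : x <= 2 by nra.
by nra.
Qed.

Lemma ln_max_le (t : R) n : t <= 8 ^+ n.+1 -> ln (Num.max t (expR 1)) <= 7 * n.+1%:R.
Proof.
move=> tn; have e0 : 0 < expR 1 :> R by exact: expR_gt0.
have p8 : 0 < 8 ^+ n.+1 :> R by rewrite exprn_gt0.
apply: (@le_trans _ _ (ln (8 ^+ n.+1))).
  rewrite ler_ln ?posrE ?lt_max ?e0 ?orbT// ge_max tn/=.
  apply: le_trans expR1_le8 _; rewrite -[leLHS]expr1.
  by rewrite ler_weXn2l// ler1n.
rewrite lnXn// -(mulr_natr (ln 8)) ler_wpM2r//.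
have := @le_ln1Dx R 7; rewrite (_ : 1 + 7 = 8); last by ring.
by apply; lra.
Qed.

Lemma lo_frac_far (a t : R) : 0 < a -> 8 * a <= `|t| -> `|lo_frac a t| = 7.
Proof.
move=> a0 at_; rewrite /lo_frac normrM normfV (gtr0_norm a0).
suff -> : `|lo_trunc a t| = 7 * a by rewrite mulfK// gt_eqF.
have := lo_truncE t a0; move: at_.
have [t0|t0] := leP 0 t; [rewrite (ger0_norm t0)|rewrite (ltr0_norm t0)].
  move=> at_ [[]|] [h ->]; rewrite ?normrN ?(gtr0_norm (_ : 0 < 7 * a))//; try lra.
  by rewrite ger0_norm; lra.
move=> at_ [[]|] [h ->]; rewrite ?normrN ?(gtr0_norm (_ : 0 < 7 * a))//; try lra.
by rewrite ler0_norm; lra.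
Qed.

(** A single level suffices. Below 8^7 the logarithm is bounded and the low level with 8a <= |t| <
    64a is saturated, provided [K] is large enough for it to exist. Above, the lower bound on [t]
    excludes negative values, and the highest saturated high level carries the cube root of the
    logarithm in its weight. *)
Lemma power_log_le_profile : exists2 C : R, 0 < C & forall t, -1 <= t ->
  exists N, forall K, (N <= K)%N -> power_log t <= C * profile K t.
Proof.
exists (8 ^+ 4) => [|t t1]; first by rewrite exprn_gt0.
have [->|tn0] := eqVneq t 0.
  exists 0 => K _; rewrite power_logE normr0 powR0 ?invr_eq0// expr0n/= mul0r.
  by rewrite mulr_ge0 ?exprn_ge0// profile_ge0.
have at0 : 0 < `|t| by rewrite normr_gt0.
have sum_ge n (F : nat -> R) i : (forall j, 0 <= F j) -> (i < n)%N -> F i <= \sum_(j < n) F j.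
  move=> F0 i_n; rewrite (bigD1 (Ordinal i_n))//= lerDl.
  by apply: sumr_ge0 => j _.
have [tlo|thi] := ltP `|t| (8 ^+ 7).
  have [N tN] := lt_exp8 (8 / `|t|); exists N => K NK.
  have sK : 8 <= `|t| * 8 ^+ K.
    have : 8 ^+ N <= 8 ^+ K :> R by rewrite ler_weXn2l// ler1n.
    by move: tN; rewrite ltr_pdivrMr// => h1 h2; nra.
  have [[|i] /andP[il ir]] : exists n, 8 ^+ n <= `|t| * 8 ^+ K < 8 ^+ n.+1.
    by apply: exp8_itv; lra.
    by move: ir; rewrite expr1; lra.
  have iK : (i < K + 6)%N.
    have : 8 ^+ i.+1 < 8 ^+ (7 + K) :> R.
      by apply: le_lt_trans il _; rewrite exprD ltr_pM2r// exprn_gt0.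
    by rewrite ltr_eXn2l ?ltr1n//; lia.
  have p2 : 0 < 2 ^- K :> R by rewrite invr_gt0 exprn_gt0.
  set b := 2 ^- K * 2 ^+ i : R.
  have b0 : 0 < b by rewrite mulr_gt0 ?exprn_gt0.
  have b3 : b ^+ 3 * 8 ^+ K = 8 ^+ i.
    rewrite /b exprMn -!exprVn -!exprM (mulnC K) (mulnC i) !exprM.
    have -> : 2^-1 ^+ 3 = 8^-1 :> R by field.
    have -> : 2 ^+ 3 = 8 :> R by ring.
    by rewrite mulrAC -exprMn mulVf// expr1n mul1r.
  have a3 : (2 ^- K) ^+ 3 * 8 ^+ i = b ^+ 3.
    by rewrite /b exprMn; congr (_ * _); rewrite -exprM mulnC exprM; congr (_ ^+ _); ring.
  have k8 : 0 < 8 ^+ K :> R by rewrite exprn_gt0.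
  have tl : 8 * b ^+ 3 <= `|t|.
    by rewrite -(ler_pM2r k8) -mulrA b3 -exprS.
  have tr : `|t| <= (4 * b) ^+ 3.
    rewrite -(ler_pM2r k8) exprMn -mulrA b3 (_ : 4 ^+ 3 = 8 * 8 :> R); last by ring.
    by rewrite -mulrA -!exprS ltW.
  have lo : b * (`|t| * 7) <= profile K t.
    rewrite -(lo_frac_far (exprn_gt0 3 b0) tl) -a3.
    apply: (@le_trans _ _ (lo_profile K t)).
      exact: (sum_ge _ (fun i => (2 ^- K * 2 ^+ i) *
        (`|t| * `|lo_frac ((2 ^- K) ^+ 3 * 8 ^+ i) t|)) i (fun j => lo_term_ge0 K j t)).
    by rewrite lerDl; apply: sumr_ge0 => j _; exact: hi_term_ge0.
  (* The crude bound ln 8 <= 7 gives 49, which is below 64, a cube. *)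
  have ll : ln (Num.max t (expR 1)) <= 4 ^+ 3.
    apply: (@le_trans _ _ (7 * 7%:R)); last by lra.
    apply: ln_max_le; apply: le_trans (ler_norm t) _; exact: ltW.
  have := power_log_bound (_ : 0 <= 4 * b) (ler0n R 4) tr ll.
  move=> /(_ (mulr_ge0 (ler0n R 4) (ltW b0))) => h; apply: le_trans h _.
  have : b * b ^+ 3 <= profile K t by nra.
  rewrite -exprS [(4 * b) ^+ 4]exprMn; have := profile_ge0 K t.
  rewrite (_ : 8 ^+ 4 = 16 * 4 ^+ 4 :> R); last by ring.
  have : 0 <= 4 ^+ 4 :> R by rewrite exprn_ge0.
  by move: (profile K t) (b ^+ 4) (4 ^+ 4) => x y z *; nra.
have tE : `|t| = t.
  by rewrite ger0_norm//; move: thi; rewrite ler_normr => /orP[]; lra.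
rewrite tE in thi at0.
have [n /andP[nl nr]] : exists n, 8 ^+ n <= t < 8 ^+ n.+1.
  by apply: exp8_itv; lra.
have n7 : (7 <= n)%N.
  by have := le_lt_trans thi nr; rewrite ltr_eXn2l ?ltr1n.
pose k := (n - 6)%N; have nk : n = (k + 6)%N by rewrite /k; lia.
rewrite nk in nl nr; exists k.+1 => K kK.
have hk : hi_frac k t = 1.
  rewrite /hi_frac /hi_trunc /clamp max_r ?min_l//; last first.
    by apply: le_trans nl; rewrite ler_weXn2l ?ler1n// leq_add2l.
  rewrite hi8S.
  have : 0 < 8 ^+ (k + 5) :> R by rewrite exprn_gt0.
  by move: (8 ^+ _) => x x0; field; rewrite gt_eqF.
have hi : 16 ^+ (k + 5) * cubert k <= profile K t.
  apply: (@le_trans _ _ (hi_profile K t)).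
    have := sum_ge _ (fun k => hi_weight cubert k * hi_frac k t) k (fun j => hi_term_ge0 j t) kK.
    by rewrite hk mulr1.
  by rewrite lerDr; apply: sumr_ge0 => j _; exact: lo_term_ge0.
(* Here 7 (k + 7) <= 27 (k + 5). *)
have ll : ln (Num.max t (expR 1)) <= (3 * cubert k) ^+ 3.
  rewrite exprMn cubertE; apply: le_trans (ln_max_le (ltW nr)) _.
  rewrite !natrD -[(k + 6).+1%:R]natr1 natrD.
  by have := ler0n R k; lra.
have cr : `|t| <= (2 ^+ (k + 7)) ^+ 3.
  rewrite tE -exprM mulnC exprM (_ : 2 ^+ 3 = 8 :> R); last by ring.
  by rewrite addnS ltW.
have c0 : 0 <= cubert k :> R by exact: powR_ge0.
have := power_log_bound (exprn_ge0 (k + 7) (ler0n R 2)) (mulr_ge0 (ler0n R 3) c0) cr ll.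
have -> : (2 ^+ (k + 7)) ^+ 4 = 16 ^+ 2 * 16 ^+ (k + 5) :> R.
  rewrite -exprM mulnC exprM -exprD (_ : 2 ^+ 4 = 16 :> R); last by ring.
  by congr (_ ^+ _); lia.
move: hi (profile_ge0 K t) c0; move: (profile K t) (16 ^+ (k + 5)) (cubert k) => a b c.
by rewrite -mulrA (mulrCA b) => *; lra.
Qed.

End pointwise.

Lemma excess_cvg0 (R : realType) (L : R) (u : R * R -> R) : cell_integrable L u ->
  (fun K => \int[leb2]_(z in cell L) (Num.max 0 (u z - 8 ^+ (K + 5)))%:E)%E @ \oo --> 0%E.
Proof.
move=> ui; have mD := measurable_cell L.
have ei K := cell_integrable_excess ui (exprn_ge0 (K + 5) (ler0n R 8)).
rewrite -(@integral0 _ _ _ (@leb2 R) (cell L)).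
apply: (@dominated_cvg _ _ _ (@leb2 R) (cell L) mD
  (fun K z => (Num.max 0 (u z - 8 ^+ (K + 5)))%:E) (cst 0%E) (fun z => (`|u z|)%:E)).
- by move=> K; exact: (measurable_int leb2 (ei K)).
- move=> z _; apply: cvg_near_cst; have [N uN] := lt_exp8 (u z).
  exists N => // K /= NK; congr EFin; apply/max_idPl; rewrite subr_le0.
  apply: le_trans (ltW uN) _; rewrite ler_weXn2l ?ler1n//; lia.
- by [].
- by have := integrable_abse ui; apply.
- move=> K z _ /=; rewrite lee_fin ger0_norm ?le_max ?lexx// ge_max normr_ge0/=.
  by have := exprn_ge0 (K + 5) (ler0n R 8); have := ler_norm (u z); lra.
Qed.

Lemma power_log_integral_le (R : realType) : exists2 C : R, 0 < C &
  forall (L : R) (u j1 j2 : R * R -> R) (V J lam : R),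
    0 < L -> cell_integrable L u -> {ae leb2, forall z, cell L z -> -1 <= u z} ->
    (torus_variation L u <= V%:E)%E -> 0 < lam ->
    cell_integrable L j1 -> cell_integrable L j2 -> weak_div L j1 j2 u ->
    (\int[leb2]_(z in cell L) (j1 z ^+ 2 + j2 z ^+ 2)%:E <= J%:E)%E ->
  (\int[leb2]_(z in cell L) (power_log (u z))%:E <= (C * (lam * V + J / lam ^+ 2))%:E)%E.
Proof.
have [C0 C00 pw] := @power_log_le_profile R.
have C13 : 0 < C0 * 8 ^+ 13 by rewrite mulr_gt0 ?exprn_gt0.
exists (C0 * 8 ^+ 13) => // L u j1 j2 V J lam L0 ui uge uV lam0 i1 i2 jd jJ.
have mD := measurable_cell L.
have mu_ : measurable_fun (cell L) u by apply/measurable_EFinP; exact: (measurable_int leb2 ui).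
have mprof K : measurable_fun (cell L) (fun z => (profile K (u z))%:E).
  apply/measurable_EFinP; apply: measurableT_comp => //.
  by apply: continuous_measurable_fun; exact: continuous_profile.
apply: (le_trans (@fatou_ae _ _ _ (@leb2 R) (cell L)
  (fun K z => (C0%:E * (profile K (u z))%:E)%E) (fun z => (power_log (u z))%:E) _ _ _ _ _ _)) => //.
- by move=> K; apply: measurable_funeM; exact: mprof.
- by move=> K z _; rewrite -EFinM lee_fin mulr_ge0 ?profile_ge0// ltW.
- by apply/measurable_EFinP; apply: measurableT_comp => //; exact: measurable_power_log.
- by move=> z _; rewrite lee_fin power_log_ge0.
- apply: (@filterS _ _ (ae_leb2_filter R)) uge => z uz Dz.
  have [N PN] := pw _ (uz Dz).
  rewrite limn_einf_lim; apply: lime_ge; first exact: is_cvg_einfs.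
  exists N => // n /= Nn; apply: le_ereal_inf_tmp => _ [m /= nm <-].
  by rewrite -EFinM lee_fin PN// (leq_trans Nn).
apply/lee_addgt0Pr => eps eps0.
have /fine_cvgP[_ /cvgrPdist_le/(_ (eps / (C0 * 8 ^+ 13)) (divr_gt0 eps0 C13))] := excess_cvg0 ui.
move=> [N _ NP]; apply: (@limn_einf_le _ _ _ N) => K NK.
have IZ : (\int[leb2]_(z in cell L) (C0%:E * (profile K (u z))%:E) =
    C0%:E * \int[leb2]_(z in cell L) (profile K (u z))%:E)%E.
  apply: ge0_integralZl; rewrite ?lee_fin ?(ltW C00)//; first exact: mprof.
  by move=> z _; rewrite lee_fin profile_ge0.
rewrite IZ.
have C0E : (0 < C0%:E)%E by rewrite lte_fin.
have := profile_integral_bound K L0 ui uge uV lam0 i1 i2 jd jJ.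
have Efin : (\int[leb2]_(z in cell L) (Num.max 0 (u z - 8 ^+ (K + 5)))%:E)%E \is a fin_num.
  apply: integrable_fin_num => //.
  exact: (cell_integrable_excess ui (exprn_ge0 (K + 5) (ler0n R 8))).
have := NP K NK; rewrite /= sub0r normrN => Ele.
rewrite -(fineK Efin) -EFinD -EFinM -(lee_pmul2l (x := C0%:E)) ?lte_fin// => bnd.
apply: (le_trans bnd); rewrite -EFinM -EFinD lee_fin mulrA mulrDr lerD2l.
rewrite mulrC -ler_pdivlMr//; apply: le_trans Ele; exact: ler_norm.
Qed.

(** The choice lam^3 = h / V makes the two terms equal, and each is then the cube root of V^2 h. *)
Lemma optimal_scale (R : realType) (C V h x : R) : 0 < C -> 0 <= V -> 0 <= h -> 0 <= x ->
    (forall lam h', 0 < lam -> h < h' -> x <= C * (lam * V + h' / lam ^+ 2)) ->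
  x ^+ 3 <= (2 * C) ^+ 3 * (V ^+ 2 * h).
Proof.
move=> C0 V0 h0 x0 xle.
have C8 : 0 < (2 * C) ^+ 3 by rewrite exprn_gt0// mulr_gt0.
(* Either quantity may vanish, so both are first enlarged by [e]; this also provides a value
   strictly above [h]. *)
have pos e : 0 < e -> x ^+ 3 <= (2 * C) ^+ 3 * ((V + e) ^+ 2 * (h + e)).
  move=> e0; pose r := (h + e) / (V + e); have Ve : 0 < V + e by lra.
  have he : 0 < h + e by lra.
  have r0 : 0 < r by exact: divr_gt0.
  pose lam := r `^ 3^-1; have lam0 : 0 < lam by exact: powR_gt0.
  have lam3 : lam ^+ 3 = r by apply: cube_root; exact: ltW.
  have hr : h + e = lam ^+ 3 * (V + e) by rewrite lam3 divfK ?gt_eqF.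
  have xl : x <= 2 * C * (lam * (V + e)).
    have := xle lam (h + e) lam0; rewrite ltrDl => /(_ e0).
    have -> : (h + e) / lam ^+ 2 = lam * (V + e).
      by rewrite hr; field; rewrite gt_eqF.
    have h1 : C * (lam * V) <= C * (lam * (V + e)).
      by rewrite ler_pM2l// ler_pM2l//; lra.
    by rewrite mulrDr; move: h1; lra.
  have : x ^+ 3 <= (2 * C * (lam * (V + e))) ^+ 3.
    by rewrite lerXn2r ?nnegrE// (le_trans x0).
  move=> /le_trans; apply; rewrite hr exprMn ler_pM2l// exprMn.
  by rewrite le_eqVlt; apply/orP; left; apply/eqP; ring.
rewrite mulrC -ler_pdivrMr//; apply/ler_addgt0Pr => d d0.
(* For e <= 1, the product (V + e)^2 (h + e) exceeds V^2 h by at most e M. *)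
pose M := h * (2 * V + 1) + (V + 1) ^+ 2.
have M0 : 0 < M by rewrite /M; nra.
pose e := Num.min 1 (d / M).
have e0 : 0 < e by rewrite lt_min ltr01 divr_gt0.
have e1 : e <= 1 by rewrite ge_min lexx.
have eM : e * M <= d by rewrite -ler_pdivlMr// ge_min lexx orbT.
have := pos e e0; rewrite mulrC -ler_pdivrMr// => /le_trans; apply.
have ee : e * e <= e by nra.
have : h * (e * e) <= h * e by rewrite ler_wpM2l.
have : e * (V + e) ^+ 2 <= e * (V + 1) ^+ 2.
  by rewrite ler_wpM2l ?(ltW e0)// lerXn2r ?nnegrE; lra.
by move: eM; rewrite /M; lra.
Qed.

(** * The norms and the final inequality *)

Section norms.
Context {R : realType} (L : R) (u : R * R -> R).

Lemma torus_variation_ge0 : (0 <= torus_variation L u)%E.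
Proof.
apply: ereal_sup_ubound => /=; exists (cst 0), (cst 0).
have c0 : C1 (cst 0 : R * R -> R) /\ biperiodic L (cst 0 : R * R -> R).
  split; last by [].
  have px : pdx (cst 0 : R * R -> R) = cst 0 by apply/funext => z; rewrite /pdx derive_cst.
  have py : pdy (cst 0 : R * R -> R) = cst 0 by apply/funext => z; rewrite /pdy derive_cst.
  by split => //; rewrite ?px ?py => z; exact: cvg_cst.
split => // [z|]; first by rewrite /= expr0n addr0 ler01.
rewrite integral0_eq// => z _.
by rewrite /pdx /pdy !derive_cst addr0 mulr0.
Qed.

Lemma cell_Lnorm_power_log :
  (cell_Lnorm L (4 / 3) (fun z => (u z * ln (Num.max (u z) (expR 1)) `^ (1 / 4))%R) =
   (\int[leb2]_(z in cell L) (power_log (u z))%:E) `^ (3 / 4))%E.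
Proof.
set N := cell_Lnorm _ _ _.
have p0 : (4 / 3 != 0 :> R) by rewrite gt_eqF.
have -> : N = ((N `^ (4 / 3)) `^ (3 / 4))%E.
  rewrite -poweRrM (_ : 4 / 3 * (3 / 4) = 1 :> R); last by field.
  by rewrite poweRe1// Lnorm_ge0.
congr poweR; rewrite /N /cell_Lnorm poweR_Lnorm// [RHS]integral_mkcond.
apply: eq_integral => z _ /=; rewrite !patchE; case: ifPn => // _.
by rewrite (_ : (point : R) = 0)// normr0 powR0.
Qed.

End norms.

Theorem proposition1p2 (R : realType) :
  exists C : R, 0 < C /\
    forall (L : R) (u : R * R -> R),
      0 < L ->
      biperiodic L u ->
      cell_integrable L u ->
      {ae leb2, forall z, cell L z -> -1 <= u z} ->
      (\int[leb2]_(z in cell L) (u z)%:E = 0)%E ->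
      (torus_variation L u < +oo)%E ->
      (Hm1_norm L u < +oo)%E ->
      (cell_Lnorm L (4 / 3)
         (fun z => (u z * ln (Num.max (u z) (expR 1)) `^ (1 / 4))%R)
       <= C%:E * torus_variation L u `^ (1 / 2) * Hm1_norm L u `^ (1 / 2))%E.

Proof.
have [C C0 main] := @power_log_integral_le R.
have C8 : 0 < (2 * C) ^+ 3 by rewrite exprn_gt0// mulr_gt0.
exists (((2 * C) ^+ 3) `^ 4^-1); split; first exact: powR_gt0.
move=> L u L0 _ ui uge _ Vfin Hfin.
rewrite cell_Lnorm_power_log; set X := (\int[leb2]_(z in _) _)%E.
have V0 := torus_variation_ge0 L u.
move: Hfin; rewrite /Hm1_norm; set S := [set v | _]; set H2 := ereal_inf S => Hfin.
have H20 : (0 <= H2)%E.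
  apply: le_ereal_inf_tmp => _ [j1 [j2 [_ _ _ ->]]].
  by apply: integral_ge0 => z _; rewrite lee_fin addr_ge0 ?sqr_ge0.
have H2fin : H2 \is a fin_num.
  by rewrite ge0_fin_numE// ltNge leye_eq; apply/eqP => E; move: Hfin; rewrite E poweRyr ?ltxx// invr_eq0.
have VE : torus_variation L u \is a fin_num by rewrite ge0_fin_numE.
set V := fine (torus_variation L u); set h := fine H2.
have V0' : 0 <= V by exact: fine_ge0.
have h0 : 0 <= h by exact: fine_ge0.
have X0 : (0 <= X)%E by apply: integral_ge0 => z _; rewrite lee_fin power_log_ge0.
(* The infimum need not be attained, so fields are taken with energy below an arbitrary h' > h. *)
have Xle lam h' : 0 < lam -> h < h' -> (X <= (C * (lam * V + h' / lam ^+ 2))%:E)%E.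
  move=> lam0 hh'.
  have : (H2 < h'%:E)%E by rewrite -(fineK H2fin) lte_fin.
  move=> /ereal_inf_lt[_ [j1 [j2 [[i1 _] [i2 _] jd ->]]] Jh'].
  by apply: (main L u j1 j2) => //; rewrite ?fineK// ltW.
have Xfin : X \is a fin_num.
  rewrite ge0_fin_numE//; apply: le_lt_trans (Xle 1 (h + 1) _ _) _ => //.
    by rewrite ltrDl.
  exact: ltry.
set x := fine X; have x0 : 0 <= x by exact: fine_ge0.
have x3 : x ^+ 3 <= (2 * C) ^+ 3 * (V ^+ 2 * h).
  apply: optimal_scale => // lam h' lam_gt0 hh'.
  by rewrite -lee_fin fineK// Xle.
rewrite -(fineK Xfin) -(fineK VE) -(fineK H2fin) -/x -/V -/h !poweR_EFin -!EFinM lee_fin.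
(* All exponents are written as fourth roots: [h] is the square of the dual norm, so its fourth root
   is the square root of that norm. *)
have -> : x `^ (3 / 4) = (x ^+ 3) `^ 4^-1 by rewrite -powR_mulrn// -powRrM.
have -> : V `^ (1 / 2) = (V ^+ 2) `^ 4^-1.
  by rewrite -powR_mulrn// -powRrM; congr (_ `^ _); field.
have -> : (h `^ 2^-1) `^ (1 / 2) = h `^ 4^-1.
  by rewrite -powRrM; congr (_ `^ _); field.
have D0 := ltW C8; have V2 : 0 <= V ^+ 2 by exact: exprn_ge0.
rewrite -(powRM _ D0 V2) -(powRM _ (mulr_ge0 D0 V2) h0).
apply: ge0_ler_powR.
- by rewrite invr_ge0.
- by rewrite nnegrE exprn_ge0.
- by rewrite nnegrE (mulr_ge0 (mulr_ge0 D0 V2) h0).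
- by rewrite -mulrA.
Qed.
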